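(* Let $V:\mathbb R^3\to\mathbb C^{4\times 4}$ be self-adjoint with $|V(x)|\lesssim\langle x\rangle^{-2-\varepsilon}$ for some $\varepsilon>0$. If $\phi\in L^2(\mathbb R^3)$ and $\phi\in\ker(T_0)$, then $\phi=Uv\psi$ where $\psi$ is a distributional solution of $\mathcal H\psi=0$ and $\psi\in L^2(\mathbb R^3)$; that is, $\psi$ is a zero-energy eigenfunction of $\mathcal H$ (when $\phi\ne0$). Furthermore, $\psi\in L^p(\mathbb R^3)$ for all $p\ge2$.
   Context: Function spaces consist of $\mathbb C^4$-valued functions on $\mathbb R^3$. $\langle x\rangle=(1+|x|^2)^{1/2}$; $|V(x)|\lesssim\langle x\rangle^{-\delta}$ means every entry satisfies this bound. $D_0=-i\alpha\cdot\nabla=-i\sum_{k=1}^3\alpha_k\partial_k$, where $\alpha_k=\begin{pmatrix}0&\sigma_k\\ \sigma_k&0\end{pmatrix}$ with $\sigma_1=\begin{pmatrix}0&-i\\ i&0\end{pmatrix}$, $\sigma_2=\begin{pmatrix}0&1\\1&0\end{pmatrix}$, $\sigma_3=\begin{pmatrix}1&0\\0&-1\end{pmatrix}$, and $\mathcal H=D_0+V$. Since $V(x)$ is Hermitian, write $V=B^*\Lambda B$ with $B(x)$ unitary and $\Lambda=\mathrm{diag}(\lambda_1,\dots,\lambda_4)$ real; set $U=\mathrm{diag}(\mathrm{sign}(\lambda_1),\dots,\mathrm{sign}(\lambda_4))$ (with values in $\{\pm1\}$, say $\mathrm{sign}(0)=1$), $v=|\Lambda|^{1/2}B$, so $V=v^*Uv$.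 $\mathcal G_0$ is the operator with matrix-valued kernel $\mathcal G_0(x,y)=\dfrac{i\,\alpha\cdot(x-y)}{4\pi|x-y|^3}$, i.e. $\mathcal G_0=-i\alpha\cdot\nabla(-\Delta)^{-1}$, and $T_0=U+v\mathcal G_0v^*$ on $L^2(\mathbb R^3)$. *)

(* Defs.v *)
From HB Require Import structures.
From mathcomp Require Import all_boot all_order all_algebra.
From mathcomp Require Import all_classical all_reals all_analysis.
From mathcomp Require Import complex.

Set Implicit Arguments.
Unset Strict Implicit.
Unset Printing Implicit Defensive.

Import Order.TTheory GRing.Theory Num.Theory.
Import numFieldNormedType.Exports.

Local Open Scope classical_set_scope.
Local Open Scope ring_scope.
Local Open Scope complex_scope.
Local Open Scope sesquilinear_scope.

(* [measurableTypeR R] is R with the Borel sigma-algebra on which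
   [lebesgue_measure] is defined; it unfolds to R, and its products carry the
   usual topology and vector space structure.  The library norm on products is
   the sup norm, hence the separate Euclidean norm [norm3] below. *)
Notation R3 R :=
  (measurableTypeR R * measurableTypeR R * measurableTypeR R)%type.
Notation C4 R := ('cV[R[i]]_4).
Notation M4 R := ('M[R[i]]_4).

Section Space.
Context {R : realType}.

Definition mu3 : {measure set (R3 R) -> \bar R} :=
  (lebesgue_measure \x lebesgue_measure \x lebesgue_measure)%E.

Definition coord3 (k : 'I_3) (x : R3 R) : R := [tuple x.1.1; x.1.2; x.2]`_k.

Definition basis3 (k : 'I_3) : R3 R :=
  ((k == 0 :> nat)%N%:R, (k == 1 :> nat)%N%:R, (k == 2 :> nat)%N%:R).

Definition norm3 (x : R3 R) : R := Num.sqrt (\sum_k coord3 k x ^+ 2).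

Definition japanese (x : R3 R) : R := Num.sqrt (1 + norm3 x ^+ 2).

Definition partial (k : 'I_3) (f : R3 R -> R) : R3 R -> R :=
  fun x => 'D_(basis3 k) f x.

(* C^infinity: every iterated partial derivative exists and is continuous. *)
Definition smooth3 (f : R3 R -> R) : Prop :=
  forall s : seq 'I_3, let g := foldr partial f s in
    continuous g /\ forall k x, derivable g x (basis3 k).

End Space.

Section Complex_valued.
Context {R : realType}.

Definition cmod (z : R[i]) : R := Num.sqrt (complex.Re z ^+ 2 + complex.Im z ^+ 2).

Definition normC4 (u : C4 R) : R := Num.sqrt (\sum_i cmod (u i 0) ^+ 2).

Definition cmeasurable (f : R3 R -> R[i]) : Prop :=
  measurable_fun setT (fun x => complex.Re (f x)) /\
  measurable_fun setT (fun x => complex.Im (f x)).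

Definition mxmeasurable m n (F : R3 R -> 'M[R[i]]_(m, n)) : Prop :=
  forall i j, cmeasurable (fun x => F x i j).

Definition cintegral (f : R3 R -> R[i]) : R[i] :=
  (\int[mu3]_x complex.Re (f x)) +i* (\int[mu3]_x complex.Im (f x)).

Definition vintegral (f : R3 R -> C4 R) : C4 R :=
  \col_i cintegral (fun x => f x i 0).

Definition memLp (p : \bar R) (f : R3 R -> C4 R) : Prop :=
  mxmeasurable f /\ ('N[mu3]_p [(fun x => (normC4 (f x))%:E)] < +oo)%E.

Definition ae_zero (f : R3 R -> C4 R) : Prop := {ae mu3, forall x, f x = 0}.

Definition locally_integrable3 (f : R3 R -> C4 R) : Prop :=
  mxmeasurable f /\
  forall K, compact K -> (\int[mu3]_(x in K) (normC4 (f x))%:E < +oo)%E.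

(* Test functions C_c^infinity(R^3; C). *)
Definition test_function (eta : R3 R -> R[i]) : Prop :=
  [/\ smooth3 (fun x => complex.Re (eta x)),
      smooth3 (fun x => complex.Im (eta x)) &
      compact (closure [set x | eta x != 0])].

Definition cpartial (k : 'I_3) (eta : R3 R -> R[i]) : R3 R -> R[i] :=
  fun x => partial k (fun y => complex.Re (eta y)) x
        +i* partial k (fun y => complex.Im (eta y)) x.

End Complex_valued.

Section Dirac.
Context {R : realType}.

Definition mx22 (a b c d : R[i]) : 'M[R[i]]_2 :=
  \matrix_(i, j) (if i == 0 then (if j == 0 then a else b)
                  else (if j == 0 then c else d)).

Definition pauli (k : 'I_3) : 'M[R[i]]_2 :=
  [tuple mx22 0 (- 'i%C) 'i%C 0; mx22 0 1 1 0; mx22 1 0 0 (- 1)]`_k.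

Definition alpha (k : 'I_3) : M4 R :=
  (block_mx 0 (pauli k) (pauli k) 0 : 'M[R[i]]_(2 + 2)).

(* C^4-valued distributions are represented by their action on complex test
   functions. *)
Definition vdist := (R3 R -> R[i]) -> C4 R.

Definition regular_dist (f : R3 R -> C4 R) : vdist :=
  fun eta => vintegral (fun x => eta x *: f x).

Definition dist_partial (k : 'I_3) (T : vdist) : vdist :=
  fun eta => - T (cpartial k eta).

Definition D0 (T : vdist) : vdist :=
  fun eta => - 'i%C *: \sum_k alpha k *m dist_partial k T eta.

Definition Hop (V : R3 R -> M4 R) (psi : R3 R -> C4 R) : vdist :=
  fun eta => D0 (regular_dist psi) eta
           + regular_dist (fun x => V x *m psi x) eta.

Definition distributional_solution (V : R3 R -> M4 R) (psi : R3 R -> C4 R)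
    : Prop :=
  [/\ locally_integrable3 psi,
      locally_integrable3 (fun x => V x *m psi x) &
      forall eta, test_function eta -> Hop V psi eta = 0].

Definition zero_energy_eigenfunction (V : R3 R -> M4 R) (psi : R3 R -> C4 R)
    : Prop :=
  [/\ memLp 2%:E psi, distributional_solution V psi & ~ ae_zero psi].

Definition decays (V : R3 R -> M4 R) (delta : R) : Prop :=
  exists c : R, forall x i j, cmod (V x i j) <= c * japanese x `^ (- delta).

Definition diag4 (l : 'rV[R]_4) : M4 R := diag_mx (\row_j (l 0 j)%:C).

(* The decomposition V = B^* Lambda B, with Lambda = diag(lam); B and lam are
   chosen measurably in x. *)
Definition diagonalizes (V : R3 R -> M4 R) (B : R3 R -> M4 R)
    (lam : R3 R -> 'rV[R]_4) : Prop :=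
  [/\ mxmeasurable B,
      forall j, measurable_fun setT (fun x => lam x 0 j),
      forall x, B x \is unitarymx &
      forall x, V x = (B x)^t* *m diag4 (lam x) *m B x].

(* Unlike [Num.sg], this sign takes the value 1 at 0. *)
Definition sign1 (t : R) : R := if 0 <= t then 1 else -1.

Definition Umx (l : 'rV[R]_4) : M4 R := diag4 (map_mx sign1 l).

Definition vmx (b : M4 R) (l : 'rV[R]_4) : M4 R :=
  diag4 (map_mx (fun t => Num.sqrt `|t|) l) *m b.

(* At x = y the scalar factor is 0, by the convention 0^-1 = 0. *)
Definition G0_kernel (x y : R3 R) : M4 R :=
  ('i%C * ((4 * pi * norm3 (x - y) ^+ 3)^-1)%:C)
    *: \sum_k (coord3 k (x - y))%:C *: alpha k.

Definition G0 (f : R3 R -> C4 R) : R3 R -> C4 R :=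
  fun x => vintegral (fun y => G0_kernel x y *m f y).

Definition T0 (B : R3 R -> M4 R) (lam : R3 R -> 'rV[R]_4) (phi : R3 R -> C4 R)
    : R3 R -> C4 R :=
  fun x => Umx (lam x) *m phi x
         + vmx (B x) (lam x)
             *m G0 (fun y => (vmx (B y) (lam y))^t* *m phi y) x.

Definition ker_T0 (B : R3 R -> M4 R) (lam : R3 R -> 'rV[R]_4)
    (phi : R3 R -> C4 R) : Prop :=
  memLp 2%:E phi /\ ae_zero (T0 B lam phi).

End Dirac.

(* Main.v *)
Require Import Defs.
From HB Require Import structures.
From mathcomp Require Import all_boot all_order all_algebra.
From mathcomp Require Import all_classical all_reals all_analysis.
From mathcomp Require Import measurable_realfun ess_sup_inf.
From mathcomp Require Import complex.
From mathcomp Require Import ring lra.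

(** Put [f = v^* phi] and [psi = - G0 f]. The equation [T0 phi = 0] says
[U phi = v psi], and [U^2 = 1] turns it into [phi = U v psi], so that
[V psi = v^* U v psi = f] almost everywhere. Two facts remain: [psi] is bounded
and square integrable, hence in every [L^p] with [p >= 2]; and
[- i alpha . grad psi = - f] as distributions, which with [V psi = f] is
[H psi = 0]. Finally [psi = 0] a.e. would force [phi = U v psi = 0] a.e.

_Size of psi._ The kernel of [G0] is at most a constant times [|x-y|^-2], and the
entries of [v] are at most a constant times [<x>^-1]. As [|z|^2 >= z_k^2] for each
of the three coordinates, [|z|^-2 <= prod_k |z_k|^(-2/3)] and likewise
[<x>^-1 <= prod_k (1 + x_k^2)^(-1/6)]. These product majorants ([kappa3] and
[beta3]) reduce every kernel estimate in space to one-dimensional integrals of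
[|s-t|^-a |t-r|^-b] ([riesz_compose]). Let
[H(x) = int kappa3(x,y) beta3(y) |phi(y)| dy] ([riesz]). Then [|psi| <= C H], and
by [phi = U v psi] also [|phi| <= C H] a.e. The Schur test with the weight
[prod_k |x_k|^(-1/2)] puts [H] in [L^2] ([riesz_L2]). Inserting [|phi| <= C H]
into the definition of [H] bounds [H] by an integral with the iterated kernel
[int kappa3(x,y) kappa3(y,z) dy <= C prod_k |x_k - z_k|^(-1/3)]; times [beta3] this
is square integrable in [z] uniformly in [x], so the Cauchy-Schwarz inequality
bounds [H] everywhere ([riesz_sup], [riesz_bootstrap]).

_The equation._ For a test function [eta] let
[N_km(y) = int d_k eta(x) (x-y)_m / |x-y|^3 dx] ([newton]). This matrix is symmetric
and has trace [- 4 pi eta(y)] ([newton_sym], [newton_trace]). Both are seen on the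
smooth vector field [z_m / (|z|^2 + e^2)^(3/2)]: its Jacobian is symmetric, and its
divergence [3 e^2 / (|z|^2 + e^2)^(5/2)] is a bump of total mass [4 pi]
concentrating at [0] as [e] tends to [0]. By Fubini's theorem [D0 psi] tested against
[eta] equals [(4 pi)^-1 sum_km alpha_k alpha_m int N_km f]. Because [N] is symmetric,
the relation [alpha_k alpha_m + alpha_m alpha_k = 2 delta_km] leaves only its trace,
and the value is [- int eta f] ([D0_G0]). *)

Set Implicit Arguments.
Unset Strict Implicit.
Unset Printing Implicit Defensive.

Import Order.TTheory GRing.Theory Num.Theory.
Import numFieldNormedType.Exports.

Local Open Scope classical_set_scope.
Local Open Scope ring_scope.
(** * Lebesgue measure on space is sigma-finite *)

Section SigmaFinite.
Context {R : realType}.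

Lemma product_measure_sigma_finite d1 d2 (T1 : measurableType d1) (T2 : measurableType d2)
    (m1 : {sigma_finite_measure set T1 -> \bar R})
    (m2 : {sigma_finite_measure set T2 -> \bar R}) :
  sigma_finite setT (m1 \x m2)%E.
Proof.
have /sigma_finiteP[F [TF ndF Foo]] := sigma_finiteT m1.
have /sigma_finiteP[G [TG ndG Goo]] := sigma_finiteT m2.
exists (fun n => F n `*` G n).
  rewrite -setXTT TF TG predeqE => -[x y]; split.
    move=> [/= [n _ Fnx] [k _ Gky]]; exists (maxn n k) => //; split.
    - by move: x Fnx; exact/subsetPset/ndF/leq_maxl.
    - by move: y Gky; exact/subsetPset/ndG/leq_maxr.
  by move=> [n _ []/= ? ?]; split; exists n.
move=> k; have [? ?] := Foo k; have [? ?] := Goo k.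
split; first exact: measurableX.
by rewrite product_measure1E// lte_mul_pinfty// ge0_fin_numE.
Qed.

(** A named copy of the product of two Lebesgue measures, on which the
    sigma-finiteness needed by Fubini's theorem can be registered. *)
Definition lebesgue2 : set (measurableTypeR R * measurableTypeR R) -> \bar R :=
  (lebesgue_measure \x lebesgue_measure)%E.

HB.instance Definition _ := Measure.on lebesgue2.
HB.instance Definition _ := @Measure_isSigmaFinite.Build _ _ _ lebesgue2
  (product_measure_sigma_finite lebesgue_measure lebesgue_measure).

(** Convertible to [mu3], but registered as sigma-finite, so that Tonelli and
    Fubini apply to pairs of points of space. *)
Definition volume : set (R3 R) -> \bar R := (lebesgue2 \x lebesgue_measure)%E.

HB.instance Definition _ := Measure.on volume.
HB.instance Definition _ := @Measure_isSigmaFinite.Build _ _ _ volume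
  (product_measure_sigma_finite lebesgue2 lebesgue_measure).

End SigmaFinite.

(** * Integrals of powers on the line *)

Section OneDim.
Context {R : realType}.
Local Notation leb := (@lebesgue_measure R).
Local Open Scope ereal_scope.

Lemma ge0_integral_translate (f : R -> \bar R) (s : R) :
  measurable_fun setT f -> (forall t, 0 <= f t) ->
  \int[leb]_t f (t - s)%R = \int[leb]_t f t.
Proof.
move=> mf f0.
have mphi : measurable_fun setT ((fun t => (t - s)%R) : R -> measurableTypeR R).
  exact: measurable_funB.
rewrite [RHS](eq_measure_integral (pushforward leb ((fun t => (t - s)%R) : R -> measurableTypeR R))).
  by rewrite ge0_integral_pushforward.
move=> A mA _; apply: lebesgue_measure_unique => //= _ [[a b]] _ <-.
rewrite /pushforward (_ : _ @^-1` _ = `]a + s, b + s]%classic)%R.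
  rewrite !lebesgue_measure_itv/= !lte_fin ltrD2r -!EFinB.
  by rewrite opprD addrACA subrr addr0.
by apply/seteqP; split => t /=; rewrite !in_itv/= ltrBrDr lerBlDr.
Qed.

Lemma ge0_integral_reflect (f : R -> \bar R) (s : R) :
  measurable_fun setT f -> (forall t, 0 <= f t) ->
  \int[leb]_t f (s - t)%R = \int[leb]_t f t.
Proof.
move=> mf f0.
have mphi : measurable_fun setT ((fun t => (s - t)%R) : R -> measurableTypeR R).
  exact: measurable_funB.
have mN : measurable_fun setT ((fun t => (- t)%R) : R -> measurableTypeR R).
  exact: measurableT_comp.
have E : \int[leb]_t f t = \int[leb]_t f (- t)%R.
  rewrite [LHS](eq_measure_integral (pushforward leb ((fun t => (- t)%R) : R -> measurableTypeR R))).
    by rewrite ge0_integral_pushforward.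
  by move=> A mA _; apply/esym/lebesgue_measureN.
rewrite E.
rewrite -(@ge0_integral_translate (fun t => f (- t)%R) s)//.
- by apply: eq_integral => t _; rewrite opprB.
- exact: measurableT_comp.
Qed.

(** The singular part of [|t|^-a], integrable for [a < 1]; with [farpow], the part
    integrable at infinity, it splits a power at distance [rho] from its singularity. *)
Definition nearpow (a rho t : R) : R := if (`|t| < rho)%R then (`|t| `^ (- a))%R else 0%R.
Definition farpow (c rho t : R) : R := if (rho <= `|t|)%R then (`|t| `^ (- c))%R else 0%R.

Lemma nearpow_ge0 a rho t : (0 <= nearpow a rho t)%R.
Proof. by rewrite /nearpow; case: ifP => // _; exact: powR_ge0. Qed.

Lemma farpow_ge0 c rho t : (0 <= farpow c rho t)%R.
Proof. by rewrite /farpow; case: ifP => // _; exact: powR_ge0. Qed.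

Lemma measurable_norm_powR a : measurable_fun setT (fun t : R => `|t| `^ a)%R.
Proof.
apply: (measurableT_comp (measurable_powR _)).
exact: normr_measurable.
Qed.

Lemma measurable_nearpow a rho : measurable_fun setT (nearpow a rho).
Proof.
apply: measurable_fun_ifT => //.
  by apply: measurable_fun_ltr => //; exact: normr_measurable.
exact: measurable_norm_powR.
Qed.

Lemma measurable_farpow a rho : measurable_fun setT (farpow a rho).
Proof.
apply: measurable_fun_ifT => //.
  by apply: measurable_fun_ler => //; exact: normr_measurable.
exact: measurable_norm_powR.
Qed.

Lemma ge0_integral_le_even (g h : R -> R) (C : R) :
  measurable_fun setT g -> measurable_fun setT h ->
  (forall t, 0 <= g t)%R -> (forall t, 0 <= h t)%R ->
  (forall t, h t <= g t + g (- t))%R ->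
  \int[leb]_t (g t)%:E <= C%:E ->
  \int[leb]_t (h t)%:E <= (2 * C)%:E.
Proof.
move=> mg mh g0 h0 hg gC.
have mgN : measurable_fun setT (fun t : R => (g (0 - t)%R)%:E).
  apply/measurable_EFinP; apply: (measurableT_comp mg).
  exact: measurable_funB.
apply: (@le_trans _ _ (\int[leb]_t ((g t)%:E + (g (0 - t)%R)%:E))).
  apply: ge0_le_integral => //.
  - by move=> t _; rewrite lee_fin.
  - exact/measurable_EFinP.
  - by apply: emeasurable_funD => //; exact/measurable_EFinP.
  - by move=> t _; rewrite -EFinD lee_fin sub0r.
rewrite ge0_integralD//.
- rewrite (@ge0_integral_reflect (fun t => (g t)%:E) 0) //.
  + by rewrite mulr_natl mulr2n EFinD leeD.
  + exact/measurable_EFinP.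
- by move=> t _; rewrite lee_fin.
- exact/measurable_EFinP.
- by move=> t _; rewrite lee_fin.
Qed.

Lemma powRN_cvgy (p : R) : (0 < p)%R -> (t `^ (- p))%R @[t --> +oo%R] --> 0%R.
Proof.
move=> p0; apply/cvgr0Pnorm_le => e e0; near=> t.
have t0 : (e `^ (- p^-1) <= t)%R by near: t; apply: nbhs_pinfty_ge; rewrite num_real.
rewrite ger0_norm ?powR_ge0// powRN.
have -> : e = ((e `^ (- p^-1)) `^ p)^-1%R.
  by rewrite -powRrM mulNr mulVf ?gt_eqF// powRN powRr1 ?ltW// invrK.
have h0 : (0 < e `^ (- p^-1))%R by exact: powR_gt0.
rewrite lef_pV2 ?posrE; last 2 first.
- by apply: powR_gt0; exact: lt_le_trans t0.
- exact: powR_gt0.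
by apply: ge0_ler_powR => //; rewrite ?nnegrE ?ltW// (lt_le_trans h0).
Unshelve. all: by end_near. Qed.

Lemma continuous_powR_gt0 (p x : R) : (0 < x)%R -> {for x, continuous (fun t : R => t `^ p)%R}.
Proof.
move=> x0; apply/differentiable_continuous/derivable1_diffP.
by apply: derivable_powR; rewrite in_itv/= x0.
Qed.

Lemma is_derive_powR_primitive (c x : R) : (c != 1)%R -> (0 < x)%R ->
  is_derive x 1%R (fun t : R => t `^ (1 - c) / (1 - c))%R (x `^ (- c))%R.
Proof.
move=> c1 x0.
have c10 : (1 - c != 0)%R by rewrite subr_eq0 eq_sym.
have := is_derive1_powR (1 - c) x0 => h.
have -> : (fun t : R => t `^ (1 - c) / (1 - c))%R = (fun t : R => ((1 - c)^-1 *: (t `^ (1 - c))))%R.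
  by apply/funext => t; rewrite /GRing.scale/= mulrC.
apply: is_derive_eq.
rewrite /GRing.scale/= mulrA mulVf// mul1r; congr (_ `^ _)%R; ring.
Qed.

Lemma integral_farpow (c rho : R) : (1 < c)%R -> (0 < rho)%R ->
  \int[leb]_t (farpow c rho t)%:E <= (2 * (rho `^ (1 - c) / (c - 1)))%:E.
Proof.
move=> c1 rho0.
pose g (t : R) := if (rho <= t)%R then (t `^ (- c))%R else 0%R.
have mg : measurable_fun setT g.
  apply: measurable_fun_ifT => //; first exact: measurable_fun_ler.
apply: (@ge0_integral_le_even g) => //.
- exact: measurable_farpow.
- by move=> t; rewrite /g; case: ifP => // _; exact: powR_ge0.
- exact: farpow_ge0.
- move=> t; rewrite /farpow /g.
  have [t0|t0] := leP 0%R t.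
    rewrite ger0_norm//; case: ifPn => rt.
      by rewrite lerDl; case: ifP => // _; exact: powR_ge0.
    by rewrite add0r; case: ifP => // _; exact: powR_ge0.
  rewrite ltr0_norm//; case: ifPn => rt.
    by rewrite lerDr; case: ifP => // _; exact: powR_ge0.
  by rewrite addr0; case: ifP => // _; exact: powR_ge0.
have -> : \int[leb]_t (g t)%:E = \int[leb]_(t in `[rho, +oo[) (t `^ (- c))%:E.
  rewrite [RHS]integral_mkcond; apply: eq_integral => t _.
  rewrite /patch /g mem_setE in_itv/= andbT.
  by case: ifP.
have c10 : (1 - c < 0)%R by rewrite subr_lt0.
have cN1 : (c != 1)%R by rewrite gt_eqF.
have pos (x : R) : (rho <= x)%R -> (0 < x)%R by exact: lt_le_trans.
rewrite (@ge0_continuous_FTC2y _ _ (fun t => (t `^ (1 - c) / (1 - c)))%R _ 0%R).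
- by rewrite sub0e -EFinN -mulrN -invrN opprB.
- by move=> x _; exact: powR_ge0.
- apply: continuous_in_subspaceT => x; rewrite inE/= in_itv/= andbT => /pos x0.
  exact: continuous_powR_gt0.
- rewrite -(mul0r ((1 - c)^-1)%R); apply: cvgMl.
  by rewrite -opprB; apply: powRN_cvgy; rewrite subr_gt0.
- by move=> x /ltW/pos x0; apply: ex_derive; exact: is_derive_powR_primitive.
- apply: cvg_at_right_filter; apply: cvgMl; exact: continuous_powR_gt0.
- move=> x; rewrite in_itv/= andbT => /ltW/pos x0; rewrite derive1E.
  by have [_ ->] := is_derive_powR_primitive cN1 x0.
Qed.

(** The fundamental theorem of calculus applies on [[1/n, rho]], away from the
    singularity; monotone convergence reaches [0]. *)
Lemma integral_nearpow (a rho : R) : (0 < a < 1)%R -> (0 < rho)%R ->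
  \int[leb]_t (nearpow a rho t)%:E <= (2 * (rho `^ (1 - a) / (1 - a)))%:E.
Proof.
move=> /andP[a0 a1] rho0.
pose g (t : R) := if (0 < t < rho)%R then (t `^ (- a))%R else 0%R.
have g0 t : (0 <= g t)%R by rewrite /g; case: ifP => // _; exact: powR_ge0.
have mg : measurable_fun setT g.
  apply: measurable_fun_ifT => //; apply: measurable_and; exact: measurable_fun_ltr.
apply: (@ge0_integral_le_even g) => //.
- exact: measurable_nearpow.
- exact: nearpow_ge0.
- move=> t; rewrite /nearpow /g oppr_gt0.
  have [t0|t0|->] := ltgtP t 0%R.
  + by rewrite ltr0_norm// add0r.
  + by rewrite gtr0_norm// addr0.
  + by rewrite normr0 powR0 ?oppr_eq0 ?gt_eqF// if_same addr0.
(* Truncations away from the singularity, increasing to [g]. *)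
pose G n t := if (n.+1%:R^-1 <= t < rho)%R then (t `^ (- a))%R else 0%R.
have G0 n t : (0 <= G n t)%R by rewrite /G; case: ifP => // _; exact: powR_ge0.
have mG n : measurable_fun setT (G n).
  apply: measurable_fun_ifT => //; apply: measurable_and.
    exact: measurable_fun_ler.
  exact: measurable_fun_ltr.
have Gg t : limn (fun n => (G n t)%:E) = (g t)%:E.
  apply/cvg_lim => //; apply: cvg_near_cst.
  have [t0|t0] := leP t 0%R.
    apply: nearW => n; rewrite /G /g (le_gtF t0)/= (lt_geF (le_lt_trans t0 _))//.
  near=> n; rewrite /G /g t0/=; suff -> : (n.+1%:R^-1 <= t)%R by [].
  by apply/ltW; near: n; exact: (near_infty_natSinv_lt (PosNum t0)).
under eq_integral do rewrite -Gg.
rewrite monotone_convergence//; last 3 first.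
- by move=> n; apply/measurable_EFinP; exact: mG.
- by move=> n t _; rewrite lee_fin.
- move=> t _ m n mn; rewrite lee_fin /G.
  case: ifPn => [/andP[tm ->]|_]; last by case: ifP => // _; exact: powR_ge0.
  by rewrite (le_trans _ tm)// lef_pV2 ?posrE// ler_nat.
apply: lime_le.
  apply: ereal_nondecreasing_is_cvgn => m n mn; apply: ge0_le_integral => //.
  - by move=> t _; rewrite lee_fin.
  - apply/measurable_EFinP; exact: mG.
  - apply/measurable_EFinP; exact: mG.
  - move=> t _; rewrite lee_fin /G.
    case: ifPn => [/andP[tm ->]|_]; last by case: ifP => // _; exact: powR_ge0.
    by rewrite (le_trans _ tm)// lef_pV2 ?posrE// ler_nat.
apply: nearW => n.
pose d : R := (n.+1%:R^-1)%R.
have d0 : (0 < d)%R by rewrite invr_gt0.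
have a10 : (0 < 1 - a)%R by rewrite subr_gt0.
have C0 : (0 <= rho `^ (1 - a) / (1 - a))%R by rewrite divr_ge0 ?powR_ge0// ltW.
have [rd|dr] := leP rho d.
  rewrite integral0_eq ?lee_fin// => t _; rewrite /G -/d.
  by case: ifPn => // /andP[dt tr]; move: (lt_le_trans (le_lt_trans dt tr) rd); rewrite ltxx.
apply: (@le_trans _ _ (\int[leb]_(t in `[d, rho]) (t `^ (- a))%:E)).
  rewrite [leRHS]integral_mkcond; apply: ge0_le_integral => //.
  - by move=> t _; rewrite lee_fin.
  - apply/measurable_EFinP; exact: mG.
  - apply/(measurable_restrictT _ _).1 => //; apply/measurable_EFinP; exact: measurable_funTS.
  - move=> t _; rewrite /G -/d /patch mem_setE in_itv/=; case: ifPn => [/andP[-> /ltW ->]//|_].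
    by case: ifP => //; rewrite lee_fin powR_ge0.
have pos (x : R) : (d <= x)%R -> (0 < x)%R by exact: lt_le_trans.
have aN1 : (a != 1)%R by rewrite lt_eqF.
rewrite (@continuous_FTC2 _ _ (fun t => (t `^ (1 - a) / (1 - a)))%R)//.
- by rewrite -EFinD lee_fin gerBl divr_ge0 ?powR_ge0// ltW.
- apply: continuous_in_subspaceT => x; rewrite inE/= in_itv/= => /andP[/pos x0 _].
  exact: continuous_powR_gt0.
- split.
  + move=> x; rewrite in_itv/= => /andP[/ltW/pos x0 _]; apply: ex_derive; exact: is_derive_powR_primitive.
  + apply: cvg_at_right_filter; apply: cvgMl; exact: continuous_powR_gt0.
  + apply: cvg_at_left_filter; apply: cvgMl; exact: continuous_powR_gt0.
- move=> x; rewrite in_itv/= => /andP[/ltW/pos x0 _]; rewrite derive1E.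
  by have [_ ->] := is_derive_powR_primitive aN1 x0.
Unshelve. all: by end_near. Qed.

End OneDim.

(** * Composition of Riesz kernels on the line *)

Section IntLe.
Context d (T : measurableType d) {R : realType} (mu : {measure set T -> \bar R}).

(** Upper bounds of integrals of nonnegative functions are carried around as one
    predicate, closed under sums, scaling, domination, translation and products; it
    spares the repeated measurability and sign conditions of the integral lemmas. *)
Definition ge0_int_le (f : T -> R) (C : R) : Prop :=
  [/\ measurable_fun setT f, forall t, 0 <= f t &
      (\int[mu]_t (f t)%:E <= C%:E)%E].

Lemma ge0_int_leD f g A B : ge0_int_le f A -> ge0_int_le g B ->
  ge0_int_le (fun t => f t + g t) (A + B).
Proof.
move=> [mf f0 fA] [mg g0 gB]; split.
- exact: measurable_funD.
- by move=> t; exact: addr_ge0.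
- under eq_integral do rewrite EFinD.
  rewrite ge0_integralD//; first by rewrite EFinD leeD.
  + by move=> t _; rewrite lee_fin.
  + exact/measurable_EFinP.
  + by move=> t _; rewrite lee_fin.
  + exact/measurable_EFinP.
Qed.

Lemma ge0_int_leZ f k A : 0 <= k -> ge0_int_le f A ->
  ge0_int_le (fun t => k * f t) (k * A).
Proof.
move=> k0 [mf f0 fA]; split.
- exact: measurable_funM.
- by move=> t; exact: mulr_ge0.
- under eq_integral do rewrite EFinM.
  rewrite ge0_integralZl//; first by rewrite EFinM lee_wpmul2l// lee_fin.
  + exact/measurable_EFinP.
  + by move=> t _; rewrite lee_fin.
Qed.

Lemma ge0_int_le_le (f g : T -> R) (A B : R) : measurable_fun setT g -> (forall t, 0 <= g t <= f t) ->
  A <= B -> ge0_int_le f A -> ge0_int_le g B.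
Proof.
move=> mg gf AB [mf f0 fA]; split => //.
- by move=> t; case/andP: (gf t).
- apply: (@le_trans _ _ A%:E) => //; apply: le_trans fA.
  apply: ge0_le_integral => //.
  + by move=> t _; rewrite lee_fin; case/andP: (gf t).
  + exact/measurable_EFinP.
  + exact/measurable_EFinP.
  + by move=> t _; rewrite lee_fin; case/andP: (gf t).
Qed.

End IntLe.

Section Riesz.
Context {R : realType}.
Local Notation leb := (@lebesgue_measure R).
Local Notation "f <=I C" := (@ge0_int_le _ (measurableTypeR R) R leb f C) (at level 70).

Lemma ge0_int_le_translate (f : R -> R) s C : (f <=I C) -> ((fun t : R => f (t - s)) <=I C).
Proof.
move=> [mf f0 fC]; split => //.
- apply: (measurableT_comp mf); exact: measurable_funB.
- rewrite (@ge0_integral_translate _ (fun t => (f t)%:E))//.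
  by apply/measurable_EFinP; exact: mf.
Qed.

Lemma ge0_int_le_nearpow (a rho : R) : 0 < a < 1 -> 0 < rho ->
  nearpow a rho <=I 2 * (rho `^ (1 - a) / (1 - a)).
Proof.
move=> ha r0; split; [exact: measurable_nearpow|exact: nearpow_ge0|exact: integral_nearpow].
Qed.

Lemma ge0_int_le_farpow (c rho : R) : 1 < c -> 0 < rho ->
  farpow c rho <=I 2 * (rho `^ (1 - c) / (c - 1)).
Proof.
move=> ha r0; split; [exact: measurable_farpow|exact: farpow_ge0|exact: integral_farpow].
Qed.

Lemma ler_powRN (p x y : R) : 0 <= p -> 0 < x -> x <= y -> y `^ (- p) <= x `^ (- p).
Proof.
move=> p0 x0 xy; have y0 := lt_le_trans x0 xy.
rewrite !powRN lef_pV2 ?posrE ?powR_gt0//.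
by apply: ge0_ler_powR => //; rewrite nnegrE ltW.
Qed.

(** Cut at [rho], half the distance between the two singularities. Within [rho] of
    one of them the other factor is at most [rho^-b] or [rho^-a]. Far from both, the
    product is at most the power [a + b] of the inverse of the smaller distance, hence
    at most the sum of the two far powers. *)
Lemma riesz_pointwise (a b s r t rho : R) : 0 < a -> 0 < b -> s != r ->
  rho = `|s - r| / 2 ->
  `|s - t| `^ (- a) * `|t - r| `^ (- b) <=
  (rho `^ (- b) * nearpow a rho (t - s) + rho `^ (- a) * nearpow b rho (t - r))
  + (farpow (a + b) rho (t - s) + farpow (a + b) rho (t - r)).
Proof.
move=> a0 b0 sr rhoE.
have d0 : 0 < `|s - r| by rewrite normr_gt0 subr_eq0.
have r0 : 0 < rho by rewrite rhoE divr_gt0.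
have tri : `|s - r| <= `|t - s| + `|t - r|.
  by rewrite -[`|t - s|]normrN opprB; apply: le_trans (ler_normD _ _); rewrite addrA subrK.
rewrite -[`|s - t|]normrN opprB.
have P0 x e : 0 <= `|x : R| `^ e by exact: powR_ge0.
have [ts|ts] := ltP `|t - s| rho.
  apply: (@le_trans _ _ (rho `^ (- b) * nearpow a rho (t - s))); last first.
    by rewrite -addrA lerDl !addr_ge0 ?mulr_ge0 ?nearpow_ge0 ?farpow_ge0 ?powR_ge0.
  rewrite /nearpow ts mulrC ler_wpM2r//; apply: ler_powRN => //; first exact: ltW.
  rewrite rhoE in ts *; lra.
have [tr|tr] := ltP `|t - r| rho.
  apply: (@le_trans _ _ (rho `^ (- a) * nearpow b rho (t - r))); last first.
    by rewrite -addrA addrCA lerDl !addr_ge0 ?mulr_ge0 ?nearpow_ge0 ?farpow_ge0 ?powR_ge0.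
  by rewrite /nearpow tr ler_wpM2r//; apply: ler_powRN => //; exact: ltW.
apply: (@le_trans _ _ (farpow (a + b) rho (t - s) + farpow (a + b) rho (t - r))); last first.
  by rewrite lerDr !addr_ge0 ?mulr_ge0 ?nearpow_ge0 ?farpow_ge0 ?powR_ge0.
rewrite /farpow ts tr.
have ts0 : 0 < `|t - s| by exact: lt_le_trans ts.
have tr0 : 0 < `|t - r| by exact: lt_le_trans tr.
rewrite opprD !powRD ?(gt_eqF ts0) ?(gt_eqF tr0) ?implybT//.
have [h|/ltW h] := leP `|t - s| `|t - r|.
  apply: (@le_trans _ _ (`|t - s| `^ (- a) * `|t - s| `^ (- b))).
    by rewrite ler_wpM2l// ler_powRN// ltW.
  by rewrite lerDl mulr_ge0.
apply: (@le_trans _ _ (`|t - r| `^ (- a) * `|t - r| `^ (- b))).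
  by rewrite ler_wpM2r// ler_powRN// ltW.
by rewrite lerDr mulr_ge0.
Qed.

Lemma measurable_norm_powRB (a s : R) : measurable_fun setT (fun t : R => `|t - s| `^ a).
Proof.
apply: (measurableT_comp (measurable_norm_powR a)); exact: measurable_funB.
Qed.

(** The three regions of [riesz_pointwise] contribute constants times the same power
    [rho^(1-a-b)]: the near parts because [a, b < 1], the far parts because
    [a + b > 1]. *)
Lemma riesz_compose (a b : R) : 0 < a < 1 -> 0 < b < 1 -> 1 < a + b ->
  exists2 C : R, 0 < C & forall s r : R, s != r ->
   (fun t : R => `|s - t| `^ (- a) * `|t - r| `^ (- b)) <=I C * `|s - r| `^ (1 - (a + b)).
Proof.
move=> ha hb ab; case/andP: (ha) => a0 a1; case/andP: (hb) => b0 b1.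
exists ((2 / (1 - a) + 2 / (1 - b) + 4 / (a + b - 1)) * 2^-1 `^ (1 - (a + b))).
  rewrite mulr_gt0 ?powR_gt0// !addr_gt0 ?divr_gt0//; lra.
move=> s r sr.
set rho := `|s - r| / 2.
have d0 : 0 < `|s - r| by rewrite normr_gt0 subr_eq0.
have r0 : 0 < rho by rewrite divr_gt0.
have rN : rho != 0 by rewrite gt_eqF.
have H1 := ge0_int_leZ (powR_ge0 rho (- b)) (ge0_int_le_translate s (ge0_int_le_nearpow ha r0)).
have H2 := ge0_int_leZ (powR_ge0 rho (- a)) (ge0_int_le_translate r (ge0_int_le_nearpow hb r0)).
have H3 := ge0_int_le_translate s (ge0_int_le_farpow ab r0).
have H4 := ge0_int_le_translate r (ge0_int_le_farpow ab r0).
have H := ge0_int_leD (ge0_int_leD H1 H2) (ge0_int_leD H3 H4).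
apply: ge0_int_le_le H.
- apply: measurable_funM; last exact: measurable_norm_powRB.
  under eq_fun do rewrite -normrN opprB.
  exact: measurable_norm_powRB.
- by move=> t; rewrite mulr_ge0 ?powR_ge0//=; exact: riesz_pointwise.
rewrite -mulrA -powRM// ?(ltW d0)// (mulrC _ `|s - r|) -/rho.
have E1 : rho `^ (- b) * rho `^ (1 - a) = rho `^ (1 - (a + b)).
  by rewrite -powRD ?rN ?implybT//; congr (_ `^ _); ring.
have E2 : rho `^ (- a) * rho `^ (1 - b) = rho `^ (1 - (a + b)).
  by rewrite -powRD ?rN ?implybT//; congr (_ `^ _); ring.
rewrite le_eqVlt; apply/orP; left; apply/eqP.
rewrite (_ : _ * (2 * (_ / (1 - a))) = 2 / (1 - a) * (rho `^ (- b) * rho `^ (1 - a))); last by ring.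
rewrite (_ : _ * (2 * (_ / (1 - b))) = 2 / (1 - b) * (rho `^ (- a) * rho `^ (1 - b))); last by ring.
rewrite E1 E2; ring.
Qed.

End Riesz.

(** * Product functions on space *)

Section Product3.
Context {R : realType}.
Local Notation leb := (@lebesgue_measure R).
Local Notation "f <=I C" := (@ge0_int_le _ (measurableTypeR R) R leb f C) (at level 70).
Local Notation "f <=I3 C" := (@ge0_int_le _ (R3 R) R mu3 f C) (at level 70).
Local Open Scope ereal_scope.

Lemma ge0_integral_mu3 (f : R3 R -> \bar R) :
  measurable_fun setT f -> (forall x, 0 <= f x) ->
  \int[mu3]_x f x = \int[leb]_x1 \int[leb]_x2 \int[leb]_x3 f (x1, x2, x3).
Proof.
move=> mf f0.
rewrite -(@fubini_tonelli1 _ _ _ _ _ leb leb (fun x => \int[leb]_x3 f (x, x3))).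
- exact: (@fubini_tonelli1 _ _ _ _ _ lebesgue2 leb f).
- exact: (@measurable_fun_fubini_tonelli_F _ _ _ _ _ leb f).
- by move=> x; apply: integral_ge0.
Qed.

Lemma mu3_tonelli (f : R3 R * R3 R -> \bar R) :
  measurable_fun setT f -> (forall x, 0 <= f x) ->
  \int[mu3]_x \int[mu3]_y f (x, y) = \int[mu3]_y \int[mu3]_x f (x, y).
Proof. by move=> mf f0; exact: (@fubini_tonelli _ _ _ _ _ volume volume f). Qed.

Lemma measurable_mu3_integral (f : R3 R * R3 R -> \bar R) :
  measurable_fun setT f -> (forall x, 0 <= f x) ->
  measurable_fun setT (fun x => \int[mu3]_y f (x, y)).
Proof. by move=> mf f0; exact: (@measurable_fun_fubini_tonelli_F _ _ _ _ _ volume f). Qed.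

Definition tensor (g1 g2 g3 : R -> R) (x : R3 R) : R :=
  (g1 x.1.1 * g2 x.1.2 * g3 x.2)%R.

Lemma measurable_coord1 : measurable_fun setT (fun x : R3 R => x.1.1).
Proof. exact: (measurableT_comp measurable_fst measurable_fst). Qed.
Lemma measurable_coord2 : measurable_fun setT (fun x : R3 R => x.1.2).
Proof. exact: (measurableT_comp measurable_snd measurable_fst). Qed.
Lemma measurable_coord3 : measurable_fun setT (fun x : R3 R => x.2).
Proof. exact: measurable_snd. Qed.

Lemma measurable_tensor (g1 g2 g3 : R -> R) : measurable_fun setT g1 ->
  measurable_fun setT g2 -> measurable_fun setT g3 ->
  measurable_fun setT (tensor g1 g2 g3).
Proof.
move=> m1 m2 m3; apply: measurable_funM; first apply: measurable_funM.
- exact: (measurableT_comp m1 measurable_coord1).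
- exact: (measurableT_comp m2 measurable_coord2).
- exact: (measurableT_comp m3 measurable_coord3).
Qed.

Lemma tensor_ge0 (g1 g2 g3 : R -> R) x : (forall t, 0 <= g1 t)%R ->
  (forall t, 0 <= g2 t)%R -> (forall t, 0 <= g3 t)%R -> (0 <= tensor g1 g2 g3 x)%R.
Proof. by move=> h1 h2 h3; rewrite /tensor !mulr_ge0. Qed.

(** This product formula is the reason for majorizing the kernels by products of
    functions of one coordinate. *)
Lemma integral_tensor (g1 g2 g3 : R -> R) : measurable_fun setT g1 ->
  measurable_fun setT g2 -> measurable_fun setT g3 ->
  (forall t, 0 <= g1 t)%R -> (forall t, 0 <= g2 t)%R -> (forall t, 0 <= g3 t)%R ->
  \int[mu3]_x (tensor g1 g2 g3 x)%:E =
  \int[leb]_t (g1 t)%:E * \int[leb]_t (g2 t)%:E * \int[leb]_t (g3 t)%:E.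
Proof.
move=> m1 m2 m3 h1 h2 h3.
have e (g : R -> R) : measurable_fun setT g -> measurable_fun [set: measurableTypeR R] (fun t => (g t)%:E).
  by move=> mg; apply/measurable_EFinP; exact: mg.
rewrite ge0_integral_mu3; last 2 first.
- by apply/measurable_EFinP; exact: measurable_tensor.
- by move=> x; rewrite lee_fin tensor_ge0.
transitivity (\int[leb]_x1 ((g1 x1)%:E * (\int[leb]_x2 ((g2 x2)%:E * \int[leb]_t (g3 t)%:E)))).
  apply: eq_integral => x1 _; rewrite -ge0_integralZl//; last 3 first.
  - by apply: emeasurable_funM => //; exact: e.
  - by move=> x _; rewrite mule_ge0 ?lee_fin// integral_ge0// => t _; rewrite lee_fin.
  - by rewrite lee_fin.
  apply: eq_integral => x2 _; rewrite muleA -EFinM -ge0_integralZl//.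
  - exact: e.
  - by move=> t _; rewrite lee_fin.
  - by rewrite lee_fin mulr_ge0.
have I3 : 0 <= \int[leb]_t (g3 t)%:E by apply: integral_ge0 => t _; rewrite lee_fin.
have I2 : 0 <= \int[leb]_t (g2 t)%:E by apply: integral_ge0 => t _; rewrite lee_fin.
have zr (g : R -> R) (k : \bar R) : measurable_fun setT g -> (forall t, 0 <= g t)%R -> 0 <= k ->
    \int[leb]_t ((g t)%:E * k) = \int[leb]_t (g t)%:E * k.
  move=> mg g0 k0; apply: ge0_integralZr => //; first exact: e.
  by move=> t _; rewrite lee_fin.
rewrite zr//; last by apply: integral_ge0 => t _; rewrite mule_ge0 ?lee_fin.
rewrite zr//.
by rewrite muleA.
Qed.

Lemma ge0_int_le_bound d (T : measurableType d) (mu : {measure set T -> \bar R}) (f : T -> R) C :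
  ge0_int_le mu f C -> (0 <= C)%R.
Proof.
by case=> _ f0 /(le_trans _) h; rewrite -lee_fin h// integral_ge0// => t _; rewrite lee_fin.
Qed.

Lemma ge0_int_le_tensor (g1 g2 g3 : R -> R) (C1 C2 C3 : R) : (g1 <=I C1) -> (g2 <=I C2) ->
  (g3 <=I C3) -> tensor g1 g2 g3 <=I3 C1 * C2 * C3.
Proof.
move=> h1 h2 h3; have c1 := ge0_int_le_bound h1; have c2 := ge0_int_le_bound h2.
case: h1 h2 h3 => [m1 p1 i1] [m2 p2 i2] [m3 p3 i3]; split.
- exact: measurable_tensor.
- by move=> x; exact: tensor_ge0.
- rewrite integral_tensor// !EFinM; apply: lee_pmul => //.
  + by rewrite mule_ge0// integral_ge0// => t _; rewrite lee_fin.
  + by rewrite integral_ge0// => t _; rewrite lee_fin.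
  + by apply: lee_pmul => //; rewrite integral_ge0// => t _; rewrite lee_fin.
Qed.

(** On the planes [x_k = y_k] the product majorants should be infinite, but [0] to a
    negative power is [0] by convention, so the majorization fails there; these planes
    are null sets. *)
Lemma ae_coord_neq (y : R3 R) :
  {ae mu3, forall x : R3 R, [/\ x.1.1 != y.1.1, x.1.2 != y.1.2 & x.2 != y.2]}.
Proof.
have N (A B C : set (measurableTypeR R)) : measurable A -> measurable B -> measurable C ->
   leb A * leb B * leb C = 0 -> mu3 ((A `*` B) `*` C) = 0.
  move=> mA mB mC E.
  have -> : mu3 ((A `*` B) `*` C) = lebesgue2 (A `*` B) * leb C.
    by apply: (product_measure1E lebesgue2 leb) => //; exact: measurableX.
  by rewrite -E; congr (_ * _); exact: product_measure1E.
have mS (t : measurableTypeR R) : measurable [set t] by exact: measurable_set1.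
have null (A B C : set (measurableTypeR R)) : measurable A -> measurable B -> measurable C ->
   leb A * leb B * leb C = 0 -> \forall x \ae mu3, ~ ((A `*` B) `*` C) x.
  move=> mA mB mC E; exists ((A `*` B) `*` C); split.
  - by apply: measurableX => //; exact: measurableX.
  - exact: N.
  - by move=> x /= /contrapT.
have l0 (t : R) : leb [set t] = 0 by exact: lebesgue_measure_set1.
have h1 := null [set y.1.1] setT setT (mS _) measurableT measurableT.
have h2 := null setT [set y.1.2] setT measurableT (mS _) measurableT.
have h3 := null setT setT [set y.2] measurableT measurableT (mS _).
rewrite l0 !mul0e in h1; rewrite l0 mule0 mul0e in h2; rewrite l0 mule0 in h3.
move: (h1 erefl) (h2 erefl) (h3 erefl); apply: filterS3 => x n1 n2 n3; split; apply/eqP => E.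
- by apply: n1.
- by apply: n2.
- by apply: n3.
Qed.

End Product3.

Lemma measurable_funV d (T : measurableType d) (R : realType) (f : T -> R) :
  measurable_fun setT f -> measurable_fun setT (fun x => (f x)^-1).
Proof.
move=> mf.
have -> : (fun x => (f x)^-1) = (fun x => f x * (f x ^+ 2) `^ (-1)).
  apply/funext => x; rewrite powR_inv1 ?sqr_ge0//.
  have [->|f0] := eqVneq (f x) 0; first by rewrite invr0 mul0r.
  by rewrite expr2 invfM mulrA mulfV// mul1r.
apply: measurable_funM => //; apply: (measurableT_comp (measurable_powR _)).
exact: measurable_funX.
Qed.

(** * The Schur test *)

Section Schur.
Context {R : realType}.
Local Notation "f <=I3 C" := (@ge0_int_le _ (R3 R) R mu3 f C) (at level 70).
Local Open Scope ereal_scope.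

(** The Cauchy-Schwarz inequality obtained from its additive form by optimizing the
    parameter: [th = h / c] suffices. *)
Lemma sqr_le_of_all_theta (h c j : R) : (0 <= h)%R -> (0 < c)%R -> (0 <= j)%R ->
  (forall th, 0 < th -> h <= (th * c + th^-1 * j) / 2)%R -> (h * h <= c * j)%R.
Proof.
move=> h0 c0 j0 H; have [->|hN0] := eqVneq h 0%R.
  by rewrite mul0r mulr_ge0// ltW.
have hp : (0 < h)%R by rewrite lt_neqAle eq_sym hN0.
have := H (h / c)%R (divr_gt0 hp c0).
rewrite divfK ?gt_eqF// invf_div => H1.
have : (h <= c / h * j)%R by lra.
by rewrite mulrAC ler_pdivlMr.
Qed.

Lemma measurable_pair_l (f : R3 R -> R) : measurable_fun setT f ->
  measurable_fun setT (fun p : R3 R * R3 R => f p.1).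
Proof. by move=> mf; exact: measurableT_comp mf measurable_fst. Qed.

Lemma measurable_pair_r (f : R3 R -> R) : measurable_fun setT f ->
  measurable_fun setT (fun p : R3 R * R3 R => f p.2).
Proof. by move=> mf; exact: measurableT_comp mf measurable_snd. Qed.

Lemma measurable_section_l (K : R3 R * R3 R -> R) (x : R3 R) : measurable_fun setT K ->
  measurable_fun setT (fun y : R3 R => K (x, y)).
Proof. by move=> mK; apply: (measurableT_comp mK); exact: measurable_pair1. Qed.

Lemma measurable_section_r (K : R3 R * R3 R -> R) (y : R3 R) : measurable_fun setT K ->
  measurable_fun setT (fun x : R3 R => K (x, y)).
Proof. by move=> mK; apply: (measurableT_comp mK); exact: measurable_pair2. Qed.

Lemma measurable_flip (K : R3 R * R3 R -> R) : measurable_fun setT K ->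
  measurable_fun setT (fun p : R3 R * R3 R => K (p.2, p.1)).
Proof. by move=> mK; apply: (measurableT_comp mK); exact: measurable_swap. Qed.

(** By the Cauchy-Schwarz inequality with the weight [w],
    [(K F)(x)^2 <= (K w)(x) (K (F^2 / w))(x) <= A w(x) (K (F^2 / w))(x)]; integrating in [x]
    and exchanging the integrals lets the second hypothesis remove the remaining [w].
    The weight may vanish or be singular on a null set, so the two hypotheses are
    required only where it is positive. *)
Lemma schur_test (K : R3 R * R3 R -> R) (w F : R3 R -> R) (A B : R) :
  measurable_fun setT K -> (forall p, 0 <= K p)%R ->
  measurable_fun setT w -> (forall x, 0 <= w x)%R -> {ae mu3, forall x, (0 < w x)%R} ->
  (0 < A)%R ->
  (forall x, (0 < w x)%R -> \int[mu3]_y (K (x, y) * w y)%:E <= (A * w x)%:E) ->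
  (forall y, (0 < w y)%R -> \int[mu3]_x (K (x, y) * w x)%:E <= (A * w y)%:E) ->
  measurable_fun setT F -> (forall x, 0 <= F x)%R ->
  \int[mu3]_x (F x * F x)%:E <= B%:E ->
  \int[mu3]_x ((\int[mu3]_y (K (x, y) * F y)%:E) * (\int[mu3]_y (K (x, y) * F y)%:E))
    <= (A * A * B)%:E.
Proof.
move=> mK K0 mw w0 wpos A0 Kw wK mF F0 FB.
pose J x := \int[mu3]_y (K (x, y) * (F y * F y / w y))%:E.
pose H x := \int[mu3]_y (K (x, y) * F y)%:E.
have mG : measurable_fun setT (fun y => F y * F y / w y)%R.
  apply: measurable_funM; first exact: measurable_funM.
  exact: measurable_funV.
have G0 y : (0 <= F y * F y / w y)%R by rewrite !mulr_ge0// invr_ge0.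
have mKF : measurable_fun setT (fun p : R3 R * R3 R => (K p * F p.2)%R%:E).
  by apply/measurable_EFinP/measurable_funM => //; exact: measurable_pair_r.
have mH : measurable_fun setT H.
  apply: (measurable_mu3_integral mKF) => p.
  by rewrite lee_fin mulr_ge0.
have mKG : measurable_fun setT (fun p : R3 R * R3 R => (K p * (F p.2 * F p.2 / w p.2))%R%:E).
  by apply/measurable_EFinP/measurable_funM => //; exact: (measurable_pair_r mG).
have mJ : measurable_fun setT J.
  apply: (measurable_mu3_integral mKG) => p.
  by rewrite lee_fin mulr_ge0.
have H0 x : 0 <= H x by apply: integral_ge0 => y _; rewrite lee_fin mulr_ge0.
have J0 x : 0 <= J x by apply: integral_ge0 => y _; rewrite lee_fin mulr_ge0.
have HJ x : (0 < w x)%R -> H x * H x <= (A * w x)%:E * J x.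
  move=> wx.
  have Awx : (0 < A * w x)%R by exact: mulr_gt0.
  have [->|Jfin] := eqVneq (J x) +oo; first by rewrite gt0_muley ?lte_fin// leey.
  have Jf : J x \is a fin_num by rewrite ge0_fin_numE// lt_neqAle Jfin leey.
  have young th : (0 < th)%R -> H x <= ((th * (A * w x) + th^-1 * fine (J x)) / 2)%:E.
    move=> th0.
    have mKw : measurable_fun setT (fun y => K (x, y) * w y)%R.
      by apply: measurable_funM => //; exact: measurable_section_l.
    have mKG' : measurable_fun setT (fun y => K (x, y) * (F y * F y / w y))%R.
      by apply: measurable_funM => //; exact: measurable_section_l.
    have I1 : (fun y => K (x, y) * w y)%R <=I3 (A * w x)%R.
      by split => //; [move=> y; rewrite mulr_ge0|exact: Kw].
    have I2 : (fun y => K (x, y) * (F y * F y / w y))%R <=I3 (fine (J x)).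
      by split => //; [move=> y; rewrite mulr_ge0|rewrite fineK].
    have th2 : (0 <= th / 2)%R by rewrite divr_ge0// ltW.
    have thi2 : (0 <= th^-1 / 2)%R by rewrite divr_ge0// invr_ge0 ltW.
    have [m3 p3 i3] := ge0_int_leD (ge0_int_leZ th2 I1) (ge0_int_leZ thi2 I2).
    have -> : ((th * (A * w x) + th^-1 * fine (J x)) / 2 =
       th / 2 * (A * w x) + th^-1 / 2 * fine (J x))%R by ring.
    apply: le_trans i3; apply: ae_ge0_le_integral => //.
    - by move=> y _; rewrite lee_fin mulr_ge0.
    - by apply/measurable_EFinP/measurable_funM => //; exact: measurable_section_l.
    - by move=> y _; rewrite lee_fin.
    - exact/measurable_EFinP.
    - apply: filterS wpos => y wy _; rewrite lee_fin.
      have -> : (th / 2 * (K (x, y) * w y) + th^-1 / 2 * (K (x, y) * (F y * F y / w y)) =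
         K (x, y) * ((th * w y + (th * w y)^-1 * (F y * F y)) / 2))%R.
        by field; rewrite !gt_eqF.
      apply: ler_wpM2l => //.
      have tw : (0 < th * w y)%R by exact: mulr_gt0.
      set u := (th * w y)%R in tw *.
      (* Completing the square. *)
      have -> : ((u + u^-1 * (F y * F y)) / 2 = F y + u^-1 * ((u - F y) * (u - F y)) / 2)%R.
        by field; rewrite gt_eqF.
      rewrite lerDl divr_ge0// mulr_ge0 ?invr_ge0 ?(ltW tw)//.
      by rewrite -expr2 sqr_ge0.
  have Hf : H x \is a fin_num.
    by rewrite ge0_fin_numE//; apply: le_lt_trans (young 1%R _) _ => //; rewrite ltry.
  rewrite -(fineK Hf) -(fineK Jf) -!EFinM lee_fin.
  apply: sqr_le_of_all_theta => //; first exact: fine_ge0.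
  - exact: fine_ge0.
  - by move=> th /young; rewrite -{1}(fineK Hf) lee_fin.
apply: (@le_trans _ _ (\int[mu3]_x ((A * w x)%:E * J x))).
  apply: ae_ge0_le_integral; first exact: measurableT.
  - by move=> x _; rewrite mule_ge0// H0.
  - exact: emeasurable_funM.
  - by move=> x _; rewrite mule_ge0// lee_fin mulr_ge0// ltW.
  - by apply: emeasurable_funM => //; apply/measurable_EFinP/measurable_funM.
  - by apply: filterS wpos => x wx _; exact: HJ.
have -> : \int[mu3]_x ((A * w x)%:E * J x) =
   \int[mu3]_x \int[mu3]_y (A * w x * (K (x, y) * (F y * F y / w y)))%R%:E.
  apply: eq_integral => x _; rewrite -ge0_integralZl//.
  - by apply/measurable_EFinP/measurable_funM => //; exact: measurable_section_l.
  - by move=> y _; rewrite lee_fin mulr_ge0.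
  - by rewrite lee_fin mulr_ge0// ltW.
rewrite (@mu3_tonelli _ (fun p => (A * w p.1 * (K p * (F p.2 * F p.2 / w p.2)))%R%:E)); last 2 first.
- apply/measurable_EFinP/measurable_funM; last exact/measurable_EFinP.
  by apply: measurable_funM => //; exact: measurable_pair_l.
- by move=> p; rewrite lee_fin !mulr_ge0// ?invr_ge0// ltW.
apply: (@le_trans _ _ (\int[mu3]_y ((A * A)%:E * (F y * F y)%:E))).
  apply: ae_ge0_le_integral; first exact: measurableT.
  - by move=> y _; apply: integral_ge0 => x _; rewrite lee_fin !mulr_ge0// ?invr_ge0// ltW.
  - have := @measurable_mu3_integral _ (fun p => (A * w p.2 * (K (p.2, p.1) * (F p.1 * F p.1 / w p.1)))%R%:E).
    apply.
    + apply/measurable_EFinP/measurable_funM; last apply: measurable_funM.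
      * by apply: measurable_funM => //; exact: measurable_pair_r.
      * exact: measurable_flip.
      * exact: (measurable_pair_l mG).
    + by move=> p; rewrite lee_fin !mulr_ge0// ?invr_ge0// ltW.
  - by move=> y _; rewrite lee_fin !mulr_ge0// ltW.
  - by apply/measurable_EFinP/measurable_funM => //; exact: measurable_funM.
  - apply: filterS wpos => y wy _.
    have -> : \int[mu3]_x (A * w x * (K (x, y) * (F y * F y / w y)))%:E =
        \int[mu3]_x ((A * (F y * F y / w y))%:E * (K (x, y) * w x)%:E).
      by apply: eq_integral => x _; rewrite -EFinM; congr (_%:E); ring.
    rewrite ge0_integralZl//; last 3 first.
    + by apply/measurable_EFinP/measurable_funM => //; exact: measurable_section_r.
    + by move=> x _; rewrite lee_fin mulr_ge0.
    + by rewrite lee_fin mulr_ge0// ltW.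
    apply: (@le_trans _ _ ((A * (F y * F y / w y))%:E * (A * w y)%:E)).
      by apply: lee_wpmul2l; [rewrite lee_fin mulr_ge0// ltW|exact: wK].
    by rewrite -!EFinM lee_fin le_eqVlt; apply/orP; left; apply/eqP; field; rewrite gt_eqF.
rewrite ge0_integralZl//.
- by rewrite [leRHS]EFinM lee_wpmul2l// lee_fin mulr_ge0// ltW.
- by apply/measurable_EFinP/measurable_funM.
- by move=> y _; rewrite lee_fin mulr_ge0.
- by rewrite lee_fin mulr_ge0// ltW.
Qed.

End Schur.

(** * The product majorants and the estimates for H *)

Section Kernel.
Context {R : realType}.
Local Notation leb := (@lebesgue_measure R).
Local Notation "f <=I C" := (@ge0_int_le _ (measurableTypeR R) R leb f C) (at level 70).
Local Notation "f <=I3 C" := (@ge0_int_le _ (R3 R) R mu3 f C) (at level 70).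

(** One factor of the majorant [kappa3] of [|x-y|^-2]. *)
Definition kappa (t : R) : R := `|t| `^ (- (2 / 3)).
(** One factor of the majorant [beta3] of [<x>^-1]. *)
Definition beta (t : R) : R := (1 + t ^+ 2) `^ (- (1 / 6)).

Lemma kappa_ge0 t : 0 <= kappa t. Proof. exact: powR_ge0. Qed.
Lemma beta_ge0 t : 0 <= beta t. Proof. exact: powR_ge0. Qed.

Lemma measurable_kappa : measurable_fun setT kappa.
Proof. exact: measurable_norm_powR. Qed.

Lemma measurable_kappaB (s : R) : measurable_fun setT (fun t : R => kappa (s - t)).
Proof. by apply: (measurableT_comp measurable_kappa); exact: measurable_funB. Qed.

Lemma measurable_beta : measurable_fun setT beta.
Proof.
apply: (measurableT_comp (measurable_powR _)).
by apply: measurable_funD => //; exact: measurable_funX.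
Qed.

Lemma beta_le1 t : beta t <= 1.
Proof.
rewrite -(powRr0 1) powR1; have := @ler_powRN R (1/6) 1 (1 + t ^+ 2).
by rewrite powR1; apply => //; rewrite lerDl sqr_ge0.
Qed.

Lemma beta_le_powR t : t != 0 -> beta t <= `|t| `^ (- (1 / 3)).
Proof.
move=> t0.
have -> : - (1 / 3) = 2 * (- (1 / 6)) :> R by field.
rewrite powRrM powR_mulrn// real_normK ?num_real//.
apply: ler_powRN => //; first by rewrite exprn_even_gt0//= t0.
by rewrite lerDr.
Qed.

Lemma beta4_le_farpow t : beta t ^+ 2 * beta t ^+ 2 <= (\1_`[-1, 1] t) + farpow (4 / 3) 1 t.
Proof.
have b4 : 0 <= beta t ^+ 2 * beta t ^+ 2 by rewrite mulr_ge0// sqr_ge0.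
have [t1|t1] := leP `|t| 1.
  rewrite indicE mem_setE in_itv/= -ler_norml t1/= -[leLHS]addr0 lerD ?farpow_ge0//.
  by rewrite mulr_ile1// ?sqr_ge0// exprn_ile1 ?beta_ge0 ?beta_le1.
rewrite /farpow (ltW t1) -[leLHS]add0r lerD//.
have t0 : t != 0 by rewrite -normr_gt0 (lt_trans _ t1).
have -> : `|t| `^ (- (4 / 3)) = (`|t| `^ (- (1 / 3))) ^+ 4.
  by rewrite -powR_mulrn ?powR_ge0// -powRrM; congr (_ `^ _); field.
rewrite -exprD lerXn2r ?nnegrE ?beta_ge0 ?powR_ge0//.
exact: beta_le_powR.
Qed.

(** Far from [s] both factors are only in [L^2], so the product is estimated by the sum
    of their squares, which decay like [|t|^(-4/3)]. *)
Lemma kappa_beta2_int : exists C : R, forall s, (fun t => kappa (s - t) * beta t ^+ 2) <=I C.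
Proof.
have h23 : 0 < (2 / 3 : R) < 1 by apply/andP; split; lra.
have h43 : 1 < (4 / 3 : R) by lra.
have i1 : (\1_`[-1, 1] : R -> R) <=I 2.
  split => //.
  rewrite integral_indic//= setIT lebesgue_measure_itv/= lte_fin.
  by case: ifP => _; rewrite -?EFinB lee_fin; lra.
pose C1 : R := 2 * (1 `^ (1 - 2 / 3) / (1 - 2 / 3)).
pose C2 : R := 2 * (1 `^ (1 - 4 / 3) / (4 / 3 - 1)).
exists (C1 + C2 + (2 + C2)) => s.
have H1 := ge0_int_le_translate s (ge0_int_le_nearpow h23 (@ltr01 R)).
have H2 := ge0_int_le_translate s (ge0_int_le_farpow h43 (@ltr01 R)).
have H3 := ge0_int_leD i1 (ge0_int_le_farpow h43 (@ltr01 R)).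
have H := ge0_int_leD (ge0_int_leD H1 H2) H3.
apply: ge0_int_le_le H => //.
  apply: measurable_funM; first exact: measurable_kappaB.
  by apply: measurable_funX; exact: measurable_beta.
move=> t; rewrite mulr_ge0 ?kappa_ge0 ?sqr_ge0//=.
have kE : kappa (s - t) = `|t - s| `^ (- (2 / 3)) by rewrite /kappa -normrN opprB.
have I0 : 0 <= \1_`[-1, 1] t :> R by rewrite indicE.
have b2 : beta t ^+ 2 <= 1 by rewrite exprn_ile1 ?beta_ge0 ?beta_le1.
have [ts|ts] := ltP `|t - s| 1.
  apply: (@le_trans _ _ (nearpow (2 / 3) 1 (t - s))).
    by rewrite /nearpow ts kE ler_piMr// powR_ge0.
  by rewrite -addrA lerDl !addr_ge0 ?farpow_ge0.
apply: (@le_trans _ _ (farpow (4 / 3) 1 (t - s) + (\1_`[-1, 1] t + farpow (4 / 3) 1 t))); last first.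
  by rewrite lerD2r lerDr nearpow_ge0.
apply: (@le_trans _ _ (kappa (s - t) ^+ 2 + beta t ^+ 2 * beta t ^+ 2)).
  have := sqr_ge0 (kappa (s - t) - beta t ^+ 2).
  have := sqr_ge0 (kappa (s - t)); have := sqr_ge0 (beta t ^+ 2); nra.
rewrite lerD ?beta4_le_farpow// /farpow ts kE.
by rewrite -powR_mulrn ?powR_ge0// -powRrM (_ : - (2 / 3) * 2%:R = - (4 / 3))//; field.
Qed.

Definition kappa3 (x y : R3 R) : R :=
  tensor (fun t => kappa (x.1.1 - t)) (fun t => kappa (x.1.2 - t)) (fun t => kappa (x.2 - t)) y.
Definition beta3 : R3 R -> R := tensor beta beta beta.

Lemma kappa3_ge0 x y : 0 <= kappa3 x y.
Proof. by apply: tensor_ge0 => t; exact: kappa_ge0. Qed.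
Lemma beta3_ge0 x : 0 <= beta3 x.
Proof. by apply: tensor_ge0 => t; exact: beta_ge0. Qed.
Lemma measurable_beta3 : measurable_fun setT beta3.
Proof. by apply: measurable_tensor; exact: measurable_beta. Qed.
Lemma beta3_le1 x : beta3 x <= 1.
Proof. by rewrite /beta3 /tensor !mulr_ile1 ?mulr_ge0 ?beta_ge0 ?beta_le1. Qed.

Lemma kappa3C x y : kappa3 x y = kappa3 y x.
Proof.
by rewrite /kappa3 /tensor /kappa; congr (_ * _ * _); rewrite -normrN opprB.
Qed.

Lemma measurable_kappa3 : measurable_fun setT (fun p : R3 R * R3 R => kappa3 p.1 p.2).
Proof.
have h (f : R3 R -> R) : measurable_fun setT f ->
    measurable_fun setT (fun p : R3 R * R3 R => kappa (f p.1 - f p.2)).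
  move=> mf; apply: (measurableT_comp measurable_kappa).
  by apply: measurable_funB; [exact: measurable_pair_l|exact: measurable_pair_r].
apply: measurable_funM; first apply: measurable_funM.
- exact: (h _ measurable_coord1).
- exact: (h _ measurable_coord2).
- exact: (h _ measurable_coord3).
Qed.

(** The Schur weight: any exponent between [1/3] and [2/3] would satisfy the two
    conditions on it, since [beta] is only used through [beta t <= |t|^(-1/3)]. *)
Definition weight (t : R) : R := `|t| `^ (- (1 / 2)).

Lemma kappa_beta_weight : exists2 C : R, 0 < C & forall s : R, s != 0 ->
  (fun t => kappa (s - t) * beta t * weight t) <=I C * weight s.
Proof.
have h1 : 0 < (2 / 3 : R) < 1 by apply/andP; split; lra.
have h2 : 0 < (5 / 6 : R) < 1 by apply/andP; split; lra.
have h3 : 1 < (2 / 3 : R) + 5 / 6 by lra.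
have [C C0 HC] := riesz_compose h1 h2 h3; exists C => // s s0.
have := HC s 0 s0; rewrite subr0 (_ : 1 - (2 / 3 + 5 / 6) = - (1 / 2)); last by field.
apply: ge0_int_le_le => //.
  apply: measurable_funM; last exact: measurable_norm_powR.
  by apply: measurable_funM; [exact: measurable_kappaB|exact: measurable_beta].
move=> t; rewrite !mulr_ge0 ?kappa_ge0 ?beta_ge0 ?powR_ge0//= subr0 -mulrA ler_wpM2l ?kappa_ge0//.
have [->|t0] := eqVneq t 0.
  by rewrite /weight normr0 !powR0 ?mulr0// oppr_eq0; lra.
have E : - (5 / 6) = - (1 / 3) + - (1 / 2) :> R by field.
rewrite E powRD ?normr_eq0 ?t0 ?implybT// ler_wpM2r ?powR_ge0//.
exact: beta_le_powR.
Qed.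

Lemma beta_kappa_weight : exists2 C : R, 0 < C & forall s : R, s != 0 ->
  (fun t => kappa (t - s) * beta s * weight t) <=I C * weight s.
Proof.
have h1 : 0 < (2 / 3 : R) < 1 by apply/andP; split; lra.
have h2 : 0 < (1 / 2 : R) < 1 by apply/andP; split; lra.
have h3 : 1 < (2 / 3 : R) + 1 / 2 by lra.
have [C C0 HC] := riesz_compose h1 h2 h3; exists C => // s s0.
have := ge0_int_leZ (beta_ge0 s) (HC s 0 s0); rewrite subr0 => H.
apply: ge0_int_le_le H => //.
- apply: measurable_funM; last exact: measurable_norm_powR.
  apply: measurable_funM => //.
  by apply: (measurableT_comp measurable_kappa); exact: measurable_funB.
- move=> t; rewrite !mulr_ge0 ?kappa_ge0 ?beta_ge0 ?powR_ge0//= subr0 mulrA.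
  by rewrite (mulrC (beta s)) /kappa -[`|t - s|]normrN opprB.
- rewrite mulrCA ler_wpM2l ?(ltW C0)// /weight.
  have -> : - (1 / 2) = - (1 / 3) + (1 - (2 / 3 + 1 / 2)) :> R by field.
  rewrite [leRHS]powRD ?normr_eq0 ?s0 ?implybT// ler_wpM2r ?powR_ge0//.
  exact: beta_le_powR.
Qed.

Local Open Scope ereal_scope.

(** The function [H] that controls both [psi] and, almost everywhere, [phi]
    (for [F = |phi|]). *)
Definition riesz (F : R3 R -> R) (x : R3 R) : \bar R :=
  \int[mu3]_y (kappa3 x y * (beta3 y * F y))%:E.

(** The kernel and the weight are products, so the two Schur conditions are the
    one-dimensional ones [kappa_beta_weight] and [beta_kappa_weight]. *)
Lemma riesz_L2 : exists2 A : R, (0 <= A)%R & forall (F : R3 R -> R) (B : R),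
  measurable_fun setT F -> (forall x, 0 <= F x)%R -> \int[mu3]_x (F x * F x)%:E <= B%:E ->
  \int[mu3]_x (riesz F x * riesz F x) <= (A * B)%:E.
Proof.
have [C1 C10 H1] := kappa_beta_weight.
have [C2 C20 H2] := beta_kappa_weight.
pose C := Num.max C1 C2.
have C0 : (0 < C)%R by rewrite lt_max C10.
have C1C : (C1 <= C)%R by rewrite le_max lexx.
have C2C : (C2 <= C)%R by rewrite le_max lexx orbT.
have w0 t : (0 <= weight t)%R by exact: powR_ge0.
exists (C ^+ 3 * C ^+ 3)%R; first by rewrite mulr_ge0// exprn_ge0// ltW.
move=> F B mF F0 FB; rewrite /riesz.
pose K (p : R3 R * R3 R) := (kappa3 p.1 p.2 * beta3 p.2)%R.
pose w := tensor weight weight weight.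
have wP (x : R3 R) : (0 < w x)%R -> [/\ x.1.1 != 0, x.1.2 != 0 & x.2 != 0]%R.
  move=> wx; have z : weight 0 = 0%R.
    by rewrite /weight normr0 powR0// oppr_eq0; lra.
  by split; apply/eqP => E; move: wx; rewrite /w /tensor E z ?mul0r ?mulr0 ?mul0r ltxx.
have HK x : \int[mu3]_y (kappa3 x y * (beta3 y * F y))%:E = \int[mu3]_y (K (x, y) * F y)%:E.
  by apply: eq_integral => y _; rewrite /K/= mulrA.
under eq_integral do rewrite HK.
apply: (@schur_test _ K w F (C ^+ 3)%R B) => //.
- apply: measurable_funM; first exact: measurable_kappa3.
  exact: (measurable_pair_r measurable_beta3).
- by move=> p; rewrite mulr_ge0 ?kappa3_ge0 ?beta3_ge0.
- by apply: measurable_tensor; exact: measurable_norm_powR.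
- by move=> x; exact: tensor_ge0.
- have := @ae_coord_neq R (0, 0, 0)%R; apply: filterS => x [/= n1 n2 n3].
  by rewrite /w /tensor !mulr_gt0// powR_gt0// normr_gt0.
- by rewrite exprn_gt0.
- move=> x /wP[x1 x2 x3].
  have [m p h] := ge0_int_le_tensor (H1 _ x1) (H1 _ x2) (H1 _ x3).
  apply: le_trans (le_trans h _).
    rewrite le_eqVlt; apply/orP; left; apply/eqP/eq_integral => y _.
    by rewrite /K /kappa3 /beta3 /w /tensor/=; congr (_%:E); ring.
  rewrite lee_fin (_ : _ * _ * _ = C1 ^+ 3 * w x)%R; last by rewrite /w /tensor; ring.
  by rewrite ler_wpM2r ?tensor_ge0// lerXn2r// nnegrE ltW.
- move=> y /wP[y1 y2 y3].
  have [m p h] := ge0_int_le_tensor (H2 _ y1) (H2 _ y2) (H2 _ y3).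
  apply: le_trans (le_trans h _).
    rewrite le_eqVlt; apply/orP; left; apply/eqP/eq_integral => x _.
    by rewrite /K /kappa3 /beta3 /w /tensor/=; congr (_%:E); ring.
  rewrite lee_fin (_ : _ * _ * _ = C2 ^+ 3 * w y)%R; last by rewrite /w /tensor; ring.
  by rewrite ler_wpM2r ?tensor_ge0// lerXn2r// nnegrE ltW.
Qed.

Lemma kappa3_comp : exists2 C : R, (0 <= C)%R & forall x z : R3 R,
  [/\ z.1.1 != x.1.1, z.1.2 != x.1.2 & z.2 != x.2]%R ->
  \int[mu3]_y (kappa3 x y * kappa3 y z)%:E <=
  (C * tensor (fun t => `|x.1.1 - t| `^ (- (1 / 3)))%R (fun t => `|x.1.2 - t| `^ (- (1 / 3)))%R
     (fun t => `|x.2 - t| `^ (- (1 / 3)))%R z)%:E.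
Proof.
have h1 : (0 < (2 / 3 : R) < 1)%R by apply/andP; split; lra.
have h3 : (1 < (2 / 3 : R) + 2 / 3)%R by lra.
have [C C0 HC] := riesz_compose h1 h1 h3; exists (C ^+ 3)%R; first by rewrite exprn_ge0// ltW.
move=> x z []; rewrite eq_sym => n1; rewrite eq_sym => n2; rewrite eq_sym => n3.
have [m p h] := ge0_int_le_tensor (HC _ _ n1) (HC _ _ n2) (HC _ _ n3).
apply: le_trans (le_trans h _).
  rewrite le_eqVlt; apply/orP; left; apply/eqP/eq_integral => y _.
  by rewrite /kappa3 /tensor/= /kappa; congr (_%:E); ring.
rewrite lee_fin (_ : 1 - (2 / 3 + 2 / 3) = - (1 / 3))%R; last by field.
by rewrite /tensor le_eqVlt; apply/orP; left; apply/eqP; ring.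
Qed.

Lemma measurable_kappa3_int (F : R3 R -> R) : measurable_fun setT F -> (forall x, 0 <= F x)%R ->
  measurable_fun setT (fun x => \int[mu3]_y (kappa3 x y * F y)%:E).
Proof.
move=> mF F0.
apply: (@measurable_mu3_integral _ (fun p => (kappa3 p.1 p.2 * F p.2)%:E)).
  apply/measurable_EFinP/measurable_funM; first exact: measurable_kappa3.
  exact: measurable_pair_r.
by move=> p; rewrite lee_fin mulr_ge0 ?kappa3_ge0.
Qed.

(** By Tonelli's theorem and [kappa3_comp] the left-hand side is at most
    [C int P(x,z) beta3(z) F(z) dz] with [P = prod_k |x_k - z_k|^(-1/3)]. Then
    [2 u F <= u^2 + F^2] with [u = P beta3], where [P^2] is [kappa3], so that the integral
    of [u^2] is bounded uniformly in [x] by [kappa_beta2_int]. *)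
Lemma riesz_sup : exists2 C : R, (0 <= C)%R & forall (F : R3 R -> R) (B : R),
  measurable_fun setT F -> (forall x, 0 <= F x)%R -> \int[mu3]_x (F x * F x)%:E <= B%:E ->
  forall x, \int[mu3]_y ((kappa3 x y)%:E * riesz F y) <= (C * (1 + B))%:E.
Proof.
have [C C0 HC] := kappa3_comp.
have [D HD] := kappa_beta2_int.
have D0 : (0 <= D ^+ 3)%R.
  by rewrite exprn_ge0//; exact: ge0_int_le_bound (HD 0%R).
exists (C * (1 + D ^+ 3))%R; first by rewrite mulr_ge0// addr_ge0.
move=> F B mF F0 FB x; rewrite /riesz.
have B0 : (0 <= B)%R.
  by rewrite -lee_fin (le_trans _ FB)// integral_ge0// => y _; rewrite lee_fin mulr_ge0.
have bF0 z : (0 <= beta3 z * F z)%R by rewrite mulr_ge0 ?beta3_ge0.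
have kk y z : (0 <= kappa3 x y * (kappa3 y z * (beta3 z * F z)))%R.
  by rewrite mulr_ge0 ?kappa3_ge0// mulr_ge0 ?kappa3_ge0.
have mbF : measurable_fun setT (fun z => beta3 z * F z)%R.
  by apply: measurable_funM => //; exact: measurable_beta3.
have mk2 : measurable_fun setT (fun p : R3 R * R3 R => (kappa3 p.1 p.2 * (beta3 p.2 * F p.2))%R).
  by apply: measurable_funM; [exact: measurable_kappa3|exact: (measurable_pair_r mbF)].
have mkx : measurable_fun setT (fun y => kappa3 x y).
  by apply: measurable_tensor; exact: measurable_kappaB.
have -> : \int[mu3]_y ((kappa3 x y)%:E * \int[mu3]_z (kappa3 y z * (beta3 z * F z))%:E) =
    \int[mu3]_y \int[mu3]_z (kappa3 x y * (kappa3 y z * (beta3 z * F z)))%:E.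
  apply: eq_integral => y _; rewrite -ge0_integralZl//.
  - apply/measurable_EFinP; apply: (measurable_section_l _ mk2).
  - by move=> z _; rewrite lee_fin mulr_ge0 ?kappa3_ge0.
  - by rewrite lee_fin kappa3_ge0.
rewrite (@mu3_tonelli _ (fun p => (kappa3 x p.1 * (kappa3 p.1 p.2 * (beta3 p.2 * F p.2)))%:E)); last 2 first.
- apply/measurable_EFinP/measurable_funM => //; exact: (measurable_pair_l mkx).
- by move=> p; rewrite lee_fin.
pose P z := tensor (fun t => `|x.1.1 - t| `^ (- (1 / 3)))%R (fun t => `|x.1.2 - t| `^ (- (1 / 3)))%R
     (fun t => `|x.2 - t| `^ (- (1 / 3)))%R z.
have P0 z : (0 <= P z)%R by apply: tensor_ge0 => t; exact: powR_ge0.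
have mnB (s : R) : measurable_fun setT (fun t : R => `|s - t| `^ (- (1 / 3)))%R.
  by under eq_fun do rewrite -normrN opprB; exact: measurable_norm_powRB.
have mP : measurable_fun setT P by apply: measurable_tensor; exact: mnB.
have IP : (fun z => C * (P z * beta3 z) ^+ 2)%R <=I3 (C * (D * D * D))%R.
  apply: ge0_int_leZ => //; have [m p h] := ge0_int_le_tensor (HD x.1.1) (HD x.1.2) (HD x.2).
  apply: (ge0_int_le_le _ _ (lexx _) (And3 m p h)).
    by apply: measurable_funX; apply: measurable_funM => //; exact: measurable_beta3.
  move=> z; rewrite sqr_ge0/= /P /beta3 /tensor.
  have kE (s t : R) : (kappa (s - t) = (`|s - t| `^ (- (1 / 3))) ^+ 2)%R.
    by rewrite -powR_mulrn ?powR_ge0// -powRrM /kappa; congr (_ `^ _)%R; field.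
  by rewrite !kE le_eqVlt; apply/orP; left; apply/eqP; ring.
have IF : (fun z => C * (F z * F z))%R <=I3 (C * B)%R.
  apply: ge0_int_leZ => //; split => //; first exact: measurable_funM.
  by move=> z; rewrite mulr_ge0.
have [mI pI hI] := ge0_int_leD IP IF.
apply: (@le_trans _ _ (C * (D * D * D) + C * B)%:E); last first.
  rewrite lee_fin (_ : C * (D * D * D) + C * B = C * (D ^+ 3 + B))%R; last by ring.
  rewrite -mulrA ler_wpM2l// mulrDl mul1r mulrDr mulr1 addrC.
  by rewrite lerD// ?lerDr ?lerDl// mulr_ge0.
apply: le_trans hI; apply: ae_ge0_le_integral; first exact: measurableT.
- by move=> z _; apply: integral_ge0 => y _; rewrite lee_fin.
- apply: (@measurable_mu3_integral _ (fun p => (kappa3 x p.2 * (kappa3 p.2 p.1 * (beta3 p.1 * F p.1)))%:E)).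
    apply/measurable_EFinP/measurable_funM; first exact: (measurable_pair_r mkx).
    exact: (measurable_flip mk2).
  by move=> p; rewrite lee_fin.
- by move=> z _; rewrite lee_fin.
- exact/measurable_EFinP.
- have := @ae_coord_neq R x; apply: filterS => z /HC hz _.
  have -> : \int[mu3]_y (kappa3 x y * (kappa3 y z * (beta3 z * F z)))%:E =
      \int[mu3]_y ((beta3 z * F z)%:E * (kappa3 x y * kappa3 y z)%:E).
    by apply: eq_integral => y _; rewrite -EFinM; congr (_%:E); ring.
  rewrite ge0_integralZl//; last 3 first.
  + apply/measurable_EFinP/measurable_funM => //.
    by under eq_fun do rewrite kappa3C; apply: measurable_tensor; exact: measurable_kappaB.
  + by move=> y _; rewrite lee_fin mulr_ge0 ?kappa3_ge0.
  + by rewrite lee_fin.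
  apply: (@le_trans _ _ ((beta3 z * F z)%:E * (C * P z)%:E)).
    by rewrite lee_wpmul2l ?lee_fin.
  rewrite -EFinM lee_fin -mulrDr [leLHS]mulrCA ler_wpM2l//.
  have := sqr_ge0 (P z * beta3 z - F z)%R.
  have := sqr_ge0 (P z * beta3 z)%R; have := sqr_ge0 (F z).
  set u := (P z * beta3 z)%R; have -> : (beta3 z * F z * P z = u * F z)%R by rewrite /u; ring.
  nra.
Qed.

End Kernel.

(** * Compactly supported functions on space *)

Section Continuous3.
Context {R : realType}.

Definition box (L : R) (x : R3 R) : bool :=
  [&& `|x.1.1| <= L, `|x.1.2| <= L & `|x.2| <= L].

Lemma rat_ball_approx (t d e : R) : 0 < d -> d < e / 2 ->
  exists q : rat, ball (ratr q : R) d t /\ ball (ratr q : R) d `<=` ball t e.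
Proof.
move=> d0 de; have lt2 : t - d < t + d by lra.
have [q] := rat_in_itvoo lt2.
rewrite in_itv/= => /andP[q1 q2]; exists q; split.
  by rewrite /ball/= ltr_distl; apply/andP; split; lra.
by move=> u; rewrite /ball/= !ltr_distl => /andP[u1 u2]; apply/andP; split; lra.
Qed.

(** The sigma-algebra on [R3 R] is a product one, so openness has to be exploited through
    countably many rational boxes. *)
Lemma open_measurable3 (U : set (R3 R)) : open U -> measurable U.
Proof.
move=> oU.
pose bx (i : rat * rat * rat * nat) : set (R3 R) :=
  ((ball (ratr i.1.1.1 : R) i.2.+1%:R^-1 `*` ball (ratr i.1.1.2 : R) i.2.+1%:R^-1)
    `*` ball (ratr i.1.2 : R) i.2.+1%:R^-1).
have mb (r : R) (n : nat) : measurable (ball r n.+1%:R^-1 : set (measurableTypeR R)).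
  exact: measurable_ball.
have -> : U = \bigcup_i (if `[< bx i `<=` U >] then bx i else set0).
  apply/seteqP; split => [x Ux|x [i _]]; last first.
    by case: ifPn => [/asboolP + bxi|//]; apply.
  have /nbhs_ballP[e /= e0 be] : nbhs x U by exact: open_nbhs_nbhs.
  have e20 : 0 < e / 2 by exact: divr_gt0.
  have [n _ /(_ n (leqnn n)) /= ne] := near_infty_natSinv_lt (PosNum e20).
  have n0 : (0 : R) < n.+1%:R^-1 by rewrite invr_gt0.
  have approx t := rat_ball_approx t n0 ne.
  have [q1 [a1 b1]] := approx x.1.1.
  have [q2 [a2 b2]] := approx x.1.2.
  have [q3 [a3 b3]] := approx x.2.
  exists (q1, q2, q3, n) => //; case: ifPn => [_|/asboolPn]; first by [].
  case=> z [[z1 z2] z3]; apply: be; split; [split|].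
  - exact: b1.
  - exact: b2.
  - exact: b3.
apply: countable_bigcupT_measurable => // i; case: ifPn => // _.
by apply: measurableX; [apply: measurableX|]; exact: mb.
Qed.

Lemma continuous_measurable3 (f : R3 R -> R) : continuous f -> measurable_fun setT f.
Proof.
move=> /continuousP cf; apply: (measurability _ (RGenOpens.measurableE R)).
move=> _ [_ [a [b ->] <-]]; apply: measurableI => //.
by apply: open_measurable3; apply: cf; exact: interval_open.
Qed.

Lemma compact_box (K : set (R3 R)) : compact K -> exists2 L : R, 0 < L & forall x, K x -> box L x.
Proof.
move=> /compact_bounded[M [Mr H]].
exists (Num.max M 0 + 1).
  by rewrite ltr_wpDl// le_max lexx orbT.
move=> x Kx.
have h : `|x : R * R * R| <= Num.max M 0 + 1.
  by apply: H => //; rewrite (@le_lt_trans _ _ (Num.max M 0)) ?ltrDl// le_max lexx.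
by move: h; rewrite !prod_normE/= !ge_max /box andbA.
Qed.

Lemma compact_bounded_image (K : set (R3 R)) (f : R3 R -> R) : compact K -> continuous f ->
  exists2 M : R, 0 < M & forall x, K x -> `|f x| <= M.
Proof.
move=> cK cf.
have : compact (f @` K) by apply: continuous_compact => //; exact: continuous_subspaceT.
move=> /compact_bounded[M [Mr H]].
exists (Num.max M 0 + 1); first by rewrite ltr_wpDl// le_max lexx orbT.
move=> x Kx; apply: (H (Num.max M 0 + 1)); last by exists x.
by rewrite (@le_lt_trans _ _ (Num.max M 0)) ?ltrDl// le_max lexx.
Qed.

(** Boxes rather than balls or compact sets, because the indicator function of a box is
    a product function. *)
Definition bounded_in_box (f : R3 R -> R) (M L : R) : Prop :=
  [/\ measurable_fun setT f, forall x, `|f x| <= M & forall x, ~~ box L x -> f x = 0].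

Lemma partial_support (f : R3 R -> R) (K : set (R3 R)) (k : 'I_3) (x : R3 R) : closed K ->
  (forall x, ~ K x -> f x = 0) -> ~ K x -> partial k f x = 0.
Proof.
move=> cK fK nKx; rewrite /partial.
rewrite (@near_eq_derive _ _ _ f (cst 0)).
  by rewrite derive_cst.
have : nbhs x (~` K) by apply: open_nbhs_nbhs; split => //; exact: closed_openC.
by apply: filterS => z /fK ->.
Qed.

End Continuous3.

(** * Integration by parts *)

Section Lines.
Context {R : realType}.
Local Notation leb := (@lebesgue_measure R).

(** The line through [x] in the direction [k], on which one-dimensional calculus is
    applied. *)
Definition set_coord (k : 'I_3) (x : R3 R) (t : R) : R3 R :=
  match val k with
  | 0 => (t, x.1.2, x.2)
  | 1 => (x.1.1, t, x.2)
  | _ => (x.1.1, x.1.2, t)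
  end.

Lemma ord3_ind (P : 'I_3 -> Prop) : P 0 -> P 1 -> P 2%:R -> forall k, P k.
Proof.
move=> P0 P1 P2 [[|[|[|//]]] i].
- by rewrite (_ : Ordinal i = 0)//; exact/val_inj.
- by rewrite (_ : Ordinal i = 1)//; exact/val_inj.
- by rewrite (_ : Ordinal i = 2%:R)//; exact/val_inj.
Qed.

Lemma set_coord_basis3 k x (h t : R) : h *: basis3 k + set_coord k x t = set_coord k x (h + t).
Proof.
by elim/ord3_ind: k; rewrite /set_coord /basis3/=; congr (_, _, _);
  do 2! rewrite /GRing.scale/=; rewrite ?mulr1 ?mulr0 ?add0r.
Qed.

Lemma is_derive_line (f : R3 R -> R) k x (t : R) : derivable f (set_coord k x t) (basis3 k) ->
  is_derive t 1 (fun u : R => f (set_coord k x u)) (partial k f (set_coord k x t)).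
Proof.
have E : (fun h : R => h^-1 *: (f (h *: basis3 k + set_coord k x t) - f (set_coord k x t))) =
         (fun h : R => h^-1 *: (f (set_coord k x (h *: (1 : R) + t)) - f (set_coord k x t))).
  by apply/funext => h; rewrite set_coord_basis3 /GRing.scale/= mulr1.
move=> df; split.
  by move: df; rewrite /derivable /= => df; rewrite -E.
by rewrite /partial /derive -E.
Qed.

Lemma continuous_set_coord k x : continuous (fun t : R => set_coord k x t).
Proof.
move=> t; apply/cvg_ballP => e e0.
have := nbhsx_ballx t _ e0; apply: filterS => u /= tu.
by elim/ord3_ind: k; rewrite /set_coord/=; (split; [split|]) => //=; exact: ballxx.
Qed.

Local Open Scope ereal_scope.

Lemma integral_derive_compact (h h' : R -> R) (L : R) :
  (forall t, is_derive t (1:R)%R h (h' t)) -> continuous h' ->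
  (0 < L)%R -> (forall t, L < `|t| -> h t = 0)%R -> (forall t, L < `|t| -> h' t = 0)%R ->
  \int[leb]_t (h' t)%:E = 0.
Proof.
move=> dh ch' L0 h0 h'0.
have L1 : (- (L + 1) < L + 1)%R by lra.
have hc : continuous h.
  by move=> t; apply/differentiable_continuous/derivable1_diffP; exact: ex_derive.
transitivity (\int[leb]_(t in `[(- (L + 1))%R, (L + 1)%R]) (h' t)%:E).
  rewrite [RHS]integral_mkcond; apply: eq_integral => t _.
  rewrite /patch mem_setE in_itv/= -ler_norml; case: ifPn => //.
  by rewrite -ltNge => lt; rewrite h'0// (lt_trans _ lt)// ltrDl.
rewrite (continuous_FTC2 L1 (F := h)).
- rewrite !h0 ?sube0//.
    by rewrite normrN ger0_norm ?ltrDl// addr_ge0// ltW.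
  by rewrite ger0_norm ?ltrDl// addr_ge0// ltW.
- by apply: continuous_subspaceT => t; exact: ch'.
- split.
  + by move=> t _; exact: ex_derive.
  + by apply: cvg_at_right_filter; exact: hc.
  + by apply: cvg_at_left_filter; exact: hc.
- by move=> t _; rewrite derive1E; exact: derive_val.
Qed.

(** Fubini's theorem, with the [k]-th variable integrated first. The function is only
    integrable, so the inner integrals are known to make sense for almost all values of
    the other variables. *)
Lemma integral3_lines0 (F : R3 R -> \bar R) (k : 'I_3) :
  mu3.-integrable setT F -> (forall x, \int[leb]_t F (set_coord k x t) = 0) ->
  \int[mu3]_x F x = 0.
Proof.
move=> iF; have iF2 : (lebesgue2 \x leb).-integrable setT F by exact: iF.
elim/ord3_ind: k => H.
- have E : \int[leb]_t fubini_G lebesgue2 F t = \int[mu3]_x F x by exact: (integral21_prod_meas1 iF2).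
  rewrite -E.
  have mG := measurable_fubini_G iF2.
  rewrite (@ae_eq_integral _ _ _ leb setT (cst 0) (fubini_G lebesgue2 F))//.
    by rewrite integral0.
  have := ae_integrable2 iF2; apply: filterS => t it _.
  rewrite /fubini_G.
  have it2 : (leb \x leb).-integrable setT (fun p : measurableTypeR R * measurableTypeR R => F (p, t)) by exact: it.
  have -> : \int[lebesgue2]_p F (p, t) = \int[leb]_v fubini_G leb (fun p : measurableTypeR R * measurableTypeR R => F (p, t)) v.
    by symmetry; exact: (integral21_prod_meas1 it2).
  by rewrite /fubini_G integral0_eq// => v _; exact: (H ((0, v), t)%R).
- have E : \int[leb]_t fubini_G lebesgue2 F t = \int[mu3]_x F x by exact: (integral21_prod_meas1 iF2).
  rewrite -E.
  have mG := measurable_fubini_G iF2.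
  rewrite (@ae_eq_integral _ _ _ leb setT (cst 0) (fubini_G lebesgue2 F))//.
    by rewrite integral0.
  have := ae_integrable2 iF2; apply: filterS => t it _.
  rewrite /fubini_G.
  have it2 : (leb \x leb).-integrable setT (fun p : measurableTypeR R * measurableTypeR R => F (p, t)) by exact: it.
  have -> : \int[lebesgue2]_p F (p, t) = \int[leb]_v fubini_F leb (fun p : measurableTypeR R * measurableTypeR R => F (p, t)) v.
    by symmetry; exact: (integral12_prod_meas1 it2).
  by rewrite /fubini_F integral0_eq// => v _; exact: (H ((v, 0), t)%R).
- have E : \int[lebesgue2]_p fubini_F leb F p = \int[mu3]_x F x by exact: (integral12_prod_meas1 iF2).
  by rewrite -E /fubini_F integral0_eq// => -[u v] _; exact: (H ((u, v), 0)%R).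
Qed.

Lemma ge0_int_le_integrable d (T : measurableType d) (mu : {measure set T -> \bar R}) (f g : T -> R) (C : R) :
  measurable_fun setT f -> {ae mu, forall x, (`|f x| <= g x)%R} -> ge0_int_le mu g C ->
  mu.-integrable setT (EFin \o f).
Proof.
move=> mf fg [mg g0 gC]; apply/integrableP; split; first exact/measurable_EFinP.
apply: (@le_lt_trans _ _ (\int[mu]_x (g x)%:E)); last first.
  by apply: le_lt_trans gC _; rewrite ltry.
apply: ae_ge0_le_integral => //.
- by apply: measurableT_comp => //; exact/measurable_EFinP.
- by move=> x _; rewrite lee_fin.
- exact/measurable_EFinP.
- by apply: filterS fg => x h _; rewrite /= lee_fin.
Qed.

Lemma ge0_int_le_indic (L : R) : (0 < L)%R -> ge0_int_le leb (\1_`[(- L)%R, L] : R -> R) (L + L)%R.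
Proof.
move=> L0; split => //.
rewrite integral_indic//= setIT lebesgue_measure_itv/= lte_fin.
by case: ifP => _; rewrite -?EFinB lee_fin; lra.
Qed.

Definition boxind (L : R) : R3 R -> R := tensor (\1_`[(- L)%R, L]) (\1_`[(- L)%R, L]) (\1_`[(- L)%R, L]).

Lemma boxindE L x : boxind L x = (box L x)%:R.
Proof.
rewrite /boxind /tensor !indicE !mem_setE !in_itv/= -!ler_norml /box -!natrM.
by rewrite !mulnb andbA.
Qed.

Lemma ge0_int_le_boxind L : (0 < L)%R -> ge0_int_le mu3 (boxind L) ((L + L) * (L + L) * (L + L))%R.
Proof. by move=> L0; apply: ge0_int_le_tensor; exact: ge0_int_le_indic. Qed.

Lemma bounded_in_box_integrable (f : R3 R -> R) M L : (0 < L)%R -> bounded_in_box f M L -> mu3.-integrable setT (EFin \o f).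
Proof.
move=> L0 [mf fM f0].
have M0 : (0 <= M)%R by apply: le_trans (fM (0, 0, 0)%R).
have := ge0_int_leZ M0 (ge0_int_le_boxind L0); apply: ge0_int_le_integrable => //.
apply: nearW => x; rewrite boxindE; have [bx|nbx] := boolP (box L x).
  by rewrite mulr1.
by rewrite f0// normr0 mulr0.
Qed.

Lemma bounded_in_boxM (f g : R3 R -> R) M L G : measurable_fun setT g -> (0 <= G)%R -> (forall x, `|g x| <= G)%R ->
  bounded_in_box f M L -> bounded_in_box (fun x => f x * g x)%R (M * G) L.
Proof.
move=> mg G0 gG [mf fM f0]; split.
- exact: measurable_funM.
- by move=> x; rewrite normrM ler_pM.
- by move=> x /f0 ->; rewrite mul0r.
Qed.

Lemma box_set_coord L k x t : (L < `|t|)%R -> ~~ box L (set_coord k x t).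
Proof.
by move=> Lt; elim/ord3_ind: k; rewrite /box /set_coord/= (lt_geF Lt) ?andbF.
Qed.

(** On each line in the direction [k] the derivative of [f g] has integral [0], because [f]
    vanishes outside the box. Only the derivatives along these lines are required of [g]. *)
Lemma integration_by_parts3 (f g g' : R3 R -> R) (k : 'I_3) (M L M' G G' : R) :
  (0 < L)%R -> continuous f -> (forall x, derivable f x (basis3 k)) -> continuous (partial k f) ->
  bounded_in_box f M L -> bounded_in_box (partial k f) M' L ->
  (forall x (t : R), is_derive t (1 : R)%R (fun u : R => g (set_coord k x u)) (g' (set_coord k x t))) ->
  (forall x, continuous (fun t : R => g' (set_coord k x t))) ->
  measurable_fun setT g -> measurable_fun setT g' ->
  (forall x, `|g x| <= G)%R -> (forall x, `|g' x| <= G')%R ->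
  (\int[mu3]_x (partial k f x * g x) = - \int[mu3]_x (f x * g' x))%R.
Proof.
move=> L0 cf df cdf bf bdf dg cg' mg mg' gG gG'.
have G0 : (0 <= G)%R by apply: le_trans (gG (0, 0, 0)%R).
have G'0 : (0 <= G')%R by apply: le_trans (gG' (0, 0, 0)%R).
have b1 := bounded_in_boxM mg G0 gG bdf.
have b2 := bounded_in_boxM mg' G'0 gG' bf.
have i1 := bounded_in_box_integrable L0 b1.
have i2 := bounded_in_box_integrable L0 b2.
apply/eqP; rewrite -addr_eq0 -RintegralD//; apply/eqP.
rewrite /Rintegral (@integral3_lines0 _ k)//; first exact: integrableD i1 i2.
move=> x.
have line (h : R3 R -> R) (M0 : R) : bounded_in_box h M0 L -> forall t, (L < `|t|)%R -> h (set_coord k x t) = 0%R.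
  by move=> [_ _ h0] t Lt; apply: h0; exact: box_set_coord.
have cupd : continuous (fun t : R => set_coord k x t) by exact: continuous_set_coord.
have cg : continuous (fun t : R => g (set_coord k x t)).
  by move=> t; apply/differentiable_continuous/derivable1_diffP; exact: ex_derive.
apply: (@integral_derive_compact (fun t => f (set_coord k x t) * g (set_coord k x t))%R
  (fun t => partial k f (set_coord k x t) * g (set_coord k x t) + f (set_coord k x t) * g' (set_coord k x t))%R L) => //.
- move=> t; have d1 := is_derive_line (df (set_coord k x t)).
  have d2 := dg x t.
  apply: is_derive_eq; rewrite /GRing.scale/=; ring.
- move=> t; apply: cvgD; apply: cvgM.
  + by apply: (@continuous_comp _ _ _ (set_coord k x) (partial k f)); [exact: cupd|exact: cdf].
  + exact: cg.
  + by apply: (@continuous_comp _ _ _ (set_coord k x) f); [exact: cupd|exact: cf].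
  + exact: cg'.
- by move=> t Lt; rewrite (line _ _ bf)// mul0r.
- by move=> t Lt; rewrite (line _ _ bf)// (line _ _ bdf)// !mul0r addr0.
Qed.

End Lines.

(** * Integrals of inverse powers of square roots *)

Section Mass.
Context {R : realType}.
Local Notation leb := (@lebesgue_measure R).

Lemma is_derive_add (f g : R -> R) (t df dg : R) : is_derive t (1:R) f df ->
  is_derive t (1:R) g dg -> is_derive t (1:R) (fun u => f u + g u) (df + dg).
Proof. exact: is_deriveD. Qed.

Lemma is_derive_mul (f g : R -> R) (t df dg : R) : is_derive t (1:R) f df ->
  is_derive t (1:R) g dg -> is_derive t (1:R) (fun u => f u * g u) (df * g t + f t * dg).
Proof.
move=> d1 d2; apply: (is_derive_eq (is_deriveM d1 d2)).
by rewrite /GRing.scale/= addrC mulrC.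
Qed.

Lemma is_derive_scal (c : R) (f : R -> R) (t df : R) : is_derive t (1:R) f df ->
  is_derive t (1:R) (fun u => c * f u) (c * df).
Proof. exact: is_deriveZ. Qed.

Lemma is_derive_exp (f : R -> R) (n : nat) (t df : R) : is_derive t (1:R) f df ->
  is_derive t (1:R) (fun u => f u ^+ n) (n%:R * f t ^+ n.-1 * df).
Proof.
move=> d1; have := is_deriveX n d1.
by rewrite (_ : (f ^+ n) = (fun u => f u ^+ n))//; apply/funext => u; rewrite fctE.
Qed.

Lemma is_derive_sub (c t : R) : is_derive t (1:R) (fun u => u - c) 1.
Proof. exact: is_derive_shift. Qed.

(** The reciprocal square root [(a + u^2)^(-1/2)]. The distance to a point, as a function of
    one coordinate, has this form up to a shift. *)
Definition rsq (a u : R) : R := (Num.sqrt (a + u ^+ 2))^-1.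

Lemma rsq_gt0 a u : 0 < a -> 0 < rsq a u.
Proof. by move=> a0; rewrite invr_gt0 sqrtr_gt0 ltr_wpDr// sqr_ge0. Qed.

Lemma rsq2 a u : 0 < a -> rsq a u ^+ 2 * (a + u ^+ 2) = 1.
Proof.
move=> a0; have h : 0 < a + u ^+ 2 by rewrite ltr_wpDr// sqr_ge0.
by rewrite /rsq exprVn sqr_sqrtr ?ltW// mulVf// gt_eqF.
Qed.

Lemma is_derive_rsq (a c t : R) : 0 < a ->
  is_derive t (1:R) (fun u : R => rsq a (u - c)) (- (t - c) * rsq a (t - c) ^+ 3).
Proof.
move=> a0; have h : 0 < a + (t - c) ^+ 2 by rewrite ltr_wpDr// sqr_ge0.
have dq : is_derive t (1:R) (fun u : R => a + (u - c) ^+ 2) (2 * (t - c)).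
  apply: (is_derive_eq (is_derive_add (is_derive_cst a t (1:R)) (is_derive_exp 2 (is_derive_sub c t)))).
  by rewrite add0r mulr1 expr1.
have ds := @is_derive1_comp _ _ (fun u : R => a + (u - c) ^+ 2) t _ _ (is_derive1_sqrt h) dq.
have s0 : Num.sqrt (a + (t - c) ^+ 2) != 0 by rewrite gt_eqF// sqrtr_gt0.
have := @is_deriveV _ (Num.sqrt \o (fun u : R => a + (u - c) ^+ 2)) t _ _ s0 ds.
move=> d; apply: (is_derive_eq d).
rewrite /GRing.scale/= /rsq; field; exact: s0.
Qed.

Lemma is_derive_rsq0 (a t : R) : 0 < a ->
  is_derive t (1:R) (rsq a) (- t * rsq a t ^+ 3).
Proof.
move=> a0; have := is_derive_rsq 0 t a0; rewrite subr0.
by under eq_fun do rewrite subr0.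
Qed.

Lemma is_derive_mul_rsq (a t : R) : 0 < a ->
  is_derive t (1:R) (fun u => u * rsq a u) (a * rsq a t ^+ 3).
Proof.
move=> a0; have d := is_derive_rsq0 t a0.
apply: (is_derive_eq (is_derive_mul (is_derive_id t (1:R)) d)); rewrite mul1r.
have e := rsq2 t a0.
transitivity (rsq a t * (rsq a t ^+ 2 * (a + t ^+ 2)) - t * (t * rsq a t ^+ 3)); last by ring.
by rewrite e mulr1 -mulrN mulNr.
Qed.

Lemma rsq_cvgy a : 0 < a -> rsq a u @[u --> +oo] --> 0.
Proof.
move=> a0; apply/cvgr0Pnorm_le => e e0; near=> t.
have t0 : e^-1 <= t by near: t; apply: nbhs_pinfty_ge; rewrite num_real.
have tp : 0 < t by apply: lt_le_trans t0; rewrite invr_gt0.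
rewrite gtr0_norm ?rsq_gt0// /rsq -[leRHS]invrK lef_pV2 ?posrE ?invr_gt0// ?sqrtr_gt0 ?ltr_wpDr ?sqr_ge0//.
by rewrite (le_trans t0)// -{1}(ger0_norm (ltW tp)) -sqrtr_sqr ler_wsqrtr// lerDr ltW.
Unshelve. all: by end_near. Qed.

Lemma mul_rsq_cvgy a : 0 < a -> u * rsq a u @[u --> +oo] --> (1:R).
Proof.
move=> a0.
have h1 : (1 - a * (rsq a u * rsq a u)) @[u --> +oo] --> (1 - a * (0 * 0) : R).
  apply: cvgB; first exact: cvg_cst.
  by apply: cvgMr; apply: cvgM; exact: rsq_cvgy.
rewrite !mulr0 subr0 in h1.
apply: (squeeze_cvgr _ h1 (cvg_cst (1:R))).
near=> t.
have t0 : 0 <= t by near: t; apply: nbhs_pinfty_ge; rewrite num_real.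
have e := rsq2 t a0; have r0 := rsq_gt0 t a0.
have e1 : (t * rsq a t) ^+ 2 = 1 - a * (rsq a t * rsq a t) by rewrite -e; ring.
have p0 : 0 <= t * rsq a t by rewrite mulr_ge0// ltW.
have p1 : t * rsq a t <= 1.
  rewrite -(@expr_le1 _ 2)// e1 gerBl mulr_ge0 ?mulr_ge0 ?ltW//.
by rewrite p1 andbT -e1 expr2 ler_piMr.
Unshelve. all: by end_near. Qed.

Local Open Scope ereal_scope.

Lemma integral_even_primitive (f F : R -> R) (l : R) :
  (forall t, 0 <= f t)%R -> continuous f -> (forall t, f (- t) = f t)%R ->
  (forall t, is_derive t (1:R)%R F (f t)) -> F 0%R = 0%R -> F t @[t --> +oo%R] --> l ->
  \int[leb]_t (f t)%:E = (2 * l)%:E.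
Proof.
move=> f0 cf fe dF F0 Fl.
rewrite ge0_symfun_integralT//; last by move=> t /=; rewrite fe.
rewrite -set_itvcy (@ge0_continuous_FTC2y _ _ F _ l)//.
- by rewrite F0 sube0.
- exact: continuous_subspaceT.
- apply: cvg_at_right_filter; apply/differentiable_continuous/derivable1_diffP.
  exact: ex_derive.
- by move=> t _; rewrite derive1E; exact: derive_val.
Qed.

Lemma rsqN a t : rsq a (- t) = rsq a t.
Proof. by rewrite /rsq sqrrN. Qed.

Lemma continuous_rsqX a n : (0 < a)%R -> continuous (fun t : R => rsq a t ^+ n)%R.
Proof.
move=> a0 t; apply/differentiable_continuous/derivable1_diffP.
exact: (ex_derive (is_derive := is_derive_exp n (is_derive_rsq0 t a0))).
Qed.

(** Primitive: [u (a + u^2)^(-1/2) / a]. *)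
Lemma integral_rsq3 (a : R) : (0 < a)%R -> \int[leb]_t (rsq a t ^+ 3)%:E = (2 / a)%:E.
Proof.
move=> a0; apply: (@integral_even_primitive _ (fun u => a^-1 * (u * rsq a u))%R a^-1).
- by move=> t; rewrite exprn_ge0// ltW// rsq_gt0.
- exact: continuous_rsqX.
- by move=> t; rewrite rsqN.
- move=> t; apply: (is_derive_eq (is_derive_scal a^-1 (is_derive_mul_rsq t a0))).
  by rewrite mulrA mulVf ?gt_eqF// mul1r.
- by rewrite mul0r mulr0.
- by rewrite -[X in _ --> X]mulr1; apply: cvgMr; exact: mul_rsq_cvgy.
Qed.

(** Primitive: [(w - w^3 / 3) / a^2] with [w = u (a + u^2)^(-1/2)]. *)
Lemma integral_rsq5 (a : R) : (0 < a)%R -> \int[leb]_t (rsq a t ^+ 5)%:E = (4 / (3 * a ^+ 2))%:E.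
Proof.
move=> a0.
have -> : (4 / (3 * a ^+ 2) = 2 * ((a ^+ 2)^-1 * (1 + (- 3^-1) * (1 * 1 * 1))))%R.
  by field; rewrite gt_eqF.
apply: (@integral_even_primitive _
  (fun u => (a ^+ 2)^-1 * (u * rsq a u + (- 3^-1) * (u * rsq a u) ^+ 3))%R).
- by move=> t; rewrite exprn_ge0// ltW// rsq_gt0.
- exact: continuous_rsqX.
- by move=> t; rewrite rsqN.
- move=> t; have d := is_derive_mul_rsq t a0.
  apply: (is_derive_eq (is_derive_scal (a ^+ 2)^-1 (is_derive_add d (is_derive_scal (- 3^-1) (is_derive_exp 3 d))))).
  have e := rsq2 t a0.
  have -> : (rsq a t ^+ 5 = (a ^+ 2)^-1 * (a * rsq a t ^+ 3 * (a * rsq a t ^+ 2)))%R.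
    by field; rewrite gt_eqF.
  have -> : (a * rsq a t ^+ 2 = 1 - (t * rsq a t) ^+ 2)%R by rewrite -e; ring.
  by field; rewrite gt_eqF.
- by rewrite mul0r expr0n/= mulr0 addr0 mulr0.
- have h := mul_rsq_cvgy a0.
  apply: cvgMr; apply: cvgD => //; apply: cvgMr.
  have -> : (fun t => (t * rsq a t) ^+ 3)%R = (fun t => (t * rsq a t) * (t * rsq a t) * (t * rsq a t))%R.
    by apply/funext => t; ring.
  by apply: cvgM => //; apply: cvgM.
Qed.

(** Primitive: [(u / (b + u^2) + b^(-1/2) atan (b^(-1/2) u)) / (2 b)]. *)
Lemma integral_rsq4 (b : R) : (0 < b)%R ->
  \int[leb]_t (rsq b t ^+ 4)%:E = (pi / (2 * b) * rsq b 0)%:E.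
Proof.
move=> b0.
have s0 : (0 < Num.sqrt b)%R by rewrite sqrtr_gt0.
have sb : (Num.sqrt b ^+ 2 = b)%R by rewrite sqr_sqrtr// ltW.
have r0E : rsq b 0 = (Num.sqrt b)^-1%R by rewrite /rsq expr0n addr0.
have -> : (pi / (2 * b) * rsq b 0 = 2 * ((2 * b)^-1 * (1 * 0 + (Num.sqrt b)^-1 * (pi / 2))))%R.
  by rewrite r0E; field; rewrite !gt_eqF.
apply: (@integral_even_primitive _
  (fun u => (2 * b)^-1 * ((u * rsq b u) * rsq b u + (Num.sqrt b)^-1 * atan ((Num.sqrt b)^-1 * u)))%R).
- by move=> t; rewrite exprn_ge0// ltW// rsq_gt0.
- exact: continuous_rsqX.
- by move=> t; rewrite rsqN.
- move=> t.
  have d1 := is_derive_mul (is_derive_mul_rsq t b0) (is_derive_rsq0 t b0).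
  have d2 := @is_derive1_comp _ atan (fun u : R => (Num.sqrt b)^-1 * u)%R t _ _ (is_derive1_atan _) (is_derive_scal (Num.sqrt b)^-1 (is_derive_id t (1:R)%R)).
  apply: (is_derive_eq (is_derive_scal (2 * b)^-1 (is_derive_add d1 (is_derive_scal (Num.sqrt b)^-1 d2)))).
  have e := rsq2 t b0.
  have q0 : (0 < b + t ^+ 2)%R by rewrite ltr_wpDr// sqr_ge0.
  have e2 : (rsq b t ^+ 2 = (b + t ^+ 2)^-1)%R.
    by rewrite -[RHS]mul1r -e mulfK// gt_eqF.
  have e4 : (rsq b t ^+ 4 = (b + t ^+ 2)^-1 ^+ 2)%R by rewrite -e2; ring.
  have -> : ((Num.sqrt b)^-1 * ((1 + ((Num.sqrt b)^-1 * t) ^+ 2)^-1 * ((Num.sqrt b)^-1 * 1)) = (b + t ^+ 2)^-1)%R.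
    rewrite -{4}sb; field.
    by rewrite sb !gt_eqF.
  have -> : (b * rsq b t ^+ 3 * rsq b t + t * rsq b t * (- t * rsq b t ^+ 3) = (b - t ^+ 2) * rsq b t ^+ 4)%R by ring.
  rewrite e4; field; by rewrite !gt_eqF.
- by rewrite mul0r mul0r mulr0 atan0 mulr0 addr0 mulr0.
- apply: cvgMr; apply: cvgD.
    by apply: cvgM; [exact: mul_rsq_cvgy|exact: rsq_cvgy].
  apply: cvgMr.
  apply: (@cvg_comp _ _ _ (fun u : R => (Num.sqrt b)^-1 * u)%R atan _ (pinfty_nbhs R)); last exact: cvgy_atan.
  by apply: gt0_cvgMry; [rewrite invr_gt0|exact: cvg_id].
Qed.

End Mass.

(** * The regularized Newton field *)

Section Newton.
Context {R : realType}.
Local Notation leb := (@lebesgue_measure R).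

Definition dist2 (y x : R3 R) : R :=
  (x.1.1 - y.1.1) ^+ 2 + (x.1.2 - y.1.2) ^+ 2 + (x.2 - y.2) ^+ 2.
(** The inverse of the regularized distance; it is the inverse distance for [e = 0]. *)
Definition rdist (e : R) (y x : R3 R) : R := (Num.sqrt (e ^+ 2 + dist2 y x))^-1.
Definition dcoord (m : 'I_3) (y x : R3 R) : R := coord3 m x - coord3 m y.

Lemma dist2_ge0 y x : 0 <= dist2 y x.
Proof. by rewrite !addr_ge0// sqr_ge0. Qed.

Lemma dist2_gt0 y x : x.1.1 != y.1.1 -> 0 < dist2 y x.
Proof.
move=> n1; rewrite /dist2 -addrA ltr_pwDl ?addr_ge0 ?sqr_ge0//.
by rewrite exprn_even_gt0//= subr_eq0.
Qed.

Lemma sum_dcoord y x : \sum_k dcoord k y x ^+ 2 = dist2 y x.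
Proof. by rewrite !big_ord_recl big_ord0 addr0 addrA. Qed.

Lemma norm3_dist2 x y : norm3 (x - y) = Num.sqrt (dist2 y x).
Proof. by rewrite /norm3 !big_ord_recl big_ord0 addr0 addrA. Qed.

Lemma dcoord_le_dist2 m y x : dcoord m y x ^+ 2 <= dist2 y x.
Proof.
rewrite -sum_dcoord (bigD1 m)//= lerDl; apply: sumr_ge0 => i _; exact: sqr_ge0.
Qed.

Lemma coord3_set_coord m k (x : R3 R) t : coord3 m (set_coord k x t) = if m == k then t else coord3 m x.
Proof. by elim/ord3_ind: k; elim/ord3_ind: m. Qed.

Lemma measurable_coord3k m : measurable_fun setT (fun x : R3 R => coord3 m x).
Proof.
elim/ord3_ind: m; rewrite /coord3/=;
  [exact: measurable_coord1|exact: measurable_coord2|exact: measurable_coord3].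
Qed.

Lemma measurable_dcoord m : measurable_fun setT (fun p : R3 R * R3 R => dcoord m p.2 p.1).
Proof.
apply: measurable_funB.
  exact: (measurable_pair_l (measurable_coord3k m)).
exact: (measurable_pair_r (measurable_coord3k m)).
Qed.

Lemma measurable_sqrt : measurable_fun setT (@Num.sqrt R).
Proof. apply: continuous_measurable_fun => t; exact: sqrt_continuous. Qed.

Lemma measurable_rdist e : measurable_fun setT (fun p : R3 R * R3 R => rdist e p.2 p.1).
Proof.
apply: measurable_funV; apply: (measurableT_comp measurable_sqrt).
under eq_fun do rewrite -sum_dcoord !big_ord_recl big_ord0.
do ! [apply: measurable_funD => //]; apply: measurable_funX; exact: measurable_dcoord.
Qed.

Lemma rdist_ge0 e y x : 0 <= rdist e y x.
Proof. by rewrite invr_ge0 sqrtr_ge0. Qed.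

Lemma rdist2 e y x : 0 < e -> rdist e y x ^+ 2 * (e ^+ 2 + dist2 y x) = 1.
Proof.
move=> e0; have h : 0 < e ^+ 2 + dist2 y x by rewrite ltr_wpDr ?dist2_ge0// exprn_gt0.
by rewrite /rdist exprVn sqr_sqrtr ?ltW// mulVf// gt_eqF.
Qed.

Lemma rdist_set_coord e k y x t : 0 < e ->
  rdist e y (set_coord k x t) = rsq (e ^+ 2 + dist2 y (set_coord k x (coord3 k y))) (t - coord3 k y).
Proof.
by move=> e0; rewrite /rdist /rsq /dist2; congr (Num.sqrt _)^-1; elim/ord3_ind: k;
  rewrite /set_coord /coord3/= subrr expr0n/=; ring.
Qed.

Lemma rest_gt0 e k y (x : R3 R) : 0 < e -> 0 < e ^+ 2 + dist2 y (set_coord k x (coord3 k y)).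
Proof. by move=> e0; rewrite ltr_wpDr ?dist2_ge0// exprn_gt0. Qed.

Lemma is_derive_rdist e k y x t : 0 < e ->
  is_derive t (1:R) (fun u : R => rdist e y (set_coord k x u))
    (- dcoord k y (set_coord k x t) * rdist e y (set_coord k x t) ^+ 3).
Proof.
move=> e0; have d := is_derive_rsq (coord3 k y) t (rest_gt0 k y x e0).
have -> : (fun u : R => rdist e y (set_coord k x u)) =
    (fun u : R => rsq (e ^+ 2 + dist2 y (set_coord k x (coord3 k y))) (u - coord3 k y)).
  by apply/funext => u; rewrite rdist_set_coord.
by apply: (is_derive_eq d); rewrite rdist_set_coord// /dcoord coord3_set_coord eqxx.
Qed.

Lemma is_derive_dcoord k m y x (t : R) :
  is_derive t (1:R) (fun u : R => dcoord m y (set_coord k x u)) ((m == k)%:R).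
Proof.
rewrite /dcoord; have [->|mk] := eqVneq m k.
  under eq_fun do rewrite coord3_set_coord eqxx; exact: is_derive_sub.
have -> : (fun u : R => coord3 m (set_coord k x u) - coord3 m y) = cst (coord3 m x - coord3 m y).
  by apply/funext => u; rewrite coord3_set_coord (negbTE mk).
exact: is_derive_cst.
Qed.

(** The [m]-th component at [x - y] of the regularized Newton field
    [z / (|z|^2 + e^2)^(3/2)]; for [e = 0] it is [z / |z|^3], the kernel of [G0] up to the
    matrix factors. *)
Definition field_reg e (m : 'I_3) (y x : R3 R) : R := dcoord m y x * rdist e y x ^+ 3.
(** The derivative of [field_reg e m y] in the direction [k]. *)
Definition dfield_reg e (k m : 'I_3) (y x : R3 R) : R :=
  (m == k)%:R * rdist e y x ^+ 3 - 3 * (dcoord m y x * dcoord k y x) * rdist e y x ^+ 5.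

Lemma is_derive_field_reg e k m y x (t : R) : 0 < e ->
  is_derive t (1:R) (fun u : R => field_reg e m y (set_coord k x u)) (dfield_reg e k m y (set_coord k x t)).
Proof.
move=> e0; have d1 := is_derive_dcoord k m y x t; have d2 := is_derive_rdist k y x t e0.
apply: (is_derive_eq (is_derive_mul d1 (is_derive_exp 3 d2))); rewrite /dfield_reg/=; ring.
Qed.

Lemma continuous_dfield_reg e k m y x : 0 < e ->
  continuous (fun t : R => dfield_reg e k m y (set_coord k x t)).
Proof.
move=> e0 t; apply/differentiable_continuous/derivable1_diffP.
have d1 := is_derive_dcoord k m y x t; have d1' := is_derive_dcoord k k y x t.
have d2 := is_derive_rdist k y x t e0.
have d3 := is_derive_scal (m == k)%:R (is_derive_exp 3 d2).
have d4 := is_derive_mul (is_derive_scal (- 3) (is_derive_mul d1 d1')) (is_derive_exp 5 d2).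
have := is_derive_add d3 d4.
rewrite (_ : (fun u : R => _) = (fun t : R => dfield_reg e k m y (set_coord k x t))).
  by move=> d; exact: ex_derive.
by apply/funext => u; rewrite /dfield_reg; ring.
Qed.

Lemma dcoord_rdist_le1 e m y x : 0 < e -> `|dcoord m y x| * rdist e y x <= 1.
Proof.
move=> e0; rewrite -(@expr_le1 _ 2)// ?mulr_ge0 ?rdist_ge0// exprMn real_normK ?num_real//.
rewrite -(rdist2 y x e0) mulrC ler_wpM2l ?exprn_ge0 ?rdist_ge0//.
by apply: le_trans (dcoord_le_dist2 m y x) _; rewrite lerDr sqr_ge0.
Qed.

Lemma rdist_le e y x : 0 < e -> rdist e y x <= e^-1.
Proof.
move=> e0; rewrite /rdist lef_pV2 ?posrE// ?sqrtr_gt0 ?ltr_wpDr ?dist2_ge0 ?exprn_gt0//.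
by rewrite -{1}(ger0_norm (ltW e0)) -sqrtr_sqr ler_wsqrtr// lerDl dist2_ge0.
Qed.

Lemma field_reg_le e m y x : 0 < e -> `|field_reg e m y x| <= rdist e y x ^+ 2.
Proof.
move=> e0; rewrite /field_reg normrM (ger0_norm (exprn_ge0 _ (rdist_ge0 _ _ _))).
by rewrite exprS mulrA ler_piMl ?exprn_ge0 ?rdist_ge0// dcoord_rdist_le1.
Qed.

Lemma dfield_reg_le e k m y x : 0 < e -> `|dfield_reg e k m y x| <= 4 * rdist e y x ^+ 3.
Proof.
move=> e0; have r0 := rdist_ge0 e y x; have r3 := exprn_ge0 3 r0.
rewrite /dfield_reg; apply: (le_trans (ler_normB _ _)).
have -> : 4 * rdist e y x ^+ 3 = rdist e y x ^+ 3 + 3 * rdist e y x ^+ 3 by ring.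
apply: lerD.
  rewrite normrM (ger0_norm r3) ler_piMl//; case: (m == k); rewrite ?normr1 ?normr0//.
rewrite normrM (ger0_norm (exprn_ge0 5 r0)) normrM normrM [`|3|]ger0_norm//.
have -> : 3 * (`|dcoord m y x| * `|dcoord k y x|) * rdist e y x ^+ 5 =
  (`|dcoord m y x| * rdist e y x) * (`|dcoord k y x| * rdist e y x) * (3 * rdist e y x ^+ 3) by ring.
rewrite ler_piMl ?mulr_ge0//.
by rewrite mulr_ile1 ?mulr_ge0// dcoord_rdist_le1.
Qed.

Lemma measurable_section2 (K : R3 R -> R3 R -> R) y :
  measurable_fun setT (fun p : R3 R * R3 R => K p.2 p.1) ->
  measurable_fun setT (fun x => K y x).
Proof. by move=> mK; exact: (measurable_section_r y mK). Qed.

Lemma measurable_field_reg e m : measurable_fun setT (fun p : R3 R * R3 R => field_reg e m p.2 p.1).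
Proof.
apply: measurable_funM; first exact: measurable_dcoord.
by apply: measurable_funX; exact: measurable_rdist.
Qed.

Lemma measurable_dfield_reg e k m :
  measurable_fun setT (fun p : R3 R * R3 R => dfield_reg e k m p.2 p.1).
Proof.
apply: measurable_funB; apply: measurable_funM.
- by [].
- by apply: measurable_funX; exact: measurable_rdist.
- by apply: measurable_funM => //; apply: measurable_funM; exact: measurable_dcoord.
- by apply: measurable_funX; exact: measurable_rdist.
Qed.

(** What is used of the real and imaginary parts of a test function. *)
Definition C1_in_box (f : R3 R -> R) (M L : R) : Prop :=
  [/\ 0 < L, continuous f, bounded_in_box f M L &
   forall k, [/\ forall x, derivable f x (basis3 k), continuous (partial k f) & bounded_in_box (partial k f) M L]].

Lemma ibp_field_reg f M L e k m y : 0 < e -> C1_in_box f M L ->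
  (\int[mu3]_x (partial k f x * field_reg e m y x) = - \int[mu3]_x (f x * dfield_reg e k m y x))%R.
Proof.
move=> e0 [L0 cf bf pf]; have [df cdf bdf] := pf k.
apply: (@integration_by_parts3 _ f (field_reg e m y) (dfield_reg e k m y) k M L M (e^-1 ^+ 2) (4 * e^-1 ^+ 3)) => //.
- by move=> x t; exact: is_derive_field_reg.
- by move=> x; exact: continuous_dfield_reg.
- exact: (@measurable_section2 (field_reg e m) y (measurable_field_reg _ _)).
- exact: (@measurable_section2 (dfield_reg e k m) y (measurable_dfield_reg _ _ _)).
- move=> x; apply: le_trans (field_reg_le m y x e0) _.
  by rewrite lerXn2r ?nnegrE ?rdist_ge0 ?invr_ge0 ?(ltW e0) ?rdist_le.
- move=> x; apply: le_trans (dfield_reg_le k m y x e0) _.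
  by rewrite ler_wpM2l// lerXn2r ?nnegrE ?rdist_ge0 ?invr_ge0 ?(ltW e0) ?rdist_le.
Qed.

Local Open Scope ereal_scope.

(** The divergence of the regularized Newton field. *)
Definition bump e (y x : R3 R) : R := (3 * e ^+ 2 * rdist e y x ^+ 5)%R.

Lemma bump_ge0 e y x : (0 <= bump e y x)%R.
Proof.
apply: mulr_ge0; first by apply: mulr_ge0 => //; exact: sqr_ge0.
by apply: exprn_ge0; exact: rdist_ge0.
Qed.

Lemma measurable_bump e y : measurable_fun setT (bump e y).
Proof.
apply: (@measurable_section2 (bump e) y); apply: measurable_funM => //.
by apply: measurable_funX; exact: measurable_rdist.
Qed.

Lemma integral_translateZ (g : R -> R) (c s : R) : measurable_fun setT g -> (forall t, 0 <= g t)%R ->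
  (0 <= c)%R ->
  \int[leb]_t (c * g (t - s))%:E = c%:E * \int[leb]_t (g t)%:E.
Proof.
move=> mg g0 c0.
rewrite (@ge0_integral_translate _ (fun t => (c * g t)%:E))//.
- under eq_integral do rewrite EFinM.
  rewrite ge0_integralZl//; first by apply/measurable_EFinP; exact: mg.
  by move=> t _; rewrite lee_fin.
- by apply/measurable_EFinP; apply: measurable_funM.
- by move=> t; rewrite lee_fin mulr_ge0.
Qed.

Lemma measurable_rsqX (a : R) n : (0 < a)%R -> measurable_fun setT (fun t : R => rsq a t ^+ n)%R.
Proof. by move=> a0; apply: continuous_measurable_fun; exact: continuous_rsqX. Qed.

Lemma rsqX_ge0 (a : R) n t : (0 < a)%R -> (0 <= rsq a t ^+ n)%R.
Proof. by move=> a0; rewrite exprn_ge0// ltW// rsq_gt0. Qed.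

(** Integrating one coordinate at a time only meets the three integrals of powers of
    [rsq], as each integration lowers the power of the inverse distance by one. *)
Lemma integral_bump (e : R) y : (0 < e)%R -> \int[mu3]_x (bump e y x)%:E = (4 * pi)%:E.
Proof.
move=> e0; have e20 : (0 < e ^+ 2)%R by rewrite exprn_gt0.
rewrite ge0_integral_mu3; last 2 first.
- by apply/measurable_EFinP; exact: measurable_bump.
- by move=> x; rewrite lee_fin bump_ge0.
pose b1 (x1 : R) := (e ^+ 2 + (x1 - y.1.1) ^+ 2)%R.
have b10 x1 : (0 < b1 x1)%R by rewrite ltr_wpDr ?sqr_ge0.
pose b2 (x1 x2 : R) := (b1 x1 + (x2 - y.1.2) ^+ 2)%R.
have b20 x1 x2 : (0 < b2 x1 x2)%R by rewrite ltr_wpDr ?sqr_ge0.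
have E1 x1 x2 : \int[leb]_x3 (bump e y (x1, x2, x3))%:E = (4 * e ^+ 2 * rsq (b1 x1) (x2 - y.1.2) ^+ 4)%:E.
  have -> : \int[leb]_x3 (bump e y (x1, x2, x3))%:E =
      \int[leb]_x3 (3 * e ^+ 2 * (fun t => rsq (b2 x1 x2) t ^+ 5) (x3 - y.2))%:E.
    by apply: eq_integral => x3 _; rewrite /bump /rdist /rsq /b2 /b1 /dist2/= !addrA.
  rewrite (@integral_translateZ (fun t => rsq (b2 x1 x2) t ^+ 5)%R)//; last 3 first.
  - exact: measurable_rsqX.
  - by move=> t; exact: rsqX_ge0.
  - by rewrite mulr_ge0// ltW.
  rewrite integral_rsq5// -EFinM; congr (_%:E).
  have := rsq2 (x2 - y.1.2) (b10 x1); rewrite -/(b2 x1 x2) => h.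
  have -> : (rsq (b1 x1) (x2 - y.1.2) ^+ 4 = (b2 x1 x2)^-1 ^+ 2)%R.
    have -> : (b2 x1 x2)^-1%R = (rsq (b1 x1) (x2 - y.1.2) ^+ 2)%R.
      by rewrite -[LHS]mul1r -h mulfK// gt_eqF.
    by ring.
  by field; rewrite gt_eqF.
have E2 x1 : \int[leb]_x2 \int[leb]_x3 (bump e y (x1, x2, x3))%:E =
    (2 * pi * e ^+ 2 * rsq (e ^+ 2) (x1 - y.1.1) ^+ 3)%:E.
  under eq_integral do rewrite E1.
  rewrite (@integral_translateZ (fun t => rsq (b1 x1) t ^+ 4)%R)//; last 3 first.
  - exact: measurable_rsqX.
  - by move=> t; exact: rsqX_ge0.
  - by rewrite mulr_ge0// ltW.
  rewrite integral_rsq4// -EFinM; congr (_%:E).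
  have h := rsq2 (x1 - y.1.1) e20; rewrite -/(b1 x1) in h.
  have -> : (rsq (b1 x1) 0 = rsq (e ^+ 2) (x1 - y.1.1))%R by rewrite /rsq expr0n addr0.
  have -> : (rsq (e ^+ 2) (x1 - y.1.1) ^+ 3 = (b1 x1)^-1 * rsq (e ^+ 2) (x1 - y.1.1))%R.
    have -> : (b1 x1)^-1%R = (rsq (e ^+ 2) (x1 - y.1.1) ^+ 2)%R.
      by rewrite -[LHS]mul1r -h mulfK// gt_eqF.
    by ring.
  by field; rewrite gt_eqF.
under eq_integral do rewrite E2.
rewrite (@integral_translateZ (fun t => rsq (e ^+ 2) t ^+ 3)%R)//; last 3 first.
- exact: measurable_rsqX.
- by move=> t; exact: rsqX_ge0.
- by rewrite !mulr_ge0 ?pi_ge0// ltW.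
rewrite integral_rsq3// -EFinM; congr (_%:E).
by field; rewrite gt_eqF.
Qed.

End Newton.

(** * Second derivatives of the Newton potential of a test function *)

Section NewtonLimit.
Context {R : realType}.
Local Notation leb := (@lebesgue_measure R).
Local Notation "f <=I C" := (@ge0_int_le _ (measurableTypeR R) R leb f C) (at level 70).
Local Notation "f <=I3 C" := (@ge0_int_le _ (R3 R) R mu3 f C) (at level 70).

Lemma normr_Rintegral_le d (T : measurableType d) (mu : {measure set T -> \bar R})
    (g h : T -> R) (C : R) : measurable_fun setT g ->
  {ae mu, forall x, `|g x| <= h x} -> ge0_int_le mu h C -> `|\int[mu]_x g x| <= C.
Proof.
move=> mg gh hC; have ig := ge0_int_le_integrable mg gh hC.
apply: le_trans (le_normr_Rintegral measurableT ig) _.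
case: hC => mh h0 hC.
have ian : mu.-integrable setT (EFin \o (fun x => `|g x|)) by exact: integrable_norm.
rewrite -lee_fin fineK; last exact: integrable_fin_num.
apply: le_trans hC; apply: ae_ge0_le_integral => //.
- by apply/measurable_EFinP; apply: measurableT_comp.
- by move=> x _; rewrite lee_fin.
- exact/measurable_EFinP.
- by apply: filterS gh => x hx _; rewrite lee_fin.
Qed.

Lemma ge0_int_le_bump (e : R) (y : R3 R) : 0 < e -> bump e y <=I3 4 * pi.
Proof.
move=> e0; split; [exact: measurable_bump|exact: bump_ge0|by rewrite integral_bump].
Qed.

Lemma bump_integrable (e : R) (y : R3 R) : 0 < e -> mu3.-integrable [set: R3 R] (EFin \o bump e y).
Proof.
move=> e0; apply: ge0_int_le_integrable (ge0_int_le_bump y e0); first exact: measurable_bump.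
by apply: nearW => x; rewrite ger0_norm// bump_ge0.
Qed.

Lemma rdist_far (e d : R) (y x : R3 R) : 0 < e -> 0 < d -> d ^+ 2 <= dist2 y x ->
  rdist e y x <= (1 + d^-1) * rdist 1 y x.
Proof.
move=> e0 d0 dD; have D0 := dist2_ge0 y x.
have c0 : 0 < 1 + d^-1 by rewrite addr_gt0// invr_gt0.
have s1 : 0 < 1 ^+ 2 + dist2 y x by rewrite ltr_wpDr// expr1n.
have s2 : 0 < e ^+ 2 + dist2 y x by rewrite ltr_wpDr// exprn_gt0.
rewrite /rdist -ler_pdivrMr ?invr_gt0 ?sqrtr_gt0// invrK mulrC.
rewrite ler_pdivrMr ?sqrtr_gt0// -(ger0_norm (ltW c0)) -sqrtr_sqr -sqrtrM ?sqr_ge0//.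
apply: ler_wsqrtr; rewrite expr1n.
have di : 0 < d^-1 by rewrite invr_gt0.
have h1 : 1 <= d^-1 ^+ 2 * dist2 y x.
  by rewrite exprVn mulrC ler_pdivlMr ?exprn_gt0// mul1r.
have -> : (1 + d^-1) ^+ 2 * (e ^+ 2 + dist2 y x) =
  dist2 y x + d^-1 ^+ 2 * dist2 y x + (2 * d^-1 * dist2 y x + (1 + d^-1) ^+ 2 * e ^+ 2) by ring.
apply: (@le_trans _ _ (dist2 y x + d^-1 ^+ 2 * dist2 y x)); first by rewrite addrC lerD2l.
by rewrite lerDl addr_ge0// mulr_ge0 ?sqr_ge0 ?mulr_ge0 ?(ltW di).
Qed.

Lemma natSinv_cvg0 : (n.+1%:R^-1 : R) @[n --> \oo] --> (0 : R).
Proof. exact: cvg_harmonic. Qed.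

(** All the bumps have mass [4 pi]. Near [y] the function differs little from [f y];
    away from [y] the bump with parameter [e] is at most [e^2] times a constant multiple
    of the bump with parameter [1], by [rdist_far]. *)
Lemma bump_limit (f : R3 R -> R) M L y : C1_in_box f M L ->
  \int[mu3]_x (f x * bump n.+1%:R^-1 y x) @[n --> \oo] --> f y * (4 * pi).
Proof.
move=> [L0 cf bf _]; have [mf fM f0] := bf.
have M0 : 0 <= M by apply: le_trans (fM y).
apply/cvgrPdist_le => /= eta eta0.
have pi0 := pi_gt0 R.
have [h h0 hE] : exists2 h : R, 0 < h & h * (4 * pi) = eta / 2.
  (* Half of the error [eta] for the region near [y], whose mass is at most [4 pi]. *)
  exists (eta / (8 * pi)); first by rewrite divr_gt0// mulr_gt0.
  have aux (x p : R) : p != 0 -> x / (8 * p) * (4 * p) = x / 2 by move=> p0; field.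
  by apply: aux; rewrite gt_eqF.
have [d /= d0 dball] : nbhs_ball y [set x | `|f y - f x| <= h].
  apply/nbhs_ballP; have /cvgrPdist_le := cf y; exact.
have near_ x : dist2 y x < d ^+ 2 -> `|f y - f x| <= h.
  move=> xd; apply: dball.
  have c k : `|coord3 k y - coord3 k x| < d.
    rewrite -(@ltr_pXn2r _ 2)// ?nnegrE ?(ltW d0)// real_normK ?num_real// -sqrrN opprB.
    exact: le_lt_trans (dcoord_le_dist2 k y x) xd.
  by split; [split|]; rewrite /ball/=; [exact: (c 0)|exact: (c 1)|exact: (c 2%:R)].
pose A := 2 * M * ((1 + d^-1) ^+ 5) * (4 * pi).
have A0 : 0 <= A.
  by rewrite !mulr_ge0 ?exprn_ge0 ?(ltW pi0)// addr_ge0// invr_ge0 ltW.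
have cv : (fun n => A * (n.+1%:R^-1 * n.+1%:R^-1 : R)) @ \oo --> A * (0 * 0).
  apply: cvgMr; apply: cvgM; exact: natSinv_cvg0.
move: cv; rewrite !mulr0 => /cvgrPdist_le /(_ (eta / 2) (divr_gt0 eta0 (@ltr0n R 2))).
apply: filterS => n.
have : (0 : R) < n.+1%:R^-1 by rewrite invr_gt0.
move: (n.+1%:R^-1 : R) => e e0; rewrite sub0r normrN (ger0_norm (mulr_ge0 A0 (mulr_ge0 (ltW e0) (ltW e0)))) => Ae.
have ib := bump_integrable y e0.
have e1 : (0 : R) < 1 by [].
have ifb : mu3.-integrable [set: R3 R] (EFin \o (fun x => f x * bump e y x)).
  apply: ge0_int_le_integrable (ge0_int_leZ M0 (ge0_int_le_bump y e0)).
    by apply: measurable_funM => //; exact: measurable_bump.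
  apply: nearW => x; rewrite normrM (ger0_norm (bump_ge0 _ _ _)) ler_wpM2r ?bump_ge0//.
have E : \int[mu3]_x bump e y x = 4 * pi by rewrite /Rintegral integral_bump.
have iyb : mu3.-integrable [set: R3 R] (EFin \o (fun x => f y * bump e y x)).
  by have := integrableZl measurableT (f y) ib; apply: eq_integrable.
rewrite -E -RintegralZl// -RintegralB//.
have : 0 <= 2 * M * ((1 + d^-1) ^+ 5) * (e * e).
  apply: mulr_ge0; last by rewrite mulr_ge0 ?(ltW e0).
  apply: mulr_ge0; first by rewrite mulr_ge0.
  by rewrite exprn_ge0// addr_ge0// invr_ge0 ltW.
move=> /[dup] B0 /ge0_int_leZ /(_ (ge0_int_le_bump y e1)) H2.
have H := ge0_int_leD (ge0_int_leZ (ltW h0) (ge0_int_le_bump y e0)) H2.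
apply: (@le_trans _ _ (h * (4 * pi) + 2 * M * (1 + d^-1) ^+ 5 * (e * e) * (4 * pi))).
  apply: normr_Rintegral_le H.
    apply: measurable_funB; apply: measurable_funM => //; exact: measurable_bump.
  apply: nearW => x; rewrite -mulrBl normrM (ger0_norm (bump_ge0 _ _ _)).
  have [xd|xd] := ltP (dist2 y x) (d ^+ 2).
    apply: (@le_trans _ _ (h * bump e y x)); last first.
      by rewrite lerDl; apply: mulr_ge0 => //; exact: bump_ge0.
    by apply: ler_wpM2r; [exact: bump_ge0|exact: near_].
  apply: (@le_trans _ _ (2 * M * (1 + d^-1) ^+ 5 * (e * e) * bump 1 y x)); last first.
    by rewrite lerDr; apply: mulr_ge0; [exact: ltW|exact: bump_ge0].
  have f2 : `|f y - f x| <= 2 * M.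
    by apply: le_trans (ler_normB _ _) _; rewrite mulr_natl mulr2n lerD.
  have -> : 2 * M * (1 + d^-1) ^+ 5 * (e * e) * bump 1 y x =
    2 * M * (3 * e ^+ 2 * ((1 + d^-1) * rdist 1 y x) ^+ 5) by rewrite /bump; ring.
  apply: ler_pM => //; first exact: bump_ge0.
  apply: ler_wpM2l; first by apply: mulr_ge0 => //; exact: sqr_ge0.
  apply: lerXn2r; rewrite ?nnegrE ?rdist_ge0//.
    by apply: mulr_ge0; [rewrite addr_ge0// invr_ge0 ltW|exact: rdist_ge0].
  exact: rdist_far.
have -> : eta = eta / 2 + eta / 2 by rewrite -splitr.
apply: lerD; first by rewrite hE.
apply: le_trans Ae; rewrite /A le_eqVlt; apply/orP; left; apply/eqP; ring.
Qed.

(** Each of the three coordinates of [x - y] is at most [|x - y|] in absolute value, so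
    [|x - y|^(-2/3)] is at most each factor of [kappa3]. *)
Lemma dist2_kappa3 (y x : R3 R) : [/\ x.1.1 != y.1.1, x.1.2 != y.1.2 & x.2 != y.2] ->
  (dist2 y x)^-1 <= kappa3 y x.
Proof.
move=> [n1 n2 n3].
have D0 : 0 < dist2 y x by exact: dist2_gt0.
have k1 (s t : R) : t != s -> (t - s) ^+ 2 <= dist2 y x -> (dist2 y x) `^ (- (1 / 3)) <= kappa (s - t).
  move=> ts le.
  have -> : kappa (s - t) = ((t - s) ^+ 2) `^ (- (1 / 3)).
    rewrite /kappa -[X in `|X|]opprB normrN -(real_normK (num_real (t - s))) -powR_mulrn// -powRrM.
    by congr (_ `^ _); field.
  by apply: ler_powRN => //; rewrite exprn_even_gt0//= subr_eq0.
have -> : (dist2 y x)^-1 = (dist2 y x) `^ (- (1 / 3)) * (dist2 y x) `^ (- (1 / 3)) * (dist2 y x) `^ (- (1 / 3)).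
  have DN : dist2 y x != 0 by rewrite gt_eqF.
  rewrite -powRD ?DN ?implybT// -powRD ?DN ?implybT// -powR_inv1 ?(ltW D0)//.
  by congr (_ `^ _); field.
rewrite /kappa3 /tensor; apply: ler_pM; rewrite ?mulr_ge0 ?powR_ge0//.
  apply: ler_pM; rewrite ?powR_ge0//.
    by apply: k1 => //; exact: (dcoord_le_dist2 0 y x).
  by apply: k1 => //; exact: (dcoord_le_dist2 1 y x).
by apply: k1 => //; exact: (dcoord_le_dist2 2%:R y x).
Qed.

Lemma field_reg_kappa3 (e : R) m (y x : R3 R) : 0 <= e -> [/\ x.1.1 != y.1.1, x.1.2 != y.1.2 & x.2 != y.2] ->
  `|field_reg e m y x| <= kappa3 y x.
Proof.
move=> e0 n; have := dist2_kappa3 n; apply: le_trans; case: n => n1 n2 n3.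
have D0 : 0 < dist2 y x by exact: dist2_gt0.
have eD : 0 < e ^+ 2 + dist2 y x by rewrite ltr_wpDl ?sqr_ge0.
have r2 : rdist e y x ^+ 2 = (e ^+ 2 + dist2 y x)^-1.
  by rewrite /rdist exprVn sqr_sqrtr ?ltW.
have r2D : rdist e y x ^+ 2 <= (dist2 y x)^-1.
  by rewrite r2 lef_pV2 ?posrE// lerDr sqr_ge0.
apply: le_trans r2D.
rewrite /field_reg normrM (ger0_norm (exprn_ge0 _ (rdist_ge0 _ _ _))) exprS mulrA.
rewrite ler_piMl ?exprn_ge0 ?rdist_ge0//.
rewrite -(@expr_le1 _ 2)// ?mulr_ge0 ?rdist_ge0// exprMn real_normK ?num_real// r2.
rewrite ler_pdivrMr// mul1r; apply: le_trans (dcoord_le_dist2 m y x) _.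
by rewrite lerDr sqr_ge0.
Qed.

Lemma boxind_kappa (L : R) : 0 < L -> exists C : R, forall s : R,
  (fun t => \1_`[- L, L] t * kappa (s - t)) <=I C.
Proof.
move=> L0.
have h23 : 0 < (2 / 3 : R) < 1 by apply/andP; split; lra.
exists (2 * (1 `^ (1 - 2 / 3) / (1 - 2 / 3)) + (L + L)) => s.
have := ge0_int_leD (ge0_int_le_translate s (ge0_int_le_nearpow h23 (@ltr01 R))) (ge0_int_le_indic L0).
apply: ge0_int_le_le => //.
  by apply: measurable_funM => //; exact: measurable_kappaB.
move=> t; have I0 : 0 <= \1_`[- L, L] t :> R by rewrite indicE.
rewrite mulr_ge0 ?kappa_ge0//=.
have kE : kappa (s - t) = `|t - s| `^ (- (2 / 3)) by rewrite /kappa -normrN opprB.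
have [ts|ts] := ltP `|t - s| 1.
  apply: (@le_trans _ _ (nearpow (2 / 3) 1 (t - s))); last by rewrite lerDl.
  by rewrite /nearpow ts kE ler_piMl ?powR_ge0// indicE lern1 leq_b1.
apply: (@le_trans _ _ (\1_`[- L, L] t)); last by rewrite lerDr nearpow_ge0.
rewrite ler_piMr// kE.
(* Away from [s] the kernel is at most one. *)
by have := @ler_powRN R (2 / 3) 1 `|t - s|; rewrite powR1; apply.
Qed.

Lemma boxind_kappa3 (L : R) : 0 < L -> exists C : R, forall y : R3 R,
  (fun x => boxind L x * kappa3 y x) <=I3 C.
Proof.
move=> L0; have [C HC] := boxind_kappa L0; exists (C * C * C) => y.
have [m p h] := ge0_int_le_tensor (HC y.1.1) (HC y.1.2) (HC y.2).
apply: (ge0_int_le_le _ _ (lexx _) (And3 m p h)).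
  apply: measurable_funM; apply: measurable_tensor => //; exact: measurable_kappaB.
move=> x; rewrite mulr_ge0 ?kappa3_ge0 ?boxindE//= -boxindE /boxind /kappa3 /tensor.
by rewrite le_eqVlt; apply/orP; left; apply/eqP; ring.
Qed.

(** The second derivatives of the Newton potential of [f], up to normalization: one
    derivative falls on [f], the other on the Newton kernel [1 / |z|]. *)
Definition newton (f : R3 R -> R) (k m : 'I_3) (y : R3 R) : R :=
  \int[mu3]_x (partial k f x * field_reg 0 m y x).

Lemma bounded_in_box_le (f : R3 R -> R) (M L : R) (x : R3 R) : bounded_in_box f M L -> `|f x| <= M * boxind L x.
Proof.
move=> [_ fM f0]; rewrite boxindE; have [bx|/f0->] := boolP (box L x).
  by rewrite mulr1.
by rewrite normr0 mulr0.
Qed.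

(** Dominated convergence: for every [e >= 0] the regularized field is at most
    [kappa3]. *)
Lemma newton_limit f M L k m y : C1_in_box f M L ->
  \int[mu3]_x (partial k f x * field_reg n.+1%:R^-1 m y x) @[n --> \oo] --> newton f k m y.
Proof.
move=> [L0 _ _ /(_ k)[_ _ bp]]; have [mp pM p0] := bp.
have M0 : 0 <= M by apply: le_trans (pM y).
have [C HC] := boxind_kappa3 L0.
have HG := ge0_int_leZ M0 (HC y).
pose G x := M * (boxind L x * kappa3 y x).
have mreg e : measurable_fun setT (fun x => partial k f x * field_reg e m y x).
  by apply: measurable_funM => //; exact: (@measurable_section2 _ (field_reg e m) y (measurable_field_reg _ _)).
have dom e : 0 <= e -> {ae mu3, forall x, `|partial k f x * field_reg e m y x| <= G x}.
  move=> e0; have := ae_coord_neq y; apply: filterS => x n.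
  rewrite normrM /G mulrA; apply: ler_pM => //; first exact: bounded_in_box_le.
  exact: field_reg_kappa3.
have iG : mu3.-integrable [set: R3 R] (EFin \o G).
  by case: (HG) => mG G0 _; apply: (ge0_int_le_integrable mG _ HG); apply: nearW => x; rewrite ger0_norm.
have iF n : mu3.-integrable setT (EFin \o (fun x => partial k f x * field_reg n.+1%:R^-1 m y x)).
  by apply: (ge0_int_le_integrable (mreg _) _ HG); apply: dom; rewrite invr_ge0.
have iF0 : mu3.-integrable setT (EFin \o (fun x => partial k f x * field_reg 0 m y x)).
  by apply: (ge0_int_le_integrable (mreg _) _ HG); exact: dom.
have [||_ _ DC] := @dominated_convergence _ _ _ mu3 setT measurableT
  (fun n x => (partial k f x * field_reg n.+1%:R^-1 m y x)%:E)
  (fun x => (partial k f x * field_reg 0 m y x)%:E) (EFin \o G)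
  (fun n => (measurable_EFinP _ _).2 (mreg n.+1%:R^-1)) ((measurable_EFinP _ _).2 (mreg 0)) _ iG _.
- have := ae_coord_neq y; apply: filterS => x [n1 _ _] _.
  have D0 : 0 < dist2 y x by exact: dist2_gt0.
  apply: cvg_EFin; first exact: nearW.
  apply: cvgMr; apply: cvgMr.
  have rc : rdist n.+1%:R^-1 y x @[n --> \oo] --> rdist 0 y x.
    apply: cvgV; first by rewrite gt_eqF// sqrtr_gt0 ltr_wpDl// sqr_ge0.
    apply: (@cvg_comp _ _ _ (fun n : nat => (n.+1%:R^-1) ^+ 2 + dist2 y x) Num.sqrt); last exact: sqrt_continuous.
    apply: cvgD; last exact: cvg_cst.
    by rewrite expr2; under eq_fun do rewrite expr2; apply: cvgM; exact: natSinv_cvg0.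
  rewrite (_ : (fun n : nat => rdist n.+1%:R^-1 y x ^+ 3) =
     (fun n : nat => rdist n.+1%:R^-1 y x * rdist n.+1%:R^-1 y x * rdist n.+1%:R^-1 y x)); last first.
    by apply/funext => n; rewrite !exprS expr0 mulr1 mulrA.
  rewrite !exprS expr0 mulr1 mulrA.
  by apply: cvgM => //; apply: cvgM.
- have h n := dom (n.+1%:R^-1) (ltac:(by rewrite invr_ge0)).
  have := (ae_foralln h).
  by apply: filterS => x hx n _; rewrite lee_fin.
apply: (@fine_cvg _ _ _ _ _ (newton f k m y)).
rewrite /newton fineK; last exact: integrable_fin_num.
exact: DC.
Qed.

Lemma dfield_reg_sym (e : R) k m (y x : R3 R) : m != k -> dfield_reg e k m y x = dfield_reg e m k y x.
Proof.
by move=> mk; rewrite /dfield_reg (negbTE mk) eq_sym (negbTE mk) [dcoord m y x * _]mulrC.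
Qed.

Lemma sum_dfield_reg (e : R) (y x : R3 R) : 0 < e -> \sum_k dfield_reg e k k y x = bump e y x.
Proof.
move=> e0; rewrite /dfield_reg.
transitivity (3 * rdist e y x ^+ 3 - 3 * (\sum_k dcoord k y x ^+ 2) * rdist e y x ^+ 5).
  under eq_bigr do rewrite eqxx mul1r -expr2.
  by rewrite !big_ord_recl !big_ord0; ring.
rewrite sum_dcoord; have := rdist2 y x e0 => h.
transitivity (3 * rdist e y x ^+ 3 * (rdist e y x ^+ 2 * (e ^+ 2 + dist2 y x))
   - 3 * dist2 y x * rdist e y x ^+ 5); first by rewrite h mulr1.
by rewrite /bump; ring.
Qed.

(** After an integration by parts the regularized integrals involve [z_k z_m], which is
    symmetric in [k] and [m]. *)
Lemma newton_sym f M L k m y : C1_in_box f M L -> newton f k m y = newton f m k y.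
Proof.
move=> tf; have [->//|mk] := eqVneq m k.
have l1 := @newton_limit f M L k m y tf; have l2 := @newton_limit f M L m k y tf.
suff E : (fun n => \int[mu3]_x (partial k f x * field_reg n.+1%:R^-1 m y x)) =
  (fun n => \int[mu3]_x (partial m f x * field_reg n.+1%:R^-1 k y x)).
  by rewrite E in l1; exact: (cvg_unique _ l1 l2).
apply/funext => n; rewrite !(@ibp_field_reg _ f M L)//.
by congr (- _); apply: eq_Rintegral => x _; rewrite dfield_reg_sym.
Qed.

(** After an integration by parts the regularized integrals add up to an integral of [f]
    against the bumps. *)
Lemma newton_trace f M L y : C1_in_box f M L -> \sum_k newton f k k y = - (f y * (4 * pi)).
Proof.
move=> tf.
have l1 : (fun n => \sum_k \int[mu3]_x (partial k f x * field_reg n.+1%:R^-1 k y x)) @ \oo --> \sum_k newton f k k y.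
  rewrite !big_ord_recl big_ord0 addr0; under eq_fun do rewrite !big_ord_recl big_ord0 addr0.
  by apply: cvgD; [|apply: cvgD]; exact: newton_limit tf.
have l2 : (fun n => - \int[mu3]_x (f x * bump n.+1%:R^-1 y x)) @ \oo --> - (f y * (4 * pi)).
  by apply: cvgN; exact: bump_limit tf.
suff E : (fun n => \sum_k \int[mu3]_x (partial k f x * field_reg n.+1%:R^-1 k y x)) =
  (fun n => - \int[mu3]_x (f x * bump n.+1%:R^-1 y x)).
  by rewrite E in l1; exact: (cvg_unique _ l1 l2).
apply/funext => n; have e0 : (0 : R) < n.+1%:R^-1 by rewrite invr_gt0.
move: (n.+1%:R^-1 : R) e0 => e e0.
under eq_bigr do rewrite (@ibp_field_reg _ f M L)//.
rewrite sumrN; congr (- _); case: (tf) => L0 _ bf _.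
have i k : mu3.-integrable setT (EFin \o (fun x => f x * dfield_reg e k k y x)).
  have := @bounded_in_boxM _ f (dfield_reg e k k y) M L (4 * e^-1 ^+ 3) => h.
  apply: (bounded_in_box_integrable L0 (h _ _ _ bf)).
  - exact: (@measurable_section2 _ (dfield_reg e k k) y (measurable_dfield_reg _ _ _)).
  - by rewrite mulr_ge0// exprn_ge0// invr_ge0 ltW.
  - move=> x; apply: le_trans (dfield_reg_le k k y x e0) _.
    by rewrite ler_wpM2l// lerXn2r ?nnegrE ?rdist_ge0 ?invr_ge0 ?(ltW e0) ?rdist_le.
rewrite !big_ord_recl big_ord0 addr0 -!RintegralD//; last first.
  by have := integrableD measurableT (i (lift ord0 ord0)) (i (lift ord0 (lift ord0 ord0))); apply: eq_integrable.
by apply: eq_Rintegral => x _; rewrite -(sum_dfield_reg y x e0) !big_ord_recl big_ord0 addr0 !mulrDr.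
Qed.

End NewtonLimit.

(** * Complex-valued functions *)

Section Complex3.
Context {R : realType}.
Local Open Scope complex_scope.
Local Notation Re := (@complex.Re R).
Local Notation Im := (@complex.Im R).

Lemma ReD (z w : R[i]) : Re (z + w) = Re z + Re w. Proof. by case: z; case: w. Qed.
Lemma ImD (z w : R[i]) : Im (z + w) = Im z + Im w. Proof. by case: z; case: w. Qed.
Lemma ReN (z : R[i]) : Re (- z) = - Re z. Proof. by case: z. Qed.
Lemma ImN (z : R[i]) : Im (- z) = - Im z. Proof. by case: z. Qed.
Lemma ReM (z w : R[i]) : Re (z * w) = Re z * Re w - Im z * Im w.
Proof. by case: z; case: w. Qed.
Lemma ImM (z w : R[i]) : Im (z * w) = Re z * Im w + Im z * Re w.
Proof. by case: z => a b; case: w => c d /=; ring. Qed.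

Lemma complexP (z w : R[i]) : Re z = Re w -> Im z = Im w -> z = w.
Proof. by case: z => a b; case: w => c d /= -> ->. Qed.

Lemma cmodC (z : R[i]) : (cmod z)%:C = `|z|.
Proof. by rewrite normc_def. Qed.

Lemma cmod_ge0 (z : R[i]) : 0 <= cmod z. Proof. exact: sqrtr_ge0. Qed.

Lemma cmodD (z w : R[i]) : cmod (z + w) <= cmod z + cmod w.
Proof. by rewrite -lecR rmorphD/= !cmodC ler_normD. Qed.

Lemma cmodM (z w : R[i]) : cmod (z * w) = cmod z * cmod w.
Proof. by apply/(@complexI R); rewrite rmorphM/= !cmodC normrM. Qed.

Lemma cmodN (z : R[i]) : cmod (- z) = cmod z.
Proof. by apply/(@complexI R); rewrite !cmodC normrN. Qed.

Lemma cmod0 : cmod (0 : R[i]) = 0.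
Proof. by apply/(@complexI R); rewrite !cmodC normr0. Qed.

Lemma cmod_conj (z : R[i]) : cmod (z^*%C) = cmod z.
Proof. by case: z => a b; rewrite /cmod/= sqrrN. Qed.

Lemma cmod_real (r : R) : cmod r%:C = `|r|.
Proof. by rewrite /cmod/= expr0n addr0 sqrtr_sqr. Qed.

Lemma cmod_sum (I : Type) (s : seq I) (P : pred I) (F : I -> R[i]) :
  cmod (\sum_(i <- s | P i) F i) <= \sum_(i <- s | P i) cmod (F i).
Proof.
elim/big_rec2: _ => [|i x y _ h]; first by rewrite cmod0.
by apply: le_trans (cmodD _ _) _; rewrite lerD2l.
Qed.

Lemma Re_le_cmod (z : R[i]) : `|Re z| <= cmod z.
Proof. by rewrite /cmod -sqrtr_sqr ler_wsqrtr// lerDl sqr_ge0. Qed.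

Lemma Im_le_cmod (z : R[i]) : `|Im z| <= cmod z.
Proof. by rewrite /cmod -sqrtr_sqr ler_wsqrtr// lerDr sqr_ge0. Qed.

Lemma cmod_le_ReIm (z : R[i]) : cmod z <= `|Re z| + `|Im z|.
Proof.
rewrite /cmod -[leRHS]ger0_norm ?addr_ge0// -sqrtr_sqr ler_wsqrtr//.
by rewrite sqrrD !real_normK ?num_real// addrAC lerDl mulrn_wge0// mulr_ge0.
Qed.

Lemma normC4_ge0 (u : C4 R) : 0 <= normC4 u. Proof. exact: sqrtr_ge0. Qed.

Lemma cmod_le_normC4 (u : C4 R) i : cmod (u i 0) <= normC4 u.
Proof.
rewrite /normC4 -[leLHS]ger0_norm ?cmod_ge0// -sqrtr_sqr ler_wsqrtr//.
by rewrite (bigD1 i)//= lerDl; apply: sumr_ge0 => j _; exact: sqr_ge0.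
Qed.

Lemma sum_sqr_le (I : finType) (F : I -> R) : (forall i, 0 <= F i) ->
  \sum_i F i ^+ 2 <= (\sum_i F i) ^+ 2.
Proof.
move=> F0; rewrite [leRHS]expr2 mulr_suml; apply: ler_sum => i _.
rewrite expr2 ler_wpM2l// (bigD1 i)//= lerDl.
by apply: sumr_ge0.
Qed.

Lemma normC4_le_sum (u : C4 R) : normC4 u <= \sum_i cmod (u i 0).
Proof.
rewrite /normC4 -[leRHS]ger0_norm; last by apply: sumr_ge0 => i _; exact: cmod_ge0.
rewrite -sqrtr_sqr ler_wsqrtr//.
by apply: sum_sqr_le => i; exact: cmod_ge0.
Qed.

Lemma cmeasurable_cst (c : R[i]) : cmeasurable (fun _ : R3 R => c).
Proof. by split. Qed.

Lemma cmeasurableD (f g : R3 R -> R[i]) : cmeasurable f -> cmeasurable g ->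
  cmeasurable (fun x => f x + g x).
Proof.
move=> [f1 f2] [g1 g2]; split.
- by under eq_fun do rewrite ReD; exact: measurable_funD.
- by under eq_fun do rewrite ImD; exact: measurable_funD.
Qed.

Lemma cmeasurableM (f g : R3 R -> R[i]) : cmeasurable f -> cmeasurable g ->
  cmeasurable (fun x => f x * g x).
Proof.
move=> [f1 f2] [g1 g2]; split.
- by under eq_fun do rewrite ReM; apply: measurable_funB; exact: measurable_funM.
- by under eq_fun do rewrite ImM; apply: measurable_funD; exact: measurable_funM.
Qed.

Lemma cmeasurable_conj (f : R3 R -> R[i]) : cmeasurable f -> cmeasurable (fun x => (f x)^*%C).
Proof.
move=> [f1 f2]; split.
- by rewrite (_ : (fun x => _) = (fun x => Re (f x)))//; apply/funext => x; case: (f x).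
- rewrite (_ : (fun x => _) = (fun x => - Im (f x))); first exact: measurableT_comp.
  by apply/funext => x; case: (f x).
Qed.

Lemma cmeasurable_real (f : R3 R -> R) : measurable_fun setT f -> cmeasurable (fun x => (f x)%:C).
Proof. by move=> mf; split. Qed.

Lemma cmeasurable_sum (I : Type) (s : seq I) (F : I -> R3 R -> R[i]) :
  (forall i, cmeasurable (F i)) -> cmeasurable (fun x => \sum_(i <- s) F i x).
Proof.
move=> mF; elim: s => [|i s IH].
  by under eq_fun do rewrite big_nil; exact: cmeasurable_cst.
by under eq_fun do rewrite big_cons; exact: cmeasurableD.
Qed.

Lemma mxmeasurableM m n p (F : R3 R -> 'M[R[i]]_(m, n)) (G : R3 R -> 'M[R[i]]_(n, p)) :
  mxmeasurable F -> mxmeasurable G -> mxmeasurable (fun x => F x *m G x).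
Proof.
move=> mF mG i j.
under eq_fun do rewrite mxE.
by apply: cmeasurable_sum => k; exact: cmeasurableM.
Qed.

Lemma measurable_cmod (f : R3 R -> R[i]) : cmeasurable f -> measurable_fun setT (fun x => cmod (f x)).
Proof.
move=> [f1 f2]; apply: (measurableT_comp measurable_sqrt).
by apply: measurable_funD; exact: measurable_funX.
Qed.

Lemma measurable_normC4 (f : R3 R -> C4 R) : mxmeasurable f -> measurable_fun setT (fun x => normC4 (f x)).
Proof.
move=> mf; apply: (measurableT_comp measurable_sqrt).
by apply: measurable_sum => i; apply: measurable_funX; exact: measurable_cmod.
Qed.

Definition cintegrable (f : R3 R -> R[i]) : Prop :=
  mu3.-integrable setT (fun x => (Re (f x))%:E) /\ mu3.-integrable setT (fun x => (Im (f x))%:E).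

Lemma cintegrableD (f g : R3 R -> R[i]) : cintegrable f -> cintegrable g ->
  cintegrable (fun x => f x + g x).
Proof.
move=> [f1 f2] [g1 g2]; split.
- have := integrableD measurableT f1 g1; apply: eq_integrable => // x _.
  by rewrite ReD.
- have := integrableD measurableT f2 g2; apply: eq_integrable => // x _.
  by rewrite ImD.
Qed.

Lemma integrableZ_EFin (c : R) (f : R3 R -> R) : mu3.-integrable setT (fun x => (f x)%:E) ->
  mu3.-integrable setT (fun x => (c * f x)%:E).
Proof. by move=> h; have := integrableZl measurableT c h; apply: eq_integrable. Qed.

Lemma integrableB_EFin (f g : R3 R -> R) : mu3.-integrable setT (fun x => (f x)%:E) ->
  mu3.-integrable setT (fun x => (g x)%:E) -> mu3.-integrable setT (fun x => (f x - g x)%:E).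
Proof. by move=> h1 h2; have := integrableB measurableT h1 h2; apply: eq_integrable. Qed.

Lemma integrableD_EFin (f g : R3 R -> R) : mu3.-integrable setT (fun x => (f x)%:E) ->
  mu3.-integrable setT (fun x => (g x)%:E) -> mu3.-integrable setT (fun x => (f x + g x)%:E).
Proof. by move=> h1 h2; have := integrableD measurableT h1 h2; apply: eq_integrable. Qed.

Lemma cintegrableZ (c : R[i]) (f : R3 R -> R[i]) : cintegrable f -> cintegrable (fun x => c * f x).
Proof.
move=> [f1 f2]; split.
- by under eq_fun do rewrite ReM; apply: integrableB_EFin; exact: integrableZ_EFin.
- by under eq_fun do rewrite ImM; apply: integrableD_EFin; exact: integrableZ_EFin.
Qed.

Lemma cintegrable0 : cintegrable (fun _ => 0).
Proof. by split; exact: integrable0. Qed.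

Lemma cintegrable_sum (I : Type) (s : seq I) (F : I -> R3 R -> R[i]) :
  (forall i, cintegrable (F i)) -> cintegrable (fun x => \sum_(i <- s) F i x).
Proof.
move=> mF; elim: s => [|i s IH].
  by under eq_fun do rewrite big_nil; exact: cintegrable0.
by under eq_fun do rewrite big_cons; exact: cintegrableD.
Qed.

Lemma cintegralD (f g : R3 R -> R[i]) : cintegrable f -> cintegrable g ->
  cintegral (fun x => f x + g x) = cintegral f + cintegral g.
Proof.
move=> [f1 f2] [g1 g2]; apply: complexP; rewrite /cintegral ?ReD ?ImD/=.
- by under eq_Rintegral do rewrite ReD; rewrite RintegralD.
- by under eq_Rintegral do rewrite ImD; rewrite RintegralD.
Qed.

Lemma cintegralZ (c : R[i]) (f : R3 R -> R[i]) : cintegrable f ->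
  cintegral (fun x => c * f x) = c * cintegral f.
Proof.
move=> [f1 f2]; apply: complexP; rewrite /cintegral ?ReM ?ImM/=.
- under eq_Rintegral do rewrite ReM.
  by rewrite RintegralB// ?RintegralZl//; exact: integrableZ_EFin.
- under eq_Rintegral do rewrite ImM.
  by rewrite RintegralD// ?RintegralZl//; exact: integrableZ_EFin.
Qed.

Lemma cintegral0 : cintegral (fun _ : R3 R => 0) = 0.
Proof. by apply: complexP; rewrite /cintegral/= /Rintegral integral0. Qed.

Lemma cintegral_sum (I : Type) (s : seq I) (F : I -> R3 R -> R[i]) :
  (forall i, cintegrable (F i)) ->
  cintegral (fun x => \sum_(i <- s) F i x) = \sum_(i <- s) cintegral (F i).
Proof.
move=> iF; elim: s => [|i s IH].
  by under [in LHS]eq_fun do rewrite big_nil; rewrite cintegral0 big_nil.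
under [in LHS]eq_fun do rewrite big_cons.
by rewrite cintegralD// ?IH ?big_cons//; exact: cintegrable_sum.
Qed.

Lemma eq_cintegral (f g : R3 R -> R[i]) : f =1 g -> cintegral f = cintegral g.
Proof. by move=> fg; congr cintegral; exact/funext. Qed.

Lemma ae_eq_cintegral (f g : R3 R -> R[i]) : cmeasurable f -> cmeasurable g ->
  {ae mu3, forall x, f x = g x} -> cintegral f = cintegral g.
Proof.
move=> [f1 f2] [g1 g2] fg; apply: complexP; rewrite /cintegral/= /Rintegral; congr fine.
- by apply: ae_eq_integral => //; [exact/measurable_EFinP|exact/measurable_EFinP|
    apply: filterS fg => x -> _].
- by apply: ae_eq_integral => //; [exact/measurable_EFinP|exact/measurable_EFinP|
    apply: filterS fg => x -> _].
Qed.

End Complex3.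

(** * Dirac matrices and the factorization of V *)

Section Matrices.
Context {R : realType}.
Local Open Scope complex_scope.
Local Open Scope sesquilinear_scope.

Lemma ctmxE m n (M : 'M[R[i]]_(m, n)) i j : (M ^t*) i j = (M j i)^*%C.
Proof. by rewrite !mxE. Qed.

Lemma pauli_anticomm (k m : 'I_3) :
  pauli k *m pauli m + pauli m *m pauli k = (2 * (k == m)%:R)%:M :> 'M[R[i]]_2.
Proof.
apply/matrixP => i j; rewrite !mxE !big_ord_recl !big_ord0.
elim/ord3_ind: k; elim/ord3_ind: m; rewrite /pauli/= /mx22 !mxE/=;
  case: i => [[|[|//]] ?]; case: j => [[|[|//]] ?];
  apply: complexP => /=; ring.
Qed.

Lemma alpha_anticomm (k m : 'I_3) :
  alpha k *m alpha m + alpha m *m alpha k = (2 * (k == m)%:R)%:M :> M4 R.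
Proof.
rewrite /alpha !(@mulmx_block _ 2 2 2 2 2 2) !mul0mx !mulmx0 !add0r !addr0.
rewrite (@add_block_mx _ 2 2 2 2) addr0 pauli_anticomm.
by rewrite -(@scalar_mx_block _ 2 2).
Qed.

Lemma unitary_entry n (B : 'M[R[i]]_n) i j : B \is unitarymx -> cmod (B i j) <= 1.
Proof.
move=> /unitarymxP BB.
have := congr1 (fun M : 'M[R[i]]_n => M i i) BB; rewrite !mxE eqxx => E.
have : \sum_k (cmod (B i k) ^+ 2) = 1.
  apply/(@complexI R); rewrite rmorph_sum/=.
  transitivity (\sum_j B i j * (B ^t*) j i); last by rewrite E.
  apply: eq_bigr => k _.
  by rewrite rmorphXn/= cmodC !mxE normCK.
rewrite (bigD1 j)//= => h.
rewrite -(@expr_le1 _ 2)// ?cmod_ge0// -h lerDl.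
by apply: sumr_ge0 => k _; exact: sqr_ge0.
Qed.

Lemma cmod_mulmx_le m n p (A : 'M[R[i]]_(m, n)) (B : 'M[R[i]]_(n, p)) a b i j :
  (forall i j, cmod (A i j) <= a) -> (forall i j, cmod (B i j) <= b) ->
  cmod ((A *m B) i j) <= n%:R * (a * b).
Proof.
move=> ha hb; rewrite mxE; apply: le_trans (cmod_sum _ _ _) _.
apply: (@le_trans _ _ (\sum_(k < n) (a * b))).
  apply: ler_sum => k _; rewrite cmodM ler_pM ?cmod_ge0//.
by rewrite sumr_const card_ord mulr_natl.
Qed.

(** The diagonal matrix is [B V B^*], and [B] has entries of modulus at most one. *)
Lemma eigenvalue_le (V B : M4 R) (lam : 'rV[R]_4) (c : R) j : B \is unitarymx ->
  V = B ^t* *m diag4 lam *m B -> (forall i j, cmod (V i j) <= c) -> `|lam 0 j| <= 16 * c.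
Proof.
move=> uB VE hV.
have BB : B *m B ^t* = 1%:M by apply/unitarymxP.
have LE : diag4 lam = B *m V *m B ^t*.
  by rewrite VE !mulmxA BB mul1mx -!mulmxA BB mulmx1.
have hB i k : cmod (B i k) <= 1 by exact: unitary_entry.
have hBt i k : cmod ((B ^t*) i k) <= 1 by rewrite ctmxE cmod_conj.
have := cmod_mulmx_le j j (fun i k => cmod_mulmx_le i k hB hV) hBt.
rewrite -LE !mxE eqxx mulr1n cmod_real => /le_trans; apply; rewrite le_eqVlt; apply/orP; left.
by apply/eqP; ring.
Qed.

Lemma diag4_mul (a b : 'rV[R]_4) : diag4 a *m diag4 b = diag4 (\row_j (a 0 j * b 0 j)).
Proof.
apply/matrixP => i j; rewrite mul_diag_mx !mxE.
have [->|ij] := eqVneq i j; last by rewrite !mulr0n mulr0.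
by rewrite !mulr1n rmorphM.
Qed.

Lemma sign1_sqr (t : R) : sign1 t * sign1 t = 1.
Proof. by rewrite /sign1; case: ifP => _; rewrite ?mulr1// mulrNN mulr1. Qed.

Lemma sign1_abs (t : R) : sign1 t * `|t| = t.
Proof.
rewrite /sign1; case: ifPn => t0; first by rewrite mul1r ger0_norm.
by rewrite mulN1r ltr0_norm ?opprK// ltNge.
Qed.

Lemma Umx_sqr (lam : 'rV[R]_4) : Umx lam *m Umx lam = 1%:M.
Proof.
rewrite /Umx diag4_mul; apply/matrixP => i j; rewrite !mxE sign1_sqr.
by case: (i == j).
Qed.

Lemma diag4_adj (a : 'rV[R]_4) : (diag4 a) ^t* = diag4 a.
Proof.
apply/matrixP => i j; rewrite ctmxE !mxE eq_sym.
case: eqVneq => [->|_]; last by rewrite !mulr0n conjc0.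
by rewrite !mulr1n; apply: complexP => //=; rewrite oppr0.
Qed.

Lemma ctmxM m n p (A : 'M[R[i]]_(m, n)) (B : 'M[R[i]]_(n, p)) : (A *m B) ^t* = B ^t* *m A ^t*.
Proof. by rewrite trmx_mul map_mxM. Qed.

(** [lam = |lam|^(1/2) sign(lam) |lam|^(1/2)], entry by entry. *)
Lemma factor_V (V B : M4 R) (lam : 'rV[R]_4) : V = B ^t* *m diag4 lam *m B ->
  V = (vmx B lam) ^t* *m (Umx lam *m vmx B lam).
Proof.
move=> ->; rewrite /vmx ctmxM diag4_adj -!mulmxA; congr (_ *m _); rewrite !mulmxA; congr (_ *m _).
rewrite /Umx !diag4_mul; congr diag4; apply/rowP => j; rewrite !mxE.
rewrite mulrAC -expr2 sqr_sqrtr// mulrC; exact/esym/sign1_abs.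
Qed.

Lemma vmx_entry (B : M4 R) (lam : 'rV[R]_4) i j : B \is unitarymx ->
  cmod (vmx B lam i j) <= Num.sqrt `|lam 0 i|.
Proof.
move=> uB; rewrite /vmx mul_diag_mx !mxE cmodM cmod_real ger0_norm ?sqrtr_ge0//.
by rewrite ler_piMr ?sqrtr_ge0// unitary_entry.
Qed.

Lemma mxmeasurable_vmx (B : R3 R -> M4 R) (lam : R3 R -> 'rV[R]_4) :
  mxmeasurable B -> (forall j, measurable_fun setT (fun x => lam x 0 j)) ->
  mxmeasurable (fun x => vmx (B x) (lam x)).
Proof.
move=> mB ml; apply: mxmeasurableM => // i j.
under eq_fun do rewrite /diag4 !mxE.
case: (i == j).
  apply: cmeasurable_real; apply: (measurableT_comp measurable_sqrt).
  exact: measurableT_comp.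
by under eq_fun do rewrite mulr0n; exact: cmeasurable_cst.
Qed.

Lemma mxmeasurable_adj m n (F : R3 R -> 'M[R[i]]_(m, n)) :
  mxmeasurable F -> mxmeasurable (fun x => (F x) ^t*).
Proof.
move=> mF i j; under eq_fun do rewrite ctmxE; exact: cmeasurable_conj.
Qed.

(** [1 + |x|^2] is at least [1 + x_k^2] for each of the three coordinates. *)
Lemma japanese_beta3 (x : R3 R) (d : R) : 2 <= d -> japanese x `^ (- d) <= beta3 x ^+ 2.
Proof.
move=> d2.
have N0 : norm3 x ^+ 2 = x.1.1 ^+ 2 + x.1.2 ^+ 2 + x.2 ^+ 2.
  rewrite /norm3 sqr_sqrtr; last by apply: sumr_ge0 => i _; exact: sqr_ge0.
  by rewrite !big_ord_recl big_ord0 addr0 addrA.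
have n0 := sqr_ge0 x.1.1; have n1 := sqr_ge0 x.1.2; have n2 := sqr_ge0 x.2.
set S := 1 + norm3 x ^+ 2.
have S1 : 1 <= S by rewrite /S N0; lra.
have S0 : 0 < S by exact: lt_le_trans S1.
have J1 : 1 <= japanese x by rewrite /japanese -{1}(sqrtr1 R) ler_wsqrtr.
have JS : japanese x `^ (- d) <= S `^ (-1).
  have -> : S = japanese x `^ 2%:R by rewrite powR_mulrn ?sqrtr_ge0// sqr_sqrtr// ltW.
  by rewrite -powRrM mulrN1 ler_powR// lerN2.
apply: le_trans JS _.
have key (t : R) : t ^+ 2 <= norm3 x ^+ 2 -> S `^ (- (1 / 3)) <= beta t ^+ 2.
  move=> tn; rewrite /beta -powR_mulrn ?powR_ge0// -powRrM (_ : - (1 / 6) * 2%:R = - (1 / 3)); last by field.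
  apply: ler_powRN => //; last by rewrite lerD2l.
  by rewrite ltr_pwDl// sqr_ge0.
have -> : S `^ (-1) = S `^ (- (1 / 3)) * S `^ (- (1 / 3)) * S `^ (- (1 / 3)).
  have SN : S != 0 by rewrite gt_eqF.
  rewrite -powRD ?SN ?implybT// -powRD ?SN ?implybT//.
  by congr (_ `^ _); field.
rewrite /beta3 /tensor !exprMn; apply: ler_pM; rewrite ?mulr_ge0 ?powR_ge0//.
  by apply: ler_pM; rewrite ?powR_ge0//; apply: key; rewrite N0; lra.
by apply: key; rewrite N0; lra.
Qed.

Lemma vmx_decay (V B : R3 R -> M4 R) (lam : R3 R -> 'rV[R]_4) (d : R) : 2 <= d ->
  decays V d -> diagonalizes V B lam ->
  exists2 C : R, 0 <= C & forall x i j, cmod (vmx (B x) (lam x) i j) <= C * beta3 x.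
Proof.
move=> d2 [c hc] [mB ml uB VE].
pose c' := Num.max c 0.
have c'0 : 0 <= c' by rewrite le_max lexx orbT.
have hc' x i j : cmod (V x i j) <= c' * beta3 x ^+ 2.
  apply: (le_trans (hc x i j)); apply: (@le_trans _ _ (c' * japanese x `^ (- d))).
    by rewrite ler_wpM2r ?powR_ge0// le_max lexx.
  by rewrite ler_wpM2l// japanese_beta3.
exists (Num.sqrt (16 * c')); first exact: sqrtr_ge0.
move=> x i j; apply: le_trans (vmx_entry _ _ _ (uB x)) _.
have -> : beta3 x = Num.sqrt (beta3 x ^+ 2) by rewrite sqrtr_sqr ger0_norm ?beta3_ge0.
rewrite -sqrtrM ?mulr_ge0//.
apply: ler_wsqrtr; rewrite -mulrA.
exact: (eigenvalue_le _ (uB x) (VE x)).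
Qed.

End Matrices.

(** * Fubini for potentials *)

Section Potential.
Context {R : realType}.
Local Open Scope ereal_scope.

(** The [m]-th component of the convolution of [h] with the Newton field [z / |z|^3]. *)
Definition pot (m : 'I_3) (h : R3 R -> R) (x : R3 R) : R :=
  (\int[mu3]_y (field_reg 0 m y x * h y))%R.

Lemma measurable_Rintegral_section (g : R3 R * R3 R -> R) : measurable_fun setT g ->
  measurable_fun setT (fun x => \int[mu3]_y g (x, y))%R.
Proof.
move=> mg; apply: (measurableT_comp (@fine_measurable R setT measurableT)).
have me : measurable_fun setT (EFin \o g) by exact/measurable_EFinP.
have -> : (fun x => \int[mu3]_y (g (x, y))%:E) =
    (fun x => (\int[mu3]_y ((EFin \o g)^\+ (x, y))) - \int[mu3]_y ((EFin \o g)^\- (x, y))).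
  apply/funext => x; rewrite [LHS]integralE; congr (_ - _); apply: eq_integral => y _.
  by rewrite !funeposE.
  by rewrite !funenegE.
apply: emeasurable_funB; apply: measurable_mu3_integral => //.
- exact: measurable_funepos.
- exact: measurable_funeneg.
Qed.

Section Fixed.
Variables (F : R3 R -> R) (c : R).
Hypotheses (mF : measurable_fun setT F) (F0 : forall x, (0 <= F x)%R) (c0 : (0 < c)%R).

Let bF0 y : (0 <= beta3 y * F y)%R. Proof. by rewrite mulr_ge0 ?beta3_ge0. Qed.

Let kF0 x y : (0 <= kappa3 x y * (beta3 y * F y))%R.
Proof. by apply: mulr_ge0 => //; exact: kappa3_ge0. Qed.

Let mbF : measurable_fun setT (fun y => beta3 y * F y)%R.
Proof. by apply: measurable_funM => //; exact: measurable_beta3. Qed.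

Let mker x : measurable_fun setT (fun y => kappa3 x y * (beta3 y * F y))%R.
Proof.
apply: measurable_funM => //.
exact: (measurable_section_l x measurable_kappa3).
Qed.

Lemma riesz_ge0 x : 0 <= riesz F x.
Proof. by apply: integral_ge0 => y _; rewrite lee_fin mulr_ge0 ?kappa3_ge0. Qed.

Lemma measurable_riesz : measurable_fun setT (riesz F).
Proof. exact: (measurable_kappa3_int mbF bF0). Qed.

Lemma measurable_pot_integrand (h : R3 R -> R) m : measurable_fun setT h ->
  measurable_fun setT (fun p : R3 R * R3 R => field_reg 0 m p.2 p.1 * h p.2)%R.
Proof.
move=> mh; apply: measurable_funM; first exact: measurable_field_reg.
exact: (measurable_pair_r mh).
Qed.

Lemma measurable_pot (h : R3 R -> R) m : measurable_fun setT h ->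
  measurable_fun setT (pot m h).
Proof.
by move=> mh; have := measurable_Rintegral_section (measurable_pot_integrand m mh).
Qed.

Lemma pot_dominated (h : R3 R -> R) m x : (forall y, `|h y| <= c * (beta3 y * F y))%R ->
  {ae mu3, forall y, (`|field_reg 0 m y x * h y| <= c * (kappa3 x y * (beta3 y * F y)))%R}.
Proof.
move=> hF; have := ae_coord_neq x; apply: filterS => y [n1 n2 n3].
rewrite normrM mulrCA; apply: ler_pM => //.
by rewrite kappa3C; apply: field_reg_kappa3 => //; split; rewrite eq_sym.
Qed.

Lemma riesz_int_le x : riesz F x < +oo ->
  ge0_int_le mu3 (fun y => kappa3 x y * (beta3 y * F y))%R (fine (riesz F x)).
Proof.
move=> Hx; split => //.
by rewrite fineK// ge0_fin_numE// riesz_ge0.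
Qed.

Lemma pot_integrable (h : R3 R -> R) m x : measurable_fun setT h ->
  (forall y, `|h y| <= c * (beta3 y * F y))%R -> riesz F x < +oo ->
  mu3.-integrable setT (fun y => (field_reg 0 m y x * h y)%:E).
Proof.
move=> mh hF Hx.
apply: (ge0_int_le_integrable _ (pot_dominated m x hF) (ge0_int_leZ (ltW c0) (riesz_int_le Hx))).
exact: (measurable_section_l x (measurable_pot_integrand m mh)).
Qed.

Lemma pot_le (h : R3 R -> R) m x : measurable_fun setT h ->
  (forall y, `|h y| <= c * (beta3 y * F y))%R ->
  (`|pot m h x|%R)%:E <= c%:E * riesz F x.
Proof.
move=> mh hF; have [->|Hx] := eqVneq (riesz F x) +oo.
  by rewrite gt0_muley ?lte_fin// leey.
have Hfin : riesz F x < +oo by rewrite lt_neqAle Hx leey.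
rewrite -(@fineK _ (riesz F x)) ?ge0_fin_numE ?riesz_ge0// -EFinM lee_fin.
apply: (normr_Rintegral_le _ (pot_dominated m x hF) (ge0_int_leZ (ltW c0) (riesz_int_le Hfin))).
exact: (measurable_section_l x (measurable_pot_integrand m mh)).
Qed.

Section Bounded.
Variable D : R.
Hypothesis HD : forall x, riesz F x <= D%:E.

Let Hfin x : riesz F x < +oo. Proof. by apply: le_lt_trans (HD x) _; rewrite ltry. Qed.

Let D0 : (0 <= D)%R.
Proof. by rewrite -lee_fin (le_trans _ (HD (0, 0, 0)%R))// riesz_ge0. Qed.

Variables (h a : R3 R -> R) (m : 'I_3) (M L : R).
Hypotheses (mh : measurable_fun setT h) (hF : forall y, (`|h y| <= c * (beta3 y * F y))%R).
Hypotheses (L0 : (0 < L)%R) (ba : bounded_in_box a M L).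

Let ma : measurable_fun setT a. Proof. by case: ba. Qed.

Let M0 : (0 <= M)%R. Proof. by case: ba => _ aM _; apply: le_trans (aM (0, 0, 0)%R). Qed.

Lemma pot_bound x : (`|pot m h x| <= c * D)%R.
Proof.
rewrite -lee_fin; apply: le_trans (pot_le m x mh hF) _.
by rewrite EFinM lee_wpmul2l// lee_fin ltW.
Qed.

(** The potential is bounded when [riesz F] is, and [a] has support in a box. *)
Lemma mul_pot_integrable : mu3.-integrable setT (fun x => (a x * pot m h x)%:E).
Proof.
have cD : (0 <= c * D)%R by rewrite mulr_ge0// ltW.
exact: (bounded_in_box_integrable L0 (bounded_in_boxM (measurable_pot m mh) cD pot_bound ba)).
Qed.

Let g (p : R3 R * R3 R) : R := (a p.1 * (field_reg 0 m p.2 p.1 * h p.2))%R.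

Let mg : measurable_fun setT g.
Proof.
apply: measurable_funM; first exact: (measurable_pair_l ma).
exact: measurable_pot_integrand.
Qed.

Let ig : (volume \x volume).-integrable setT (EFin \o g).
Proof.
apply/(@integrable12ltyP _ _ _ _ _ volume volume); first exact/measurable_EFinP.
have HB := ge0_int_leZ (mulr_ge0 M0 (mulr_ge0 (ltW c0) D0)) (ge0_int_le_boxind L0).
case: HB => [m1 p1 i1].
apply: (@le_lt_trans _ _ (\int[mu3]_x (M * (c * D) * boxind L x)%:E)); last first.
  by apply: le_lt_trans i1 _; rewrite ltry.
apply: (@ge0_le_integral _ _ _ mu3) => //.
- by move=> x _; apply: integral_ge0.
- apply: (@measurable_mu3_integral _ (fun p => `|(EFin \o g) p|)) => //.
  by apply: measurableT_comp => //; exact/measurable_EFinP.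
- exact/measurable_EFinP.
move=> x _.
apply: (@le_trans _ _ (\int[mu3]_y (`|a x|%:E * (c * (kappa3 x y * (beta3 y * F y)))%:E))).
  apply: ae_ge0_le_integral => //.
  - apply: measurableT_comp => //.
    by apply/measurable_EFinP; exact: (measurable_section_l x mg).
  - by move=> y _; rewrite -EFinM lee_fin mulr_ge0// mulr_ge0 ?kF0// ltW.
  - apply: emeasurable_funM => //; apply/measurable_EFinP; apply: measurable_funM => //; exact: mker.
  - have := pot_dominated m x hF; apply: filterS => y hy _.
    by rewrite /= -EFinM lee_fin /g normrM ler_wpM2l.
rewrite ge0_integralZl//; last 2 first.
- by apply/measurable_EFinP; apply: measurable_funM => //; exact: mker.
- by move=> y _; rewrite lee_fin mulr_ge0 ?kF0// ltW.
have -> : \int[mu3]_y (c * (kappa3 x y * (beta3 y * F y)))%:E = c%:E * riesz F x.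
  rewrite -ge0_integralZl//.
  - by apply/measurable_EFinP; exact: mker.
  - by move=> y _; rewrite lee_fin kF0.
  - by rewrite lee_fin ltW.
apply: (@le_trans _ _ (`|a x|%:E * (c * D)%:E)).
  apply: lee_wpmul2l => //; rewrite EFinM; apply: lee_wpmul2l => //.
  by rewrite lee_fin ltW.
rewrite -EFinM lee_fin (mulrAC M) ler_wpM2r ?mulr_ge0 ?(ltW c0)//.
exact: bounded_in_box_le.
Qed.

Let ia y : mu3.-integrable setT (fun x => (a x * field_reg 0 m y x)%:E).
Proof.
have [C HC] := boxind_kappa3 L0.
apply: (ge0_int_le_integrable _ _ (ge0_int_leZ M0 (HC y))).
  apply: measurable_funM => //.
  exact: (@measurable_section2 _ (field_reg 0 m) y (measurable_field_reg _ _)).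
have := ae_coord_neq y; apply: filterS => x n.
rewrite normrM mulrA; apply: ler_pM => //; first exact: bounded_in_box_le.
exact: field_reg_kappa3.
Qed.

Let innerx x : \int[mu3]_y (g (x, y))%:E = (a x * pot m h x)%:E.
Proof.
have ix := pot_integrable m mh hF (Hfin x).
rewrite EFinM /pot /Rintegral fineK; last exact: integrable_fin_num.
by rewrite -integralZl//; apply: eq_integral => y _; rewrite -EFinM.
Qed.

Let innery y : \int[mu3]_x (g (x, y))%:E = ((\int[mu3]_x (a x * field_reg 0 m y x)) * h y)%:E%R.
Proof.
have iy := ia y.
rewrite EFinM /Rintegral fineK; last exact: integrable_fin_num.
rewrite muleC -integralZl//; apply: eq_integral => x _.
by rewrite -EFinM /g/=; congr (_%:E); ring.
Qed.

(** The double integral converges absolutely: the integral in [y] is at most a multiple of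
    [riesz F x], which is bounded, and [a] has support in a box. *)
Lemma pot_fubini :
  (\int[mu3]_x (a x * pot m h x) = \int[mu3]_y ((\int[mu3]_x (a x * field_reg 0 m y x)) * h y))%R.
Proof.
rewrite /Rintegral; congr fine.
under eq_integral do rewrite -innerx.
under [RHS]eq_integral do rewrite -innery.
exact: (@Fubini _ _ _ _ _ volume volume _ ig).
Qed.

Lemma newton_mul_integrable :
  mu3.-integrable setT (fun y => ((\int[mu3]_x (a x * field_reg 0 m y x)) * h y)%:E%R).
Proof.
have ig' : (volume \x volume).-integrable setT (EFin \o (fun p => g (p.2, p.1))).
  apply/(@integrable12ltyP _ _ _ _ _ volume volume).
    by apply/measurable_EFinP; exact: measurable_flip.
  exact: ((@integrable21ltyP _ _ _ _ _ volume volume _ ((measurable_EFinP _ _).2 mg)).1 ig).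
have := integrable_fubini_F ig'.
by apply: eq_integrable => // y _; rewrite /fubini_F -innery.
Qed.

End Bounded.
End Fixed.
End Potential.

(** * The operator G0 and its action on distributions *)

Section Assembly.
Context {R : realType}.
Local Open Scope complex_scope.
Local Open Scope sesquilinear_scope.
Local Notation Re := (@complex.Re R).
Local Notation Im := (@complex.Im R).

Lemma bounded_in_boxW (f : R3 R -> R) (M M' L : R) : M <= M' -> bounded_in_box f M L -> bounded_in_box f M' L.
Proof. by move=> MM [mf fM f0]; split => // x; exact: le_trans (fM x) MM. Qed.

Lemma smooth_C1_in_box (f : R3 R -> R) (K : set (R3 R)) : smooth3 f -> compact K ->
  (forall x, ~ K x -> f x = 0) -> exists M L : R, C1_in_box f M L.
Proof.
move=> sf cK fK.
have clK : closed K by apply: compact_closed => //; exact: norm_hausdorff.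
have [L L0 HL] := compact_box cK.
have [cf df] := sf [::].
have cp k : continuous (partial k f) by case: (sf [:: k]).
have pK k x : ~ K x -> partial k f x = 0 by exact: partial_support.
have main (g : R3 R -> R) : continuous g -> (forall x, ~ K x -> g x = 0) ->
    exists2 M : R, 0 <= M & bounded_in_box g M L.
  move=> cg gK; have [M M0 HM] := compact_bounded_image cK cg.
  exists M; first exact: ltW.
  split; first exact: continuous_measurable3.
  - by move=> x; have [/HM//|/gK->] := pselect (K x); rewrite normr0 ltW.
  - by move=> x /negP nb; apply: gK => /HL.
have [M0 M00 H0] := main f cf fK.
have [M1 M10 H1] := main (partial 0 f) (cp 0) (pK 0).
have [M2 M20 H2] := main (partial 1 f) (cp 1) (pK 1).
have [M3 M30 H3] := main (partial 2%:R f) (cp 2%:R) (pK 2%:R).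
exists (M0 + (M1 + (M2 + M3))), L; split => //.
  by apply: bounded_in_boxW H0; lra.
move=> k; split; [by move=> x; exact: df|exact: cp|].
elim/ord3_ind: k.
- by apply: bounded_in_boxW H1; lra.
- by apply: bounded_in_boxW H2; lra.
- by apply: bounded_in_boxW H3; lra.
Qed.

Lemma test_function_C1_in_box (eta : R3 R -> R[i]) : test_function eta ->
  (exists M L : R, C1_in_box (fun x => Re (eta x)) M L) /\
  (exists M L : R, C1_in_box (fun x => Im (eta x)) M L).
Proof.
move=> [s1 s2 cK].
have K0 x : ~ closure [set x | eta x != 0] x -> eta x = 0.
  by move=> nK; apply/eqP; apply: contrapT => /negP h; apply: nK; exact: subset_closure.
by split; apply: smooth_C1_in_box cK _ => // x /K0 ->.
Qed.

Lemma memLp2_int (phi : R3 R -> C4 R) : memLp 2%:E phi ->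
  exists B : R, (\int[mu3]_x (normC4 (phi x) * normC4 (phi x))%:E <= B%:E)%E.
Proof.
move=> [mphi N2].
have E : (\int[mu3]_x (normC4 (phi x) * normC4 (phi x))%:E =
    'N[mu3]_2%:E [(fun x => (normC4 (phi x))%:E)] `^ 2)%E.
  rewrite powR_Lnorm//; apply: eq_integral => x _.
  by rewrite gee0_abs ?lee_fin ?normC4_ge0// poweR_EFin powR_mulrn ?normC4_ge0// expr2.
have fin : ('N[mu3]_2%:E [(fun x => (normC4 (phi x))%:E)] `^ 2 < +oo)%E by exact: poweR_lty.
rewrite E; exists (fine ('N[mu3]_2%:E [(fun x => (normC4 (phi x))%:E)] `^ 2)%E).
by rewrite fineK// ge0_fin_numE// poweR_ge0.
Qed.

(** For finite [p], [|psi|^p <= K^(p-2) |psi|^2]. *)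
Lemma memLp_bounded_L2 (psi : R3 R -> C4 R) (K B : R) (p : \bar R) : mxmeasurable psi ->
  (forall x, normC4 (psi x) <= K) ->
  (\int[mu3]_x (normC4 (psi x) * normC4 (psi x))%:E <= B%:E)%E ->
  (2%:E <= p)%E -> memLp p psi.
Proof.
move=> mpsi pK pB p2; split => //.
have n0 x := normC4_ge0 (psi x).
have K0 : 0 <= K by apply: le_trans (pK (0, 0, 0)).
have mn := measurable_normC4 mpsi.
case: p p2 => [r|_|//].
  rewrite lee_fin => r2; rewrite unlock /Lnorm.
  apply: poweR_lty; apply: (@le_lt_trans _ _ (K `^ (r - 2) * B)%:E); last by rewrite ltry.
  apply: (@le_trans _ _ (\int[mu3]_x ((K `^ (r - 2))%:E * (normC4 (psi x) * normC4 (psi x))%:E)))%E.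
    apply: ge0_le_integral => //.
    - by move=> x _; exact: poweR_ge0.
    - apply: (measurableT_comp (measurable_poweR _)).
      by apply: measurableT_comp => //; exact/measurable_EFinP.
    - by apply: emeasurable_funM => //; apply/measurable_EFinP; exact: measurable_funM.
    - move=> x _; rewrite gee0_abs ?lee_fin//.
      have [->|nN] := eqVneq (normC4 (psi x)) 0.
        by rewrite mulr0 mulr0 powR0// gt_eqF// (lt_le_trans _ r2).
      have -> : normC4 (psi x) `^ r = normC4 (psi x) `^ (r - 2) * normC4 (psi x) `^ 2.
        by rewrite -powRD ?nN ?implybT// subrK.
      rewrite powR_mulrn// -expr2.
      rewrite ler_wpM2r ?sqr_ge0//; apply: ge0_ler_powR; rewrite ?nnegrE ?subr_ge0//.
  rewrite ge0_integralZl//.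
  - by rewrite EFinM lee_wpmul2l// lee_fin powR_ge0.
  - by apply/measurable_EFinP; exact: measurable_funM.
  - by move=> x _; rewrite lee_fin mulr_ge0.
  - by rewrite lee_fin powR_ge0.
rewrite unlock /Lnorm; case: ifPn => // _.
apply: (@le_lt_trans _ _ K%:E); last by rewrite ltry.
by apply/ess_supP; apply: nearW => x /=; rewrite lee_fin ger0_norm.
Qed.

Lemma locally_integrable_bounded (psi : R3 R -> C4 R) (K : R) : mxmeasurable psi ->
  (forall x, normC4 (psi x) <= K) -> locally_integrable3 psi.
Proof.
move=> mpsi pK; split => // A cA.
have n0 x := normC4_ge0 (psi x).
have K0 : 0 <= K by apply: le_trans (pK (0, 0, 0)).
have [L L0 HL] := compact_box cA.
have clA : closed A by apply: compact_closed => //; exact: norm_hausdorff.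
have mA : measurable (A : set (R3 R)).
  by rewrite -(setCK A); apply: measurableC; apply: open_measurable3; exact: closed_openC.
have [m p i] := ge0_int_leZ K0 (ge0_int_le_boxind L0).
apply: le_lt_trans (le_lt_trans i (ltry _)).
rewrite [leLHS]integral_mkcond; apply: ge0_le_integral => //.
- by move=> x _; rewrite /patch; case: ifP => // _; rewrite lee_fin.
- apply/(measurable_restrictT _ mA).
  have h : measurable_fun [set: R3 R] (fun x => (normC4 (psi x))%:E).
    by apply/measurable_EFinP; exact: measurable_normC4.
  exact: (measurable_funS measurableT (@subsetT _ _) h).
- exact/measurable_EFinP.
- move=> x _; rewrite /patch; case: ifPn => [/set_mem/HL bx|_]; rewrite lee_fin//.
  by rewrite boxindE bx mulr1.
Qed.

Definition cpot (m : 'I_3) (u : R3 R -> R[i]) (x : R3 R) : R[i] :=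
  (pot m (fun y => Re (u y)) x) +i* (pot m (fun y => Im (u y)) x).

Lemma cpotE m u x : cpot m u x = cintegral (fun y => (field_reg 0 m y x)%:C * u y).
Proof.
apply: complexP; rewrite /cpot /cintegral/= /pot; apply: eq_Rintegral => y _.
- by rewrite ReM/= mul0r subr0.
- by rewrite ImM/= mul0r addr0.
Qed.

Lemma G0_kernelE (x y : R3 R) i j : G0_kernel x y i j =
  \sum_m ('i%C * ((4 * pi)^-1)%:C * alpha m i j) * (field_reg 0 m y x)%:C.
Proof.
rewrite /G0_kernel !mxE summxE mulr_sumr; apply: eq_bigr => m _.
rewrite mxE /field_reg /rdist expr0n add0r norm3_dist2.
have -> : coord3 m (x - y) = dcoord m y x by elim/ord3_ind: m.
by rewrite invfM -exprVn !rmorphM/=; ring.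
Qed.

Lemma C4_addxx_inj (u w : C4 R) : u + u = w + w -> u = w.
Proof.
move=> h; apply/colP => i; have := congr1 (fun z : C4 R => z i 0) h.
rewrite [LHS]mxE [RHS]mxE => e; apply: complexP.
- by have := congr1 Re e; rewrite !ReD; lra.
- by have := congr1 Im e; rewrite !ImD; lra.
Qed.

Section Bounds.
Variables (F : R3 R -> R) (c : R) (f : R3 R -> C4 R).
Hypotheses (mF : measurable_fun setT F) (F0 : forall x, (0 <= F x)%R) (c0 : (0 < c)%R).
Hypothesis mf : mxmeasurable f.
Hypothesis fF : forall y j, cmod (f y j 0) <= c * (beta3 y * F y).

Let mRe j : measurable_fun setT (fun y => Re (f y j 0)). Proof. by case: (mf j 0). Qed.
Let mIm j : measurable_fun setT (fun y => Im (f y j 0)). Proof. by case: (mf j 0). Qed.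
Let bRe j y : `|Re (f y j 0)| <= c * (beta3 y * F y).
Proof. exact: le_trans (Re_le_cmod _) (fF y j). Qed.
Let bIm j y : `|Im (f y j 0)| <= c * (beta3 y * F y).
Proof. exact: le_trans (Im_le_cmod _) (fF y j). Qed.

Lemma cpot_le m j x : ((cmod (cpot m (fun y => f y j 0) x))%:E <= (2 * c)%:E * riesz F x)%E.
Proof.
have h1 := pot_le mF F0 c0 m x (mRe j) (bRe j).
have h2 := pot_le mF F0 c0 m x (mIm j) (bIm j).
apply: (@le_trans _ _ ((`|pot m (fun y => Re (f y j 0)) x|)%:E + (`|pot m (fun y => Im (f y j 0)) x|)%:E)%E).
  by rewrite -EFinD lee_fin; exact: cmod_le_ReIm.
apply: le_trans (leeD h1 h2) _.
by rewrite mulr_natl mulr2n EFinD ge0_muleDl// lee_fin ltW.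
Qed.

Lemma cpot_cintegrable m j x : (riesz F x < +oo)%E ->
  cintegrable (fun y => (field_reg 0 m y x)%:C * f y j 0).
Proof.
move=> Hx; split.
- have := pot_integrable mF F0 c0 m (mRe j) (bRe j) Hx; apply: eq_integrable => // y _.
  by rewrite ReM/= mul0r subr0.
- have := pot_integrable mF F0 c0 m (mIm j) (bIm j) Hx; apply: eq_integrable => // y _.
  by rewrite ImM/= mul0r addr0.
Qed.

Lemma G0E x i : (riesz F x < +oo)%E ->
  G0 f x i 0 = \sum_m \sum_j ('i%C * ((4 * pi)^-1)%:C * alpha m i j) * cpot m (fun y => f y j 0) x.
Proof.
move=> Hx; rewrite mxE.
have ic m j := cpot_cintegrable m j Hx.
transitivity (cintegral (fun y => \sum_m \sum_j
    ('i%C * ((4 * pi)^-1)%:C * alpha m i j) * ((field_reg 0 m y x)%:C * f y j 0))).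
  apply: eq_cintegral => y; rewrite mxE exchange_big/=; apply: eq_bigr => j _.
  by rewrite G0_kernelE mulr_suml; apply: eq_bigr => m _; rewrite mulrA.
rewrite cintegral_sum; last first.
  by move=> m; apply: cintegrable_sum => j; exact: cintegrableZ.
apply: eq_bigr => m _; rewrite cintegral_sum; last by move=> j; exact: cintegrableZ.
by apply: eq_bigr => j _; rewrite cintegralZ// cpotE.
Qed.

Lemma G0_le : exists2 C : R, 0 < C & forall x i, ((cmod (G0 f x i 0))%:E <= C%:E * riesz F x)%E.
Proof.
pose q m (i j : 'I_4) := cmod ('i%C * ((4 * pi)^-1)%:C * alpha m i j : R[i]).
pose C := \sum_(i : 'I_4) \sum_m \sum_(j : 'I_4) q m i j * (2 * c) + 1.
have q0 m i j : 0 <= q m i j * (2 * c) by rewrite mulr_ge0 ?cmod_ge0// mulr_ge0// ltW.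
have C0 : 0 < C.
  by rewrite ltr_wpDl//; do 3 (apply: sumr_ge0 => ? _).
exists C => // x i.
have [->|Hx] := eqVneq (riesz F x) +oo%E; first by rewrite gt0_muley ?lte_fin// leey.
have Hfin : (riesz F x < +oo)%E by rewrite lt_neqAle Hx leey.
rewrite (G0E i Hfin).
have H0 := riesz_ge0 F0 x.
have Hf : riesz F x \is a fin_num by rewrite ge0_fin_numE.
rewrite -(fineK Hf) -EFinM lee_fin.
have f0 : 0 <= fine (riesz F x) by exact: fine_ge0.
apply: le_trans (cmod_sum _ _ _) _.
apply: (@le_trans _ _ (\sum_m \sum_j q m i j * (2 * c) * fine (riesz F x))).
  apply: ler_sum => m _; apply: le_trans (cmod_sum _ _ _) _; apply: ler_sum => j _.
  rewrite cmodM -[leRHS]mulrA ler_wpM2l ?cmod_ge0//.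
  by rewrite -lee_fin EFinM fineK//; exact: cpot_le.
under eq_bigr do rewrite -mulr_suml; rewrite -mulr_suml ler_wpM2r// /C (bigD1 i)//= -addrA lerDl.
by rewrite addr_ge0//; do 3 (apply: sumr_ge0 => ? _).
Qed.

Lemma mxmeasurable_G0 : (forall x, riesz F x < +oo)%E -> mxmeasurable (G0 f).
Proof.
move=> Hx i j; rewrite (ord1 j).
rewrite (_ : (fun x => _) = (fun x => \sum_m \sum_j ('i%C * ((4 * pi)^-1)%:C * alpha m i j) * cpot m (fun y => f y j 0) x)); last first.
  by apply/funext => x; exact: G0E.
apply: cmeasurable_sum => m; apply: cmeasurable_sum => k; apply: cmeasurableM.
  exact: cmeasurable_cst.
by split; apply: measurable_pot.
Qed.

Section Distribution.
Variable D : R.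
Hypothesis HD : forall x, (riesz F x <= D%:E)%E.
Variable eta : R3 R -> R[i].
Hypothesis teta : test_function eta.

Let Hfin x : (riesz F x < +oo)%E. Proof. by apply: le_lt_trans (HD x) _; rewrite ltry. Qed.

Definition cnewton k m (y : R3 R) : R[i] :=
  newton (fun x => Re (eta x)) k m y +i* newton (fun x => Im (eta x)) k m y.

Lemma cnewton_sym k m y : cnewton k m y = cnewton m k y.
Proof.
have [[M1 [L1 t1]] [M2 [L2 t2]]] := test_function_C1_in_box teta.
by rewrite /cnewton (newton_sym k m y t1) (newton_sym k m y t2).
Qed.

(** Up to the sign, this is the fundamental solution property of the Newton kernel,
    integrated by parts once. *)
Lemma cnewton_trace y : \sum_k cnewton k k y = - ((4 * pi)%:C * eta y).
Proof.
have [[M1 [L1 t1]] [M2 [L2 t2]]] := test_function_C1_in_box teta.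
have n1 := newton_trace y t1; have n2 := newton_trace y t2.
apply: complexP.
- by rewrite (big_morph Re ReD (erefl _)) n1 ReN ReM/= mul0r subr0 mulrC.
- by rewrite (big_morph Im ImD (erefl _)) n2 ImN ImM/= mul0r addr0 mulrC.
Qed.

Lemma cnewton_cintegrable k m j : cintegrable (fun y => cnewton k m y * f y j 0).
Proof.
have [[M1 [L1 [L10 _ _ /(_ k)[_ _ b1]]]] [M2 [L2 [L20 _ _ /(_ k)[_ _ b2]]]]] := test_function_C1_in_box teta.
pose N1 := newton (fun x => Re (eta x)) k m; pose N2 := newton (fun x => Im (eta x)) k m.
have i1 : mu3.-integrable setT (fun y => (N1 y * Re (f y j 0))%:E) :=
  newton_mul_integrable mF F0 c0 HD m (mRe j) (bRe j) L10 b1.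
have i2 : mu3.-integrable setT (fun y => (N2 y * Im (f y j 0))%:E) :=
  newton_mul_integrable mF F0 c0 HD m (mIm j) (bIm j) L20 b2.
have i3 : mu3.-integrable setT (fun y => (N1 y * Im (f y j 0))%:E) :=
  newton_mul_integrable mF F0 c0 HD m (mIm j) (bIm j) L10 b1.
have i4 : mu3.-integrable setT (fun y => (N2 y * Re (f y j 0))%:E) :=
  newton_mul_integrable mF F0 c0 HD m (mRe j) (bRe j) L20 b2.
split.
- have := integrableB_EFin i1 i2; apply: eq_integrable => // y _.
  by rewrite ReM.
- have := integrableD_EFin i3 i4; apply: eq_integrable => // y _.
  by rewrite ImM.
Qed.

Lemma cpartial_cpot_cintegrable k m j :
  cintegrable (fun x => cpartial k eta x * cpot m (fun y => f y j 0) x).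
Proof.
have [[M1 [L1 [L10 _ _ /(_ k)[_ _ b1]]]] [M2 [L2 [L20 _ _ /(_ k)[_ _ b2]]]]] := test_function_C1_in_box teta.
pose a1 := partial k (fun x => Re (eta x)); pose a2 := partial k (fun x => Im (eta x)).
have p1 : mu3.-integrable setT (fun x => (a1 x * pot m (fun y => Re (f y j 0)) x)%:E) :=
  mul_pot_integrable mF F0 c0 HD m (mRe j) (bRe j) L10 b1.
have p2 : mu3.-integrable setT (fun x => (a2 x * pot m (fun y => Im (f y j 0)) x)%:E) :=
  mul_pot_integrable mF F0 c0 HD m (mIm j) (bIm j) L20 b2.
have p3 : mu3.-integrable setT (fun x => (a1 x * pot m (fun y => Im (f y j 0)) x)%:E) :=
  mul_pot_integrable mF F0 c0 HD m (mIm j) (bIm j) L10 b1.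
have p4 : mu3.-integrable setT (fun x => (a2 x * pot m (fun y => Re (f y j 0)) x)%:E) :=
  mul_pot_integrable mF F0 c0 HD m (mRe j) (bRe j) L20 b2.
split.
- have := integrableB_EFin p1 p2; apply: eq_integrable => [//|x _].
  by rewrite /a1 /a2 [in RHS]ReM.
- have := integrableD_EFin p3 p4; apply: eq_integrable => [//|x _].
  by rewrite /a1 /a2 [in RHS]ImM.
Qed.

Lemma cpot_fubini k m j :
  cintegral (fun x => cpartial k eta x * cpot m (fun y => f y j 0) x) =
  cintegral (fun y => cnewton k m y * f y j 0).
Proof.
have [[M1 [L1 [L10 _ _ /(_ k)[_ _ b1]]]] [M2 [L2 [L20 _ _ /(_ k)[_ _ b2]]]]] := test_function_C1_in_box teta.
pose N1 := newton (fun x => Re (eta x)) k m; pose N2 := newton (fun x => Im (eta x)) k m.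
pose a1 := partial k (fun x => Re (eta x)); pose a2 := partial k (fun x => Im (eta x)).
have i1 : mu3.-integrable setT (fun y => (N1 y * Re (f y j 0))%:E) :=
  newton_mul_integrable mF F0 c0 HD m (mRe j) (bRe j) L10 b1.
have i2 : mu3.-integrable setT (fun y => (N2 y * Im (f y j 0))%:E) :=
  newton_mul_integrable mF F0 c0 HD m (mIm j) (bIm j) L20 b2.
have i3 : mu3.-integrable setT (fun y => (N1 y * Im (f y j 0))%:E) :=
  newton_mul_integrable mF F0 c0 HD m (mIm j) (bIm j) L10 b1.
have i4 : mu3.-integrable setT (fun y => (N2 y * Re (f y j 0))%:E) :=
  newton_mul_integrable mF F0 c0 HD m (mRe j) (bRe j) L20 b2.
have p1 : mu3.-integrable setT (fun x => (a1 x * pot m (fun y => Re (f y j 0)) x)%:E) :=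
  mul_pot_integrable mF F0 c0 HD m (mRe j) (bRe j) L10 b1.
have p2 : mu3.-integrable setT (fun x => (a2 x * pot m (fun y => Im (f y j 0)) x)%:E) :=
  mul_pot_integrable mF F0 c0 HD m (mIm j) (bIm j) L20 b2.
have p3 : mu3.-integrable setT (fun x => (a1 x * pot m (fun y => Im (f y j 0)) x)%:E) :=
  mul_pot_integrable mF F0 c0 HD m (mIm j) (bIm j) L10 b1.
have p4 : mu3.-integrable setT (fun x => (a2 x * pot m (fun y => Re (f y j 0)) x)%:E) :=
  mul_pot_integrable mF F0 c0 HD m (mRe j) (bRe j) L20 b2.
have e1 : \int[mu3]_x (a1 x * pot m (fun y => Re (f y j 0)) x) =
    \int[mu3]_y (N1 y * Re (f y j 0)) := pot_fubini mF F0 c0 HD m (mRe j) (bRe j) L10 b1.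
have e2 : \int[mu3]_x (a2 x * pot m (fun y => Im (f y j 0)) x) =
    \int[mu3]_y (N2 y * Im (f y j 0)) := pot_fubini mF F0 c0 HD m (mIm j) (bIm j) L20 b2.
have e3 : \int[mu3]_x (a1 x * pot m (fun y => Im (f y j 0)) x) =
    \int[mu3]_y (N1 y * Im (f y j 0)) := pot_fubini mF F0 c0 HD m (mIm j) (bIm j) L10 b1.
have e4 : \int[mu3]_x (a2 x * pot m (fun y => Re (f y j 0)) x) =
    \int[mu3]_y (N2 y * Re (f y j 0)) := pot_fubini mF F0 c0 HD m (mRe j) (bRe j) L20 b2.
apply: complexP; rewrite /cintegral/=.
- transitivity (\int[mu3]_x (a1 x * pot m (fun y => Re (f y j 0)) x - a2 x * pot m (fun y => Im (f y j 0)) x)).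
    by [].
  transitivity (\int[mu3]_y (N1 y * Re (f y j 0) - N2 y * Im (f y j 0))); last first.
    by apply: eq_Rintegral => y _; rewrite ReM.
  by rewrite (RintegralB measurableT p1 p2) (RintegralB measurableT i1 i2) e1 e2.
- transitivity (\int[mu3]_x (a1 x * pot m (fun y => Im (f y j 0)) x + a2 x * pot m (fun y => Re (f y j 0)) x)).
    by apply: eq_Rintegral => x _; rewrite /a1 /a2 /N1 /N2; ring.
  transitivity (\int[mu3]_y (N1 y * Im (f y j 0) + N2 y * Re (f y j 0))); last first.
    by apply: eq_Rintegral => y _; rewrite ImM.
  by rewrite (RintegralD measurableT p3 p4) (RintegralD measurableT i3 i4) e3 e4.
Qed.

Let Z k m : C4 R := \col_j cintegral (fun y => cnewton k m y * f y j 0).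

Let ZC k m : Z k m = Z m k.
Proof.
apply/colP => j; rewrite /Z [LHS]mxE [RHS]mxE; apply: eq_cintegral => y.
by rewrite [cnewton k m y]cnewton_sym.
Qed.

Let Z_trace : \sum_k Z k k = - (4 * pi)%:C *: regular_dist f eta.
Proof.
apply/colP => j; rewrite summxE !mxE.
have ieta : cintegrable (fun y => \sum_k cnewton k k y * f y j 0).
  by apply: cintegrable_sum => k; exact: cnewton_cintegrable.
transitivity (cintegral (fun y => \sum_k cnewton k k y * f y j 0)).
  rewrite cintegral_sum; last by move=> k; exact: cnewton_cintegrable.
  by apply: eq_bigr => k _; rewrite mxE.
have p0 : (4 * pi : R) != 0 by rewrite mulf_neq0// gt_eqF// pi_gt0.
have E y : - (4 * pi)%:C^-1 * (\sum_k cnewton k k y * f y j 0) = (eta y *: f y) j 0.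
  rewrite mxE -mulr_suml cnewton_trace mulNr [X in - (_ * X)]mulNr mulrN opprK !mulrA mulVf ?mul1r//.
  by rewrite fmorph_eq0.
have -> : cintegral (fun y => (eta y *: f y) j 0) =
    - (4 * pi)%:C^-1 * cintegral (fun y => \sum_k cnewton k k y * f y j 0).
  by rewrite -cintegralZ//; apply: eq_cintegral => y; rewrite E.
by rewrite mulNr [X in - (_ * X)]mulNr mulrN opprK mulrA mulfV ?mul1r// fmorph_eq0.
Qed.

(** Since [Z k m] is symmetric, the double sum is half the sum over the
    anticommutators of the Dirac matrices, which vanish off the diagonal. *)
Let clifford : \sum_k \sum_m alpha k *m (alpha m *m Z k m) = \sum_k Z k k.
Proof.
set S := LHS.
have S' : S = \sum_k \sum_m alpha m *m (alpha k *m Z k m).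
  by rewrite /S exchange_big/=; apply: eq_bigr => k _; apply: eq_bigr => m _; rewrite ZC.
have : S + S = \sum_k Z k k + \sum_k Z k k.
  rewrite {2}S' -!big_split/=; apply: eq_bigr => k _; rewrite -big_split/=.
  rewrite (bigD1 k)//= big1 ?addr0 => [|m mk].
    by rewrite !mulmxA -mulmxDl alpha_anticomm eqxx mulr1 mul_scalar_mx scaler_nat mulr2n.
  by rewrite !mulmxA -mulmxDl alpha_anticomm eq_sym (negbTE mk) mulr0 raddf0 mul0mx.
exact: C4_addxx_inj.
Qed.

Let c4 : R[i] := 'i%C * ((4 * pi)^-1)%:C.

Let regular_dist_psi k :
  regular_dist (fun x => - G0 f x) (cpartial k eta) = - c4 *: \sum_m alpha m *m Z k m.
Proof.
apply/colP => i; rewrite !mxE summxE mulr_sumr.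
have ic m j : cintegrable (fun x => (- c4 * alpha m i j) *
    (cpartial k eta x * cpot m (fun y => f y j 0) x)).
  by apply: cintegrableZ; exact: cpartial_cpot_cintegrable.
transitivity (cintegral (fun x => \sum_m \sum_j (- c4 * alpha m i j) *
    (cpartial k eta x * cpot m (fun y => f y j 0) x))).
  apply: eq_cintegral => x; rewrite 2!mxE (G0E i (Hfin x)) mulrN mulr_sumr -sumrN.
  apply: eq_bigr => m _; rewrite mulr_sumr -sumrN; apply: eq_bigr => j _.
  by rewrite -/c4; ring.
rewrite cintegral_sum; last by move=> m; exact: cintegrable_sum.
apply: eq_bigr => m _; rewrite cintegral_sum// mxE mulr_sumr; apply: eq_bigr => j _.
rewrite cintegralZ; last exact: cpartial_cpot_cintegrable.
rewrite cpot_fubini [Z k m j 0]mxE; exact/esym/mulrA.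
Qed.

(** [D0 (G0 f) = f] in the sense of distributions: the derivatives of [G0 f] tested against
    [eta] are the integrals [Z k m] of [f] against the second derivatives of the Newton
    potential of [eta], and [clifford] reduces their combination to [Z_trace]. *)
Lemma D0_G0 : D0 (regular_dist (fun x => - G0 f x)) eta = - regular_dist f eta.
Proof.
have p0 : (4 * pi : R) != 0 by rewrite mulf_neq0// gt_eqF// pi_gt0.
rewrite /D0 /dist_partial.
under eq_bigr do rewrite regular_dist_psi -scaleNr opprK -scalemxAr mulmx_sumr.
rewrite -scaler_sumr clifford Z_trace !scalerA.
have -> : - 'i%C * c4 * - (4 * pi)%:C = - 1 :> R[i].
  rewrite /c4 mulrN mulNr mulNr opprK mulrA -expr2 sqr_i mulN1r mulNr -rmorphM/=.
  by rewrite mulVf.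
by rewrite scaleN1r.
Qed.

End Distribution.
End Bounds.
End Assembly.

(** * Boundedness of H and the theorem *)

Section Bootstrap.
Context {R : realType}.
Local Open Scope ereal_scope.

(** Inserting the a.e. bound of [F] into the integral [riesz F x] gives the integral of
    [kappa3 x y] against [riesz F y], which [riesz_sup] bounds. *)
Lemma riesz_bootstrap (F : R3 R -> R) (C B : R) : (0 < C)%R ->
  measurable_fun setT F -> (forall x, 0 <= F x)%R -> \int[mu3]_x (F x * F x)%:E <= B%:E ->
  {ae mu3, forall x, (F x)%:E <= C%:E * riesz F x} ->
  exists D : R, forall x, riesz F x <= D%:E.
Proof.
move=> C0 mF F0 FB FC.
have [A A0 HA] := @riesz_sup R.
exists (C * (A * (1 + B)))%R => x.
have mk : measurable_fun setT (fun y => kappa3 x y) := measurable_section_l x measurable_kappa3.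
have mr := measurable_riesz mF F0.
have r0 y := riesz_ge0 F0 y.
have k0 y : 0 <= (kappa3 x y)%:E * riesz F y by rewrite mule_ge0 ?lee_fin ?kappa3_ge0.
have mkr : measurable_fun setT (fun y => (kappa3 x y)%:E * riesz F y).
  by apply: emeasurable_funM => //; exact/measurable_EFinP.
apply: (@le_trans _ _ (\int[mu3]_y (C%:E * ((kappa3 x y)%:E * riesz F y)))).
  apply: ae_ge0_le_integral => //.
  - by move=> y _; rewrite lee_fin mulr_ge0 ?kappa3_ge0// mulr_ge0 ?beta3_ge0.
  - apply/measurable_EFinP; apply: measurable_funM => //; apply: measurable_funM => //.
    exact: measurable_beta3.
  - by move=> y _; rewrite mule_ge0// lee_fin ltW.
  - by apply: emeasurable_funM.
  - apply: filterS FC => y Fy _; rewrite EFinM muleCA lee_wpmul2l ?lee_fin ?kappa3_ge0//.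
    apply: le_trans Fy; rewrite lee_fin; exact: ler_piMl (beta3_le1 y).
rewrite ge0_integralZl//; last by rewrite lee_fin ltW.
rewrite EFinM lee_wpmul2l ?lee_fin ?(ltW C0)//.
exact: HA.
Qed.

End Bootstrap.

Section Equation.
Context {R : realType}.
Local Open Scope complex_scope.
Local Open Scope sesquilinear_scope.

Lemma cmeasurable_test (eta : R3 R -> R[i]) : test_function eta -> cmeasurable eta.
Proof.
move=> [/(_ [::])[c1 _] /(_ [::])[c2 _] _].
by split; exact: continuous_measurable3.
Qed.

Lemma ae_eq_regular_dist (f g : R3 R -> C4 R) (eta : R3 R -> R[i]) : cmeasurable eta ->
  mxmeasurable f -> mxmeasurable g -> {ae mu3, forall x, f x = g x} ->
  regular_dist f eta = regular_dist g eta.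
Proof.
move=> me mf mg fg; apply/colP => j; rewrite [LHS]mxE [RHS]mxE.
apply: ae_eq_cintegral.
- by under eq_fun do rewrite mxE; exact: cmeasurableM.
- by under eq_fun do rewrite mxE; exact: cmeasurableM.
- by apply: filterS fg => x ->.
Qed.

Lemma Umx_entry (lam : 'rV[R]_4) i j : cmod (Umx lam i j) <= 1.
Proof.
rewrite /Umx /diag4 !mxE; case: eqVneq => _; last by rewrite mulr0n cmod0.
rewrite mulr1n cmod_real /sign1; case: ifP => _; rewrite ?normrN normr1//.
Qed.

Lemma normC4_le (u : C4 R) (a : R) : (forall i, cmod (u i 0) <= a) -> normC4 u <= 4 * a.
Proof.
move=> ua; apply: le_trans (normC4_le_sum u) _.
apply: le_trans (ler_sum _ (fun i _ => ua i)) _.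
by rewrite sumr_const card_ord mulr_natl.
Qed.

Lemma mxmeasurableN m n (G : R3 R -> 'M[R[i]]_(m, n)) : mxmeasurable G ->
  mxmeasurable (fun x => - G x).
Proof.
move=> mG i j; have [m1 m2] := mG i j; split.
- by under eq_fun do rewrite mxE ReN; exact: measurableT_comp.
- by under eq_fun do rewrite mxE ImN; exact: measurableT_comp.
Qed.

End Equation.

Theorem lemma6p1 (R : realType) (V B : R3 R -> M4 R)
    (lam : R3 R -> 'rV[R]_4) (eps : R) (phi : R3 R -> C4 R) :
  mxmeasurable V ->
  (forall x, V x \is hermsymmx) ->
  0 < eps ->
  decays V (2 + eps) ->
  diagonalizes V B lam ->
  ker_T0 B lam phi ->
  exists psi : R3 R -> C4 R,
    [/\ {ae mu3, forall x,
           phi x = Umx (lam x) *m (vmx (B x) (lam x) *m psi x)},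
        distributional_solution V psi,
        memLp 2%:E psi,
        ~ ae_zero phi -> zero_energy_eigenfunction V psi &
        forall p : \bar R, (2%:E <= p)%E -> memLp p psi].
Proof.
move=> mV _ e0 dV dg [phi2 T0phi].
have [mB ml uB VE] := dg.
have d2 : 2 <= 2 + eps by lra.
have [C C0 hC] := vmx_decay d2 dV dg.
have [mphi _] := phi2.
have [Bd HBd] := memLp2_int phi2.
pose F x := normC4 (phi x).
have mF : measurable_fun setT F := measurable_normC4 mphi.
have F0 x : 0 <= F x := normC4_ge0 (phi x).
pose w x := vmx (B x) (lam x).
have mw : mxmeasurable w := mxmeasurable_vmx mB ml.
pose f x := (w x ^t*)%sesqui *m phi x.
have mf : mxmeasurable f := mxmeasurableM (mxmeasurable_adj mw) mphi.
(* The summand 1 only makes the constant positive; the 4 comes from the matrix product. *)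
pose c := 4 * C + 1.
have c0 : 0 < c by rewrite /c; lra.
have fF y j : cmod (f y j 0) <= c * (beta3 y * F y).
  apply: le_trans (cmod_mulmx_le (a := C * beta3 y) (b := F y) _ _ _ _) _.
  - by move=> i k; rewrite ctmxE cmod_conj; exact: hC.
  - by move=> i k; rewrite (ord1 k); exact: cmod_le_normC4.
  - have bF : 0 <= beta3 y * F y by rewrite mulr_ge0 ?beta3_ge0.
    by rewrite -(mulrA C) (mulrA 4) ler_wpM2r ?lerDl.
have [K K0 hK] := G0_le mF F0 c0 mf fF.
pose psi x := - G0 f x.
have phiE : {ae mu3, forall x, phi x = Umx (lam x) *m (w x *m psi x)}.
  apply: filterS T0phi => x; rewrite /T0 -/f -/(w x) => /eqP; rewrite addr_eq0 => /eqP E.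
  by rewrite /psi mulmxN -E mulmxA Umx_sqr mul1mx.
have psi_entry x i : ((cmod (psi x i 0))%:E <= K%:E * riesz F x)%E.
  by rewrite /psi mxE cmodN.
(* The entries of [U] and [v] are at most [1] and [C + 1]; two matrix products and the
   norm on vectors contribute a factor [4] each. *)
have FC : {ae mu3, forall x, ((F x)%:E <= (64 * (C + 1) * K)%:E * riesz F x)%E}.
  apply: filterS phiE => x E.
  have CK : 0 < 64 * (C + 1) * K by rewrite !mulr_gt0//; lra.
  have [->|Hx] := eqVneq (riesz F x) +oo%E; first by rewrite gt0_muley ?lte_fin// leey.
  have r0 := riesz_ge0 F0 x.
  have Hf : riesz F x \is a fin_num by rewrite ge0_fin_numE// lt_neqAle Hx leey.
  have psi_x i k : cmod (psi x i k) <= K * fine (riesz F x).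
    by rewrite (ord1 k) -lee_fin EFinM fineK.
  rewrite -(fineK Hf) -EFinM lee_fin.
  have s0 : 0 <= fine (riesz F x) by exact: fine_ge0.
  have w_x i k : cmod (w x i k) <= C + 1.
    apply: le_trans (hC x i k) _; rewrite -[leRHS]mulr1.
    by apply: ler_pM; rewrite ?beta3_ge0 ?beta3_le1//; lra.
  have U_x i k : cmod (Umx (lam x) i k) <= 1 := Umx_entry _ _ _.
  rewrite /F E; apply: le_trans (normC4_le (fun i => cmod_mulmx_le i 0 U_x
    (fun i k => cmod_mulmx_le i k w_x psi_x))) _.
  by rewrite le_eqVlt; apply/orP; left; apply/eqP; ring.
have CK : 0 < 64 * (C + 1) * K by rewrite !mulr_gt0//; lra.
have [D HD] := riesz_bootstrap CK mF F0 HBd FC.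
have Hfin x : (riesz F x < +oo)%E by apply: le_lt_trans (HD x) _; rewrite ltry.
have r0 x := riesz_ge0 F0 x.
have Hf x : riesz F x \is a fin_num by rewrite ge0_fin_numE.
have mpsi : mxmeasurable psi.
  by apply: mxmeasurableN; exact: (mxmeasurable_G0 mF F0 c0 mf fF Hfin).
have psi_le x : normC4 (psi x) <= 4 * (K * fine (riesz F x)).
  by apply: normC4_le => i; rewrite -lee_fin EFinM fineK.
have psi_bd x : normC4 (psi x) <= 4 * (K * D).
  apply: le_trans (psi_le x) _; rewrite ler_wpM2l// ler_wpM2l ?(ltW K0)//.
  by rewrite -lee_fin fineK.
have [A A0 HA] := @riesz_L2 R.
have psiL2 : (\int[mu3]_x (normC4 (psi x) * normC4 (psi x))%:E <= (16 * K ^+ 2 * (A * Bd))%:E)%E.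
  apply: (@le_trans _ _ (\int[mu3]_x ((16 * K ^+ 2)%:E * (riesz F x * riesz F x)))%E).
    apply: ge0_le_integral => //.
    - by move=> x _; rewrite lee_fin mulr_ge0 ?normC4_ge0.
    - by apply/measurable_EFinP; apply: measurable_funM; exact: measurable_normC4.
    - apply: emeasurable_funM => //.
      by apply: emeasurable_funM; exact: (measurable_riesz mF F0).
    - move=> x _; rewrite -(fineK (Hf x)) -!EFinM lee_fin.
      rewrite (_ : 16 * K ^+ 2 * (fine (riesz F x) * fine (riesz F x)) =
        (4 * (K * fine (riesz F x))) * (4 * (K * fine (riesz F x)))); last by ring.
      by apply: ler_pM; rewrite ?normC4_ge0.
  rewrite ge0_integralZl//.
  - rewrite [leRHS]EFinM lee_wpmul2l ?lee_fin ?mulr_ge0 ?sqr_ge0 ?(ltW K0)//.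
    exact: HA.
  - by apply: emeasurable_funM; exact: (measurable_riesz mF F0).
  - by move=> x _; rewrite mule_ge0.
  - by rewrite lee_fin mulr_ge0 ?sqr_ge0 ?(ltW K0).
have psiLp p : (2%:E <= p)%E -> memLp p psi by exact: (memLp_bounded_L2 mpsi psi_bd psiL2).
have VpsiE : {ae mu3, forall x, V x *m psi x = f x}.
  apply: filterS phiE => x E.
  by rewrite (factor_V (VE x)) /f E -/(w x) -!mulmxA.
have mVpsi : mxmeasurable (fun x => V x *m psi x) by exact: mxmeasurableM.
have sol : distributional_solution V psi.
  split.
  - exact: (locally_integrable_bounded mpsi psi_bd).
  - have [cV hV] := dV.
    have V_x x i k : cmod (V x i k) <= `|cV|.
      apply: le_trans (hV x i k) _.
      have J0 : 0 <= japanese x `^ (- (2 + eps)) := powR_ge0 _ _.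
      have J1 : japanese x `^ (- (2 + eps)) <= 1.
        apply: le_trans (japanese_beta3 x d2) _.
        by rewrite exprn_ile1 ?beta3_ge0 ?beta3_le1.
      apply: le_trans (ler_norm _) _; rewrite normrM (ger0_norm J0).
      by rewrite ler_piMr.
    have bd x : normC4 (V x *m psi x) <= 4 * (4%:R * (`|cV| * (4 * (K * D)))).
      apply: normC4_le => i; apply: cmod_mulmx_le => // j k.
      by rewrite (ord1 k); exact: le_trans (cmod_le_normC4 _ _) (psi_bd x).
    exact: (locally_integrable_bounded mVpsi bd).
  - move=> eta teta; rewrite /Hop (D0_G0 mF F0 c0 mf fF HD teta).
    rewrite (ae_eq_regular_dist (cmeasurable_test teta) mVpsi mf VpsiE).
    by rewrite addNr.
exists psi; split => //.
- exact: psiLp.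
- move=> phi0; split=> //; first exact: psiLp.
  move=> psi0; apply: phi0; apply: filterS2 psi0 phiE => x -> ->.
  by rewrite !mulmx0.
Qed.
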